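(* For every integer $q>1$, \[ (1+(-1)^q)T_{1^3,q}=3\pi^2(\zeta(q,1)+2\log(2)\zeta(q))-(q-3)\pi^2\zeta(q+1)-3T_{1^2,q+1}-3\widetilde{t}(q+2,1)-\widetilde{t}(q+3)+R_q, \] where \begin{align*} R_q&=(1-(-1)^q)\widetilde{t}(q+3)+(1+(-1)^q)6\log(2)\widetilde{t}(q+2)+(1-(-1)^q)12\log^2(2)\widetilde{t}(q+1)+(1+(-1)^q)8\log^3(2)\widetilde{t}(q)\\ &\quad-6\sum_{\substack{2k_1+k_2=q+2\\ k_1,k_2\geq 1}}\widetilde{t}(2k_1)\zeta(k_2+1)-24\log(2)\sum_{\substack{2k_1+k_2=q+1\\ k_1,k_2\geq 1}}\widetilde{t}(2k_1)\zeta(k_2+1)-24\log^2(2)\sum_{\substack{2k_1+k_2=q\\ k_1,k_2\geq 1}}\widetilde{t}(2k_1)\zeta(k_2+1)\\ &\quad+6\sum_{\substack{2k_1+k_2+k_3=q+1\\ k_1,k_2,k_3\geq 1}}\widetilde{t}(2k_1)\zeta(k_2+1)\zeta(k_3+1)+12\log(2)\sum_{\substack{2k_1+k_2+k_3=q\\ k_1,k_2,k_3\geq 1}}\widetilde{t}(2k_1)\zeta(k_2+1)\zeta(k_3+1)\\ &\quad-2\sum_{\substack{2k_1+k_2+k_3+k_4=q\\ k_1,k_2,k_3\geq 1}}\widetilde{t}(2k_1)\zeta(k_2+1)\zeta(k_3+1)\zeta(k_4+1) \end{align*} is the residue at $s=0$ of $\pi\tan(\pi s)\left(\Psi(1/2-s)\right)^3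 s^{-q}$.
   Context: Let $h_n=\sum_{k=1}^n (k-1/2)^{-1}$ for $n\ge0$. $T_{1^j,q}=\sum_{n\ge1}\frac{h_{n-1}^j}{(n-1/2)^q}$. $\Psi(-s)=\frac{1}{s+1/2}+\sum_{k\ge1}\left(\frac{1}{k-1/2}-\frac{1}{k-1/2-s}\right)$. For positive integers $s_1,\dots,s_k$ with $s_1>1$: $\widetilde{t}(s_1,\dots,s_k)=\sum_{n_1>\cdots>n_k\ge1}\prod_j (n_j-1/2)^{-s_j}$ and $\zeta(s_1,\dots,s_k)=\sum_{n_1>\cdots>n_k\ge1}\prod_j n_j^{-s_j}$; $\widetilde t(s)=(2^s-1)\zeta(s)$. In the last sum of $R_q$, $k_4$ ranges over positive integers. *)

(* Defs.v *)
From Stdlib Require Export Reals Arith.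
From Coquelicot Require Export Coquelicot.
Open Scope R_scope.


Definition half (n : nat) : R := INR n - 1 / 2.

Definition h (n : nat) : R := sum_n_m (fun k => / half k) 1 n.

Definition Series1 (f : nat -> R) : R := Series (fun n => f (S n)).

(* T_{1^j,q} *)
Definition T1 (j q : nat) : R :=
  Series1 (fun n => h (n - 1) ^ j / half n ^ q).

(* Multiple sums with base points [x n]:
   [msum_below x [s_1; ...; s_k] N] is the sum of prod_j (x n_j)^(-s_j) over
   N > n_1 > ... > n_k >= 1, and [msum] is its limit as N tends to infinity.
   For s_1 > 1 and the base points below the terms are positive and summable,
   so the order of summation is immaterial. *)
Fixpoint msum_below (x : nat -> R) (s : list nat) (N : nat) : R :=
  match s with
  | nil => 1
  | cons s1 s' =>
      sum_n_m (fun n => / (x n) ^ s1 * msum_below x s' n) 1 (N - 1)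
  end.

Definition msum (x : nat -> R) (s : list nat) : R :=
  real (Lim_seq (msum_below x s)).

Definition mzeta (s : list nat) : R := msum INR s.
Definition mttilde (s : list nat) : R := msum half s.

Definition zeta (s : nat) : R := mzeta (cons s nil).
Definition ttilde (s : nat) : R := mttilde (cons s nil).


Definition Ccos (z : C) : C :=
  (cos (Re z) * cosh (Im z), - (sin (Re z) * sinh (Im z))).
Definition Csin (z : C) : C :=
  (sin (Re z) * cosh (Im z), cos (Re z) * sinh (Im z)).
Definition Ctan (z : C) : C := (Csin z / Ccos z)%C.

Definition CSeries (a : nat -> C) : C :=
  (Series (fun n => Re (a n)), Series (fun n => Im (a n))).

(* The source defines Psi at -s; here s = - w.  The index k >= 1 is S n. *)
Definition Psi (w : C) : C :=
  let s := (- w)%C in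
  (/ (s + RtoC (1 / 2))
   + CSeries (fun n => / RtoC (half (S n)) - / (RtoC (half (S n)) - s)))%C.

(* [c] is the coefficient of (z - z0)^(-1) in the Laurent expansion of [f]
   on a punctured disc around [z0]; [a] and [b] hold the coefficients of the
   nonnegative and of the negative powers. *)
Definition is_residue (f : C -> C) (z0 c : C) : Prop :=
  exists (r : R) (a b : nat -> C),
    0 < r /\ b 0%nat = 0%C /\ c = b 1%nat /\
    forall z : C, 0 < Cmod (z - z0)%C < r ->
      exists u v : C,
        @is_pseries C_AbsRing C_NormedModule a (z - z0)%C u /\
        @is_pseries C_AbsRing C_NormedModule b (/ (z - z0))%C v /\
        f z = (u + v)%C.


(* Sums over positive k1, k2, ... with 2 k1 + k2 + ... = N; no index exceeds N,
   so the ranges lose nothing. *)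
Definition sum2 (N : nat) (F : nat -> nat -> R) : R :=
  sum_n_m (fun k1 => sum_n_m (fun k2 =>
    if (2 * k1 + k2 =? N)%nat then F k1 k2 else 0) 1 N) 1 N.

Definition sum3 (N : nat) (F : nat -> nat -> nat -> R) : R :=
  sum_n_m (fun k1 => sum_n_m (fun k2 => sum_n_m (fun k3 =>
    if (2 * k1 + k2 + k3 =? N)%nat then F k1 k2 k3 else 0) 1 N) 1 N) 1 N.

Definition sum4 (N : nat) (F : nat -> nat -> nat -> nat -> R) : R :=
  sum_n_m (fun k1 => sum_n_m (fun k2 => sum_n_m (fun k3 => sum_n_m (fun k4 =>
    if (2 * k1 + k2 + k3 + k4 =? N)%nat then F k1 k2 k3 k4 else 0)
    1 N) 1 N) 1 N) 1 N.

Definition Rq (q : nat) : R :=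
  (1 - (-1) ^ q) * ttilde (q + 3)
  + (1 + (-1) ^ q) * 6 * ln 2 * ttilde (q + 2)
  + (1 - (-1) ^ q) * 12 * ln 2 ^ 2 * ttilde (q + 1)
  + (1 + (-1) ^ q) * 8 * ln 2 ^ 3 * ttilde q
  - 6 * sum2 (q + 2) (fun k1 k2 => ttilde (2 * k1) * zeta (k2 + 1))
  - 24 * ln 2 * sum2 (q + 1) (fun k1 k2 => ttilde (2 * k1) * zeta (k2 + 1))
  - 24 * ln 2 ^ 2 * sum2 q (fun k1 k2 => ttilde (2 * k1) * zeta (k2 + 1))
  + 6 * sum3 (q + 1) (fun k1 k2 k3 =>
          ttilde (2 * k1) * zeta (k2 + 1) * zeta (k3 + 1))
  + 12 * ln 2 * sum3 q (fun k1 k2 k3 =>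
          ttilde (2 * k1) * zeta (k2 + 1) * zeta (k3 + 1))
  - 2 * sum4 q (fun k1 k2 k3 k4 =>
          ttilde (2 * k1) * zeta (k2 + 1) * zeta (k3 + 1) * zeta (k4 + 1)).

Definition kernel (q : nat) (s : C) : C :=
  (RtoC PI * Ctan (RtoC PI * s) * Cpow (Psi (RtoC (1 / 2) - s)) 3
   / Cpow s q)%C.

(* Main.v *)
(** The function [pi tan (pi s)] is the sum of [1 / (a - s)] over the half-odd-integers [a],
    so the residue argument for the kernel amounts to expanding
    [Psi (1/2 - s)^3 / s^q] in partial fractions and summing its values over all [a].
    This is done exactly for the rational truncation [Psi_N (s) = h_N + sum_(n <= N) 1 / (s - n)]:
    the sum over [a] of [(a - n)^(-k)] does not depend on the integer [n], and it vanishes for odd [k],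
    so only the coefficients of [(s - n)^(-2)], [n >= 1], and of [s^(-k)] matter.
    The former are [(3 alpha_n - q / n) / n^q], the latter are Taylor coefficients of
    [(s Psi_N (s))^3] and produce the residue at [0]. On the other side,
    [Psi_N (m - 1/2)] tends to [h_m] and [Psi_N (1/2 - m)] tends to [h_(m-1)], and the identity follows
    by dominated convergence as [N] tends to infinity. *)

Require Import Defs.
From Stdlib Require Import Reals List.
From Coquelicot Require Import Coquelicot.
From Stdlib Require Import Lra Lia.
Import ListNotations.

(** * Finite sums and dominated convergence *)


(** Truncating replaces a contour integral by a finite partial fraction identity: no decay on large
    contours has to be shown, and since only values at real points enter, the summation takes place
    over R. The price is a limit in N. It goes through because [h] is monotone and subadditive,
    which bounds |Psi_N| at the points +-(m - 1/2) by 2 h_m for every N, while h_m^3 = O(sqrt m).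
    Simple poles are the delicate ones: their sums over half-odd-integers converge only with a and
    -a paired.

    The constants come from two limits: h_N - H_N tends to 2 log 2, and the sum of (a - n)^(-2) over
    all a is 2 ttilde(2) = pi^2. The latter, like the Taylor series of pi tan (pi s) behind the
    residue claim, rests on the partial fractions of the tangent, proved for small complex s from
    the duplication formulas of sine and cosine. The same Cauchy product [kernel_coef] then serves
    twice: as the Laurent expansion of the kernel at 0, and as the limit of the contribution of the
    pole 0 of the truncated kernel. *)

Fixpoint psum (f : nat -> R) (n : nat) : R :=
  match n with O => 0 | S m => psum f m + f m end.

Lemma psum_ext f g n : (forall i, (i < n)%nat -> f i = g i) -> psum f n = psum g n.
Proof.
  intros H; induction n as [|n IH]; simpl; auto.
  rewrite IH, H; auto.
Qed.

Lemma psum_plus f g n : psum (fun i => f i + g i) n = psum f n + psum g n.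
Proof. induction n as [|n IH]; simpl; [lra | rewrite IH; lra]. Qed.

Lemma psum_minus f g n : psum (fun i => f i - g i) n = psum f n - psum g n.
Proof. induction n as [|n IH]; simpl; [lra | rewrite IH; lra]. Qed.

Lemma psum_scal c f n : psum (fun i => c * f i) n = c * psum f n.
Proof. induction n as [|n IH]; simpl; [lra | rewrite IH; lra]. Qed.

Lemma psum_opp f n : psum (fun i => - f i) n = - psum f n.
Proof. induction n as [|n IH]; simpl; [lra | rewrite IH; lra]. Qed.

Lemma psum_le f g n : (forall i, (i < n)%nat -> f i <= g i) -> psum f n <= psum g n.
Proof.
  intros H; induction n as [|n IH]; simpl; [lra|].
  apply Rplus_le_compat; auto.
Qed.

Lemma psum_abs f n : Rabs (psum f n) <= psum (fun i => Rabs (f i)) n.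
Proof.
  induction n as [|n IH]; simpl; [rewrite Rabs_R0; lra|].
  eapply Rle_trans; [apply Rabs_triang | lra].
Qed.

Lemma psum_zero f n : (forall i, (i < n)%nat -> f i = 0) -> psum f n = 0.
Proof.
  intros H; induction n as [|n IH]; simpl; auto.
  rewrite IH, H; auto; lra.
Qed.

Lemma psum_nonneg f n : (forall i, (i < n)%nat -> 0 <= f i) -> 0 <= psum f n.
Proof.
  intros H; rewrite <- (psum_zero (fun _ => 0) n); auto.
  apply psum_le; auto.
Qed.

Lemma psum_head f n : psum f (S n) = f O + psum (fun i => f (S i)) n.
Proof. induction n as [|n IH]; simpl in *; lra. Qed.

Lemma psum_add f m n : psum f (m + n) = psum f m + psum (fun i => f (m + i)%nat) n.
Proof.
  induction n as [|n IH]; [rewrite Nat.add_0_r; simpl; lra|].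
  rewrite Nat.add_succ_r; simpl; rewrite IH; lra.
Qed.

Lemma psum_le_index f m n :
  (forall i, 0 <= f i) -> (m <= n)%nat -> psum f m <= psum f n.
Proof.
  intros H L; replace n with (m + (n - m))%nat by lia; rewrite psum_add.
  pose proof (psum_nonneg (fun i => f (m + i)%nat) (n - m) (fun i _ => H _)); lra.
Qed.

Lemma psum_swap (F : nat -> nat -> R) m n :
  psum (fun i => psum (F i) n) m = psum (fun j => psum (fun i => F i j) m) n.
Proof.
  induction m as [|m IH]; simpl.
  - symmetry; apply psum_zero; auto.
  - rewrite IH, psum_plus; auto.
Qed.

Lemma psum_pick f n i :
  psum (fun j => if (j =? i)%nat then f j else 0) n = if (i <? n)%nat then f i else 0.
Proof.
  induction n as [|n IH]; simpl psum.
  - destruct (Nat.ltb_spec i 0); auto; lia.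
  - rewrite IH; destruct (Nat.ltb_spec i n), (Nat.ltb_spec i (S n)), (Nat.eqb_spec n i);
      subst; try lia; lra.
Qed.

Lemma psum_extend f m n :
  (m <= n)%nat -> (forall i, (m <= i)%nat -> f i = 0) -> psum f n = psum f m.
Proof.
  intros L H; replace n with (m + (n - m))%nat by lia; rewrite psum_add.
  rewrite (psum_zero (fun i => f (m + i)%nat)); [lra | intros; apply H; lia].
Qed.

Lemma sum_f_R0_psum f n : sum_f_R0 f n = psum f (S n).
Proof. induction n as [|n IH]; simpl; [lra | rewrite IH; simpl; lra]. Qed.

Lemma sum_n_psum f n : sum_n f n = psum f (S n).
Proof. rewrite sum_n_Reals; apply sum_f_R0_psum. Qed.

Lemma sum_n_m_psum f n : sum_n_m f 1 n = psum (fun i => f (S i)) n.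
Proof.
  induction n as [|n IH]; [reflexivity|].
  rewrite sum_n_Sm by lia; rewrite IH; reflexivity.
Qed.

Lemma is_series_psum f l : is_series f l <-> is_lim_seq (psum f) l.
Proof.
  transitivity (is_lim_seq (sum_n f) l); [reflexivity|].
  transitivity (is_lim_seq (fun n => psum f (S n)) l).
  - split; apply is_lim_seq_ext; intros; rewrite sum_n_psum; auto.
  - symmetry; apply (is_lim_seq_incr_1 (psum f)).
Qed.

Lemma is_series_trunc f K :
  is_series (fun m => if (m <? K)%nat then f m else 0) (psum f K).
Proof.
  apply is_series_psum.
  apply is_lim_seq_ext_loc with (fun _ => psum f K); [|apply is_lim_seq_const].
  exists K; intros n Hn.
  rewrite (psum_extend _ K n Hn); [apply psum_ext; intros i Hi|intros i Hi];
    destruct (Nat.ltb_spec i K); auto; lia.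
Qed.

Lemma is_lim_seq_psum (u : nat -> nat -> R) (v : nat -> R) n :
  (forall m, (m < n)%nat -> is_lim_seq (fun N => u N m) (v m)) ->
  is_lim_seq (fun N => psum (u N) n) (psum v n).
Proof.
  intros H; induction n as [|n IH]; simpl; [apply is_lim_seq_const|].
  apply is_lim_seq_plus'; auto.
Qed.

Lemma ex_series_dom (f g : nat -> R) :
  (forall n, Rabs (f n) <= g n) -> ex_series g -> ex_series f.
Proof. intros H; apply (@ex_series_le R_AbsRing R_CompleteNormedModule); exact H. Qed.

Lemma ex_series_Rscal (c : R) (f : nat -> R) : ex_series f -> ex_series (fun n => c * f n).
Proof. apply (ex_series_scal_l c f). Qed.

(** Past some index the tail of [g] is below eps / 2, whatever N is; the remaining finite head of
    [w N] tends to 0. *)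
Lemma tannery_zero (w : nat -> nat -> R) (g : nat -> R) :
  (forall N m, 0 <= w N m <= g m) -> ex_series g ->
  (forall m, is_lim_seq (fun N => w N m) 0) ->
  is_lim_seq (fun N => Series (w N)) 0.
Proof.
  intros Hw Hg Hl.
  assert (Ew : forall N, ex_series (w N)).
  { intros N; apply ex_series_dom with g; auto.
    intros n; rewrite Rabs_pos_eq; apply Hw. }
  apply is_lim_seq_spec; intros eps.
  pose proof (Series_correct _ Hg) as Sg; apply is_series_psum in Sg.
  apply is_lim_seq_spec in Sg.
  destruct (Sg (pos_div_2 eps)) as [M HM].
  specialize (HM (S M) (le_S _ _ (le_n _))); simpl in HM.
  change (psum g M + g M) with (psum g (S M)) in HM.
  assert (L : is_lim_seq (fun N => psum (w N) (S M)) 0).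
  { rewrite <- (psum_zero (fun _ => 0) (S M)) by auto.
    apply is_lim_seq_psum with (v := fun _ => 0); auto. }
  apply is_lim_seq_spec in L; destruct (L (pos_div_2 eps)) as [N0 HN0].
  exists N0; intros N HN; specialize (HN0 N HN); simpl pos in *.
  rewrite (Series_incr_n g (S M)) in HM by (auto; lia).
  rewrite (Series_incr_n (w N) (S M)) by (auto; lia).
  rewrite sum_f_R0_psum in *; simpl Init.Nat.pred in *.
  rewrite Rminus_0_r in *.
  assert (T : 0 <= Series (fun k => w N (S M + k)%nat) <= Series (fun k => g (S M + k)%nat)).
  { split.
    - replace 0 with (Series (fun _ => 0 * 0)) at 1.
      + apply Series_le; [intros; rewrite Rmult_0_l; split; [lra|apply Hw]|].
        apply (ex_series_incr_n (w N)); auto.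
      + rewrite (Series_scal_l 0 (fun _ => 0)); lra.
    - apply Series_le; [intros; apply Hw|apply (ex_series_incr_n g); auto]. }
  assert (0 <= psum (w N) (S M)) by (apply psum_nonneg; intros; apply Hw).
  rewrite Rabs_pos_eq in * by lra.
  apply Rabs_def2 in HM; lra.
Qed.

(** Reduces to [tannery_zero] for |u N m - v m|, which is at most 2 g m because the limit inherits
    the bound on [u]. *)
Lemma tannery (u : nat -> nat -> R) (v g : nat -> R) :
  (forall N m, Rabs (u N m) <= g m) -> ex_series g ->
  (forall m, is_lim_seq (fun N => u N m) (v m)) ->
  ex_series v /\ is_lim_seq (fun N => Series (u N)) (Series v).
Proof.
  intros Hu Hg Hl.
  assert (Hv : forall m, Rabs (v m) <= g m).
  { intros m.
    apply (is_lim_seq_le (fun N => Rabs (u N m)) (fun _ => g m) (Rabs (v m)) (g m)); auto.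
    - apply (is_lim_seq_abs _ (v m)); auto.
    - apply is_lim_seq_const. }
  assert (Ev : ex_series v) by (apply ex_series_dom with g; auto).
  split; auto.
  assert (Eu : forall N, ex_series (u N)) by (intros; apply ex_series_dom with g; auto).
  assert (Z : is_lim_seq (fun N => Series (fun m => Rabs (u N m - v m))) 0).
  { apply tannery_zero with (fun m => 2 * g m).
    - intros N m; split; [apply Rabs_pos|].
      unfold Rminus; eapply Rle_trans; [apply Rabs_triang|]; rewrite Rabs_Ropp.
      specialize (Hu N m); specialize (Hv m); lra.
    - apply ex_series_Rscal; auto.
    - intros m; rewrite <- Rabs_R0; apply (is_lim_seq_abs _ 0).
      replace 0 with (v m - v m) by lra.
      apply is_lim_seq_minus'; auto; apply is_lim_seq_const. }
  apply is_lim_seq_ext with (fun N => Series v + (Series (u N) - Series v)); [intros; lra|].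
  replace (Finite (Series v)) with (Finite (Series v + 0)) by (f_equal; lra).
  apply is_lim_seq_plus'; [apply is_lim_seq_const|].
  apply is_lim_seq_abs_0.
  apply is_lim_seq_le_le with (fun _ => 0) (fun N => Series (fun m => Rabs (u N m - v m)));
    auto; [|apply is_lim_seq_const].
  intros N; split; [apply Rabs_pos|].
  rewrite <- Series_minus by auto.
  apply Series_Rabs, ex_series_dom with (fun m => 2 * g m).
  - intros m; rewrite Rabs_Rabsolu.
    unfold Rminus; eapply Rle_trans; [apply Rabs_triang|]; rewrite Rabs_Ropp.
    specialize (Hu N m); specialize (Hv m); lra.
  - apply ex_series_Rscal; auto.
Qed.

(** A finite sum of growing length is a series padded with zeros. *)
Lemma tannery_psum (u : nat -> nat -> R) (K : nat -> nat) (v g : nat -> R) :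
  (forall N m, (m < K N)%nat -> Rabs (u N m) <= g m) ->
  (forall m, 0 <= g m) -> ex_series g ->
  (forall m, exists N0, forall N, (N0 <= N)%nat -> (m < K N)%nat) ->
  (forall m, is_lim_seq (fun N => u N m) (v m)) ->
  ex_series v /\ is_lim_seq (fun N => psum (u N) (K N)) (Series v).
Proof.
  intros Hu Hg0 Hg HK Hl.
  destruct (tannery (fun N m => if (m <? K N)%nat then u N m else 0) v g) as [E L]; auto.
  - intros N m; destruct (Nat.ltb_spec m (K N)); auto; rewrite Rabs_R0; auto.
  - intros m; apply is_lim_seq_ext_loc with (fun N => u N m); auto.
    destruct (HK m) as [N0 HN]; exists N0; intros N LN.
    destruct (Nat.ltb_spec m (K N)); auto; specialize (HN N LN); lia.
  - split; auto; revert L; apply is_lim_seq_ext; intros N.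
    apply is_series_unique, is_series_trunc.
Qed.

(** * Harmonic numbers *)


Lemma half_S k : half (S k) = INR k + 1 / 2.
Proof. unfold half; rewrite S_INR; lra. Qed.

Lemma half_S_ge k : 1 / 2 <= half (S k).
Proof. rewrite half_S; pose proof (pos_INR k); lra. Qed.

Definition harm (n : nat) : R := psum (fun k => / INR (S k)) n.

Lemma h_psum n : h n = psum (fun k => / half (S k)) n.
Proof. unfold h; apply sum_n_m_psum. Qed.

Lemma h_S n : h (S n) = h n + / half (S n).
Proof. rewrite !h_psum; reflexivity. Qed.

Lemma h_0 : h 0 = 0.
Proof. rewrite h_psum; reflexivity. Qed.

Lemma inv_half_pos k : 0 < / half (S k).
Proof. pose proof (half_S_ge k); apply Rinv_0_lt_compat; lra. Qed.

Lemma inv_INR_S_pos k : 0 < / INR (S k).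
Proof. apply Rinv_0_lt_compat, lt_0_INR; lia. Qed.

Lemma h_mono m n : (m <= n)%nat -> h m <= h n.
Proof.
  intros L; rewrite !h_psum; apply psum_le_index; auto.
  intros; left; apply inv_half_pos.
Qed.

Lemma h_nonneg n : 0 <= h n.
Proof. rewrite <- h_0; apply h_mono; lia. Qed.

(** The terms decrease, so any n consecutive ones sum to at most the first n. This, and the same
    fact for [harm], gives the bounds that are uniform in the truncation. *)
Lemma h_subadd m n : h (m + n) <= h m + h n.
Proof.
  rewrite !h_psum, psum_add; apply Rplus_le_compat_l, psum_le; intros i _.
  pose proof (half_S_ge i).
  apply Rinv_le_contravar; [lra|].
  rewrite !half_S, plus_INR; pose proof (pos_INR m); lra.
Qed.

Lemma harm_mono m n : (m <= n)%nat -> harm m <= harm n.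
Proof.
  intros L; apply psum_le_index; auto; intros; left; apply inv_INR_S_pos.
Qed.

Lemma harm_nonneg n : 0 <= harm n.
Proof. change 0 with (harm 0); apply harm_mono; lia. Qed.

Lemma harm_subadd m n : harm (m + n) <= harm m + harm n.
Proof.
  unfold harm; rewrite psum_add; apply Rplus_le_compat_l, psum_le; intros i _.
  apply Rinv_le_contravar; [apply lt_0_INR; lia | apply le_INR; lia].
Qed.

Lemma harm_le_h n : harm n <= h n.
Proof.
  rewrite h_psum; apply psum_le; intros i _; pose proof (half_S_ge i).
  apply Rinv_le_contravar; [lra|]; unfold half; lra.
Qed.

Lemma h_le_harm n : h n <= 2 * harm n.
Proof.
  rewrite h_psum; unfold harm; rewrite <- psum_scal; apply psum_le; intros i _.
  rewrite half_S, S_INR; pose proof (pos_INR i).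
  apply Rmult_le_reg_r with (INR i + 1 / 2); [lra|].
  rewrite Rinv_l by lra.
  replace (2 * / (INR i + 1) * (INR i + 1 / 2)) with (1 + INR i / (INR i + 1)) by (field; lra).
  assert (0 <= INR i / (INR i + 1)) by (apply Rdiv_le_0_compat; lra); lra.
Qed.

(** * Logarithmic comparison and the limit of h_N - H_N *)

Lemma ln_le_minus_1 x : 0 < x -> ln x <= x - 1.
Proof. intros H; pose proof (exp_ineq1_le (ln x)); rewrite exp_ln in *; lra. Qed.

(** Both halves are ln t <= t - 1, at t = x / (x + 1) and at t = (x + 1) / x. *)
Lemma ln_succ_bounds k :
  / INR (S (S k)) <= ln (INR (S (S k))) - ln (INR (S k)) <= / INR (S k).
Proof.
  assert (0 < INR (S k)) by (apply lt_0_INR; lia).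
  assert (E : INR (S (S k)) = INR (S k) + 1) by apply S_INR.
  rewrite E; set (x := INR (S k)) in *; rewrite <- ln_div by lra; split.
  - assert (L : ln (x / (x + 1)) <= x / (x + 1) - 1)
      by (apply ln_le_minus_1, Rdiv_lt_0_compat; lra).
    rewrite ln_div in L by lra; rewrite ln_div by lra.
    replace (x / (x + 1) - 1) with (- / (x + 1)) in L by (field; lra); lra.
  - assert (L : ln ((x + 1) / x) <= (x + 1) / x - 1)
      by (apply ln_le_minus_1, Rdiv_lt_0_compat; lra).
    replace ((x + 1) / x - 1) with (/ x) in L by (field; lra); lra.
Qed.

Lemma harm_le_ln n : harm (S n) <= 1 + ln (INR (S n)).
Proof.
  induction n as [|n IH].
  - unfold harm; simpl; rewrite ln_1; lra.
  - pose proof (ln_succ_bounds n).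
    change (harm (S (S n))) with (harm (S n) + / INR (S (S n))); lra.
Qed.

(** Since 1 / (k - 1/2) = 2 / (2k - 1), [h N] is twice the sum over the odd denominators up to 2N -
    1, that is 2 H_(2N) - H_N. *)
Lemma harm_double N : h N - harm N = 2 * (harm (2 * N) - harm N).
Proof.
  induction N as [|N IH]; [rewrite h_0; unfold harm; simpl; lra|].
  rewrite h_S; replace (2 * S N)%nat with (S (S (2 * N))) by lia.
  change (harm (S (S (2 * N))))
    with (harm (2 * N) + / INR (S (2 * N)) + / INR (S (S (2 * N)))).
  change (harm (S N)) with (harm N + / INR (S N)).
  rewrite half_S, !S_INR, mult_INR; simpl (INR 2).
  pose proof (pos_INR N).
  assert (E : / (INR N + 1 / 2) - / (INR N + 1) =
    2 * (/ ((1 + 1) * INR N + 1) + / ((1 + 1) * INR N + 1 + 1) - / (INR N + 1)))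
    by (field; repeat split; lra).
  lra.
Qed.

Lemma harm_double_bounds N :
  ln 2 - / INR (S (2 * N)) <= harm (2 * N) - harm N <= ln 2.
Proof.
  assert (B : forall n m, ln (INR (S n + m)) - ln (INR (S n)) <= harm (n + m) - harm n).
  { intros n m; induction m as [|m IH]; [rewrite !Nat.add_0_r; lra|].
    rewrite !Nat.add_succ_r; rewrite Nat.add_succ_l in *.
    change (harm (S (n + m))) with (harm (n + m) + / INR (S (n + m))).
    pose proof (ln_succ_bounds (n + m)); lra. }
  assert (B' : forall n m, harm (S n + m) - harm (S n) <= ln (INR (S n + m)) - ln (INR (S n))).
  { intros n m; induction m as [|m IH]; [rewrite !Nat.add_0_r; lra|].
    rewrite !Nat.add_succ_r; rewrite Nat.add_succ_l in *.
    change (harm (S (S (n + m)))) with (harm (S (n + m)) + / INR (S (S (n + m)))).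
    pose proof (ln_succ_bounds (n + m)); lra. }
  split.
  - specialize (B N N); replace (N + N)%nat with (2 * N)%nat in B by lia.
    replace (S N + N)%nat with (S (2 * N)) in B by lia.
    (* [B] only reaches ln (2N + 1) - ln (N + 1), one step short of ln (2N + 2) - ln (N + 1) = ln 2;
       the missing step costs at most 1 / (2N + 1). *)
    pose proof (ln_succ_bounds (2 * N)) as L.
    replace (S (S (2 * N))) with (2 * S N)%nat in L by lia.
    rewrite (mult_INR 2 (S N)), ln_mult in L
      by (simpl; try lra; apply (lt_0_INR (S N)); lia).
    simpl (INR 2) in L; replace (1 + 1) with 2 in L by lra; lra.
  - destruct N as [|N].
    + unfold harm; simpl; pose proof ln_lt_2; lra.
    + specialize (B' N (S N)); replace (S N + S N)%nat with (2 * S N)%nat in B' by lia.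
      rewrite (mult_INR 2 (S N)), ln_mult in B'
        by (simpl; try lra; apply (lt_0_INR (S N)); lia).
      simpl (INR 2) in B'; replace (1 + 1) with 2 in B' by lra; lra.
Qed.

Lemma is_lim_seq_inv_INR_S : is_lim_seq (fun n => / INR (S n)) 0.
Proof.
  replace (Finite 0) with (Rbar_inv p_infty) by reflexivity.
  apply is_lim_seq_inv; [|discriminate].
  apply (is_lim_seq_incr_1 INR), is_lim_seq_INR.
Qed.

Lemma h_sub_harm_lim : is_lim_seq (fun N => h N - harm N) (2 * ln 2).
Proof.
  apply is_lim_seq_ext with (fun N => 2 * (harm (2 * N) - harm N));
    [intros; rewrite harm_double; auto|].
  apply (is_lim_seq_scal_l _ 2 (ln 2)).
  apply is_lim_seq_le_le with (fun N => ln 2 - / INR (S N)) (fun _ => ln 2).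
  - intros N; pose proof (harm_double_bounds N); split; [|lra].
    eapply Rle_trans; [|apply H].
    apply Rplus_le_compat_l, Ropp_le_contravar, Rinv_le_contravar;
      [apply lt_0_INR; lia | apply le_INR; lia].
  - replace (Finite (ln 2)) with (Finite (ln 2 - 0)) by (f_equal; lra).
    apply is_lim_seq_minus'; [apply is_lim_seq_const|apply is_lim_seq_inv_INR_S].
  - apply is_lim_seq_const.
Qed.

Lemma h_sub_harm_bounds N : 0 <= h N - harm N <= 2.
Proof.
  split; [pose proof (harm_le_h N); lra|].
  rewrite harm_double; pose proof (harm_double_bounds N).
  assert (ln 2 <= 1) by (pose proof (ln_le_minus_1 2); lra); lra.
Qed.

(* With [y = n^(1/8)], [h n <= 2 + 2 ln n = 2 + 16 ln y <= 16 y]. *)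
Lemma h_cube_le n : h (S n) ^ 3 <= 4096 * sqrt (INR (S n)).
Proof.
  set (x := INR (S n)).
  assert (Hx : 1 <= x) by (unfold x; rewrite S_INR; pose proof (pos_INR n); lra).
  set (y := sqrt (sqrt (sqrt x))).
  assert (G : forall t, 1 <= t -> 1 <= sqrt t)
    by (intros t Ht; rewrite <- sqrt_1 at 1; apply sqrt_le_1; lra).
  assert (Hy : 1 <= y) by (unfold y; auto).
  assert (E4 : y ^ 4 = sqrt x).
  { unfold y; replace (sqrt (sqrt (sqrt x)) ^ 4)
      with (((sqrt (sqrt (sqrt x))) ^ 2) ^ 2) by ring.
    rewrite !pow2_sqrt; auto; pose proof (G x Hx); pose proof (G _ H); lra. }
  assert (E8 : y ^ 8 = x).
  { replace (y ^ 8) with ((y ^ 4) ^ 2) by ring; rewrite E4, pow2_sqrt; lra. }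
  assert (H1 : h (S n) <= 16 * y).
  { pose proof (h_le_harm (S n)); pose proof (harm_le_ln n).
    fold x in H0; rewrite <- E8, ln_pow in H0 by lra.
    pose proof (ln_le_minus_1 y); simpl (INR 8) in H0; lra. }
  rewrite <- E4.
  apply Rle_trans with ((16 * y) ^ 3); [apply pow_incr; split; auto; apply h_nonneg|].
  replace (4096 * y ^ 4) with ((16 * y) ^ 3 * y) by ring.
  assert (0 <= (16 * y) ^ 3) by (apply pow_le; lra); nra.
Qed.

(** * Summability of powers and harmonic sums *)

Lemma ex_series_bounded (f : nat -> R) (M : R) :
  (forall n, 0 <= f n) -> (forall n, psum f n <= M) -> ex_series f.
Proof.
  intros H0 HM.
  assert (E : ex_finite_lim_seq (psum f)).
  { apply ex_finite_lim_seq_incr with M; auto; intros n; simpl; specialize (H0 n); lra. }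
  destruct E as [l Hl]; exists l; apply is_series_psum; auto.
Qed.

(** Telescoping: (x + 1)^(-3/2) <= 2 / sqrt x - 2 / sqrt (x + 1) keeps the partial sums below 3 - 2
    / sqrt n. *)
Lemma ex_series_pow_three_halves :
  ex_series (fun n => / (INR (S n) * sqrt (INR (S n)))).
Proof.
  apply ex_series_bounded with 3.
  - intros n; left; apply Rinv_0_lt_compat.
    assert (0 < INR (S n)) by (apply lt_0_INR; lia).
    apply Rmult_lt_0_compat; auto; apply sqrt_lt_R0; auto.
  - assert (B : forall n, psum (fun n => / (INR (S n) * sqrt (INR (S n)))) (S n)
                         <= 3 - 2 / sqrt (INR (S n))).
    { intros n; induction n as [|n IH].
      - simpl; rewrite sqrt_1; lra.
      - assert (0 < INR (S n)) by (apply lt_0_INR; lia).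
        remember (S n) as k; cbn [psum].
        assert (Ek : INR (S k) = INR k + 1) by apply S_INR.
        rewrite Ek; set (x := INR k) in *.
        set (a := sqrt x) in *; set (b := sqrt (x + 1)).
        assert (Ha : 0 < a) by (apply sqrt_lt_R0; auto).
        assert (Hab : a <= b) by (apply sqrt_le_1; lra).
        assert (Ea : a * a = x) by (apply sqrt_sqrt; lra).
        assert (Eb : b * b = x + 1) by (apply sqrt_sqrt; lra).
        assert (D : / ((x + 1) * b) <= 2 / a - 2 / b).
        { rewrite <- Eb.
          replace (2 / a - 2 / b) with (2 * (b - a) / (a * b)) by (field; lra).
          (* From b^2 - a^2 = 1. *)
          replace (b - a) with (/ (a + b)).
          2: { apply Rmult_eq_reg_r with (a + b); [|lra].
               rewrite Rinv_l by lra; lra. }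
          replace (2 * / (a + b) / (a * b)) with (/ ((a + b) / 2 * (a * b)))
            by (field; lra).
          apply Rinv_le_contravar; [repeat apply Rmult_lt_0_compat; lra|].
          replace (b * b * b) with (b * (b * b)) by ring.
          apply Rmult_le_compat; try lra; try nra. }
        lra. }
    intros [|n]; [simpl; lra|].
    eapply Rle_trans; [apply B|].
    assert (0 < sqrt (INR (S n))) by (apply sqrt_lt_R0, lt_0_INR; lia).
    assert (0 < 2 / sqrt (INR (S n))) by (apply Rdiv_lt_0_compat; lra); lra.
Qed.

(** The sqrt n of [h_cube_le] against n^(-q) <= n^(-2) leaves n^(-3/2); the factor 2^q comes from
    half n >= n / 2. *)
Lemma ex_series_h_cube q : (1 < q)%nat ->
  ex_series (fun m => h (S m) ^ 3 / half (S m) ^ q).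
Proof.
  intros Hq.
  apply ex_series_dom with
    (fun m => 2 ^ q * 4096 * / (INR (S m) * sqrt (INR (S m)))).
  2: apply ex_series_Rscal, ex_series_pow_three_halves.
  intros m; pose proof (half_S_ge m) as Hh; pose proof (h_nonneg (S m)) as Hp.
  assert (Hx : 1 <= INR (S m)) by (rewrite S_INR; pose proof (pos_INR m); lra).
  assert (Hs : 0 < sqrt (INR (S m))) by (apply sqrt_lt_R0; lra).
  assert (Es := sqrt_sqrt (INR (S m)) ltac:(lra)).
  assert (P1 : 0 < half (S m) ^ q) by (apply pow_lt; lra).
  rewrite Rabs_pos_eq by (apply Rdiv_le_0_compat; auto; apply pow_le; auto).
  apply Rle_trans with (4096 * sqrt (INR (S m)) * (2 ^ q * / INR (S m) ^ 2)).
  - unfold Rdiv; apply Rmult_le_compat; [apply pow_le; auto|left; apply Rinv_0_lt_compat; auto| apply h_cube_le|].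
    apply Rle_trans with (/ (INR (S m) / 2) ^ q).
    + apply Rinv_le_contravar; [apply pow_lt; lra|apply pow_incr].
      unfold half; lra.
    + unfold Rdiv; rewrite Rpow_mult_distr, Rinv_mult, pow_inv, Rinv_inv, Rmult_comm.
      apply Rmult_le_compat_l; [apply pow_le; lra|].
      apply Rinv_le_contravar; [apply pow_lt; lra|apply Rle_pow; auto].
  - right; set (s := sqrt (INR (S m))) in *; rewrite <- Es; field; lra.
Qed.

Lemma one_le_h_S m : 1 <= h (S m).
Proof.
  apply Rle_trans with (h 1); [|apply h_mono; lia].
  rewrite h_S, h_0; unfold half; simpl; lra.
Qed.

(** Because h (S m) >= 1, this one majorant covers the inverse powers and the harmonic sums
    below. *)
Lemma ex_series_half_dom (f : nat -> R) q : (1 < q)%nat ->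
  (exists C, forall m, Rabs (f m) <= C * (h (S m) ^ 3 / half (S m) ^ q)) -> ex_series f.
Proof.
  intros Hq [C H]; apply ex_series_dom with (1 := H), ex_series_Rscal, ex_series_h_cube; auto.
Qed.

Lemma inv_pow_INR_le m q : / INR (S m) ^ q <= / half (S m) ^ q.
Proof.
  pose proof (half_S_ge m); apply Rinv_le_contravar; [apply pow_lt; lra|].
  apply pow_incr; unfold half in *; lra.
Qed.

Lemma ex_series_inv_half_pow q : (1 < q)%nat -> ex_series (fun m => / half (S m) ^ q).
Proof.
  intros Hq; apply ex_series_half_dom with q; auto; exists 1; intros m.
  pose proof (half_S_ge m); assert (0 < / half (S m) ^ q) by (apply Rinv_0_lt_compat, pow_lt; lra).
  rewrite Rabs_pos_eq by lra; rewrite Rmult_1_l.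
  pose proof (pow_R1_Rle (h (S m)) 3 (one_le_h_S m)).
  unfold Rdiv; nra.
Qed.

Lemma ex_series_inv_INR_pow q : (1 < q)%nat -> ex_series (fun m => / INR (S m) ^ q).
Proof.
  intros Hq; apply ex_series_dom with (2 := ex_series_inv_half_pow q Hq); intros m.
  rewrite Rabs_pos_eq; [apply inv_pow_INR_le|].
  left; apply Rinv_0_lt_compat, pow_lt, lt_0_INR; lia.
Qed.

Lemma ex_series_harm q : (1 < q)%nat -> ex_series (fun m => harm (S m) / INR (S m) ^ q).
Proof.
  intros Hq; apply ex_series_half_dom with q; auto; exists 1; intros m.
  assert (0 < INR (S m)) by (apply lt_0_INR; lia).
  pose proof (harm_nonneg (S m)); pose proof (one_le_h_S m).
  rewrite Rabs_pos_eq by (apply Rdiv_le_0_compat; auto; apply pow_lt; auto).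
  rewrite Rmult_1_l; unfold Rdiv; apply Rmult_le_compat; auto.
  - left; apply Rinv_0_lt_compat, pow_lt; auto.
  - apply Rle_trans with (h (S m)); [apply harm_le_h|].
    simpl; nra.
  - apply inv_pow_INR_le.
Qed.

(** * Multiple sums of depth one and two as single series *)

Lemma msum_cons x s l :
  msum x (s :: l) = Series (fun m => / x (S m) ^ s * msum_below x l (S m)).
Proof.
  unfold msum, Series; f_equal.
  (* [msum_below] at N has N - 1 terms and [sum_n] at n has n + 1, hence the double shift. *)
  rewrite <- (Lim_seq_incr_1 (msum_below x (s :: l))),
    <- (Lim_seq_incr_1 (fun n => msum_below x (s :: l) (S n))).
  apply Lim_seq_ext; intros n.
  rewrite sum_n_psum; cbn [msum_below]; replace (S (S n) - 1)%nat with (S n) by lia.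
  apply sum_n_m_psum.
Qed.

Lemma msum_1 x s : msum x [s] = Series (fun m => / x (S m) ^ s).
Proof.
  rewrite msum_cons; apply Series_ext; intros m; simpl; ring.
Qed.

Lemma msum_2 x s :
  msum x [s; 1%nat] = Series (fun m => psum (fun k => / x (S k)) m / x (S m) ^ s).
Proof.
  rewrite msum_cons; apply Series_ext; intros m.
  cbn [msum_below]; replace (S m - 1)%nat with m by lia.
  rewrite sum_n_m_psum; unfold Rdiv; rewrite Rmult_comm; f_equal.
  apply psum_ext; intros; rewrite pow_1; ring.
Qed.

(** * Partial fractions of the tangent *)


Lemma C_eq (u v : C) : Re u = Re v -> Im u = Im v -> u = v.
Proof. intros; apply injective_projections; auto. Qed.

Lemma cosh_sinh_sq y : cosh y ^ 2 - sinh y ^ 2 = 1.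
Proof.
  unfold cosh, sinh; assert (E : exp y * exp (- y) = 1)
    by (rewrite <- exp_plus, Rplus_opp_r; apply exp_0).
  replace 1 with (exp y * exp (- y)); field.
Qed.

Lemma sinh_double y : sinh (2 * y) = 2 * sinh y * cosh y.
Proof.
  unfold cosh, sinh; replace (2 * y) with (y + y) by ring.
  rewrite Ropp_plus_distr, !exp_plus; field.
Qed.

Lemma cosh_double y : cosh (2 * y) = 2 * sinh y ^ 2 + 1.
Proof.
  unfold cosh, sinh; replace (2 * y) with (y + y) by ring.
  rewrite Ropp_plus_distr, !exp_plus.
  assert (E : exp y * exp (- y) = 1) by (rewrite <- exp_plus, Rplus_opp_r; apply exp_0).
  replace 1 with (exp y * exp (- y)); field.
Qed.

Lemma Csin_double z : Csin (2 * z) = (2 * Csin z * Ccos z)%C.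
Proof.
  destruct z as [x y]; unfold Csin, Ccos.
  replace (Re (2 * (x, y))%C) with (2 * x) by (simpl; ring).
  replace (Im (2 * (x, y))%C) with (2 * y) by (simpl; ring).
  simpl Re; simpl Im.
  rewrite sinh_double, cosh_double, sin_2a, cos_2a.
  pose proof (cosh_sinh_sq y); pose proof (sin2_cos2 x); unfold Rsqr in *.
  apply C_eq; simpl.
  - assert (E : cosh y ^ 2 = 1 + sinh y ^ 2) by lra.
    ring_simplify; rewrite E; ring.
  - assert (E : sin x ^ 2 = 1 - cos x ^ 2) by (simpl; lra).
    assert (E' : cosh y ^ 2 = 1 + sinh y ^ 2) by lra.
    ring_simplify; rewrite ?E, ?E'; ring.
Qed.

Lemma Ccos_double_sin z : Ccos (2 * z) = (1 - 2 * Csin z * Csin z)%C.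
Proof.
  destruct z as [x y]; unfold Csin, Ccos.
  replace (Re (2 * (x, y))%C) with (2 * x) by (simpl; ring).
  replace (Im (2 * (x, y))%C) with (2 * y) by (simpl; ring).
  simpl Re; simpl Im.
  rewrite sinh_double, cosh_double, sin_2a, cos_2a.
  pose proof (cosh_sinh_sq y); pose proof (sin2_cos2 x); unfold Rsqr in *.
  assert (E : sin x ^ 2 = 1 - cos x ^ 2) by (simpl; lra).
  assert (E' : cosh y ^ 2 = 1 + sinh y ^ 2) by lra.
  apply C_eq; simpl; ring_simplify; rewrite ?E, ?E'; ring.
Qed.

Lemma Csin_Ccos_sq z : (Csin z * Csin z + Ccos z * Ccos z = 1)%C.
Proof.
  destruct z as [x y]; unfold Csin, Ccos; simpl Re; simpl Im.
  pose proof (cosh_sinh_sq y); pose proof (sin2_cos2 x); unfold Rsqr in *.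
  assert (E : sin x ^ 2 = 1 - cos x ^ 2) by (simpl; lra).
  assert (E' : cosh y ^ 2 = 1 + sinh y ^ 2) by lra.
  apply C_eq; simpl; ring_simplify; rewrite ?E, ?E'; ring.
Qed.

Lemma Ccos_double z : Ccos (2 * z) = (2 * Ccos z * Ccos z - 1)%C.
Proof.
  rewrite Ccos_double_sin; pose proof (Csin_Ccos_sq z) as E.
  replace (2 * Csin z * Csin z)%C with (2 * (Csin z * Csin z + Ccos z * Ccos z) - 2 * Ccos z * Ccos z)%C by ring.
  rewrite E; ring.
Qed.

(** On [0, 1/2], exp (-t) >= 1 - t and exp t <= 1 / (1 - t) <= 1 + 2 t; the negative side follows by
    oddness. *)
Lemma sinh_abs_le y : Rabs y <= 1 / 2 -> Rabs (sinh y) <= 3 / 2 * Rabs y.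
Proof.
  assert (P : forall t, 0 <= t <= 1 / 2 -> 0 <= sinh t <= 3 / 2 * t).
  { intros t Ht; unfold sinh.
    pose proof (exp_ineq1_le t); pose proof (exp_ineq1_le (- t)).
    assert (E : exp t * exp (- t) = 1) by (rewrite <- exp_plus, Rplus_opp_r; apply exp_0).
    assert (U : exp t <= / (1 - t)).
    { apply Rmult_le_reg_r with (1 - t); [lra|]; rewrite Rinv_l by lra.
      pose proof (exp_pos t); nra. }
    assert (V : exp (- t) <= 1) by nra.
    assert (W : / (1 - t) <= 1 + 2 * t).
    { apply Rmult_le_reg_r with (1 - t); [lra|]; rewrite Rinv_l by lra; nra. }
    split; lra. }
  intros Hy; unfold Rabs in Hy |- *; destruct (Rcase_abs y) as [N|N].
  - assert (O : sinh y = - sinh (- y))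
      by (unfold sinh; rewrite Ropp_involutive; field).
    rewrite O; specialize (P (- y)); destruct (Rcase_abs _); lra.
  - specialize (P y); destruct (Rcase_abs _); lra.
Qed.

Lemma sin_abs_le x : Rabs (sin x) <= Rabs x.
Proof.
  assert (P : forall t, 0 <= t -> sin t <= t).
  { intros t [Ht|<-]; [left; apply sin_lt_x; auto|rewrite sin_0; lra]. }
  assert (Q : forall t, 0 <= t -> Rabs (sin t) <= t).
  { intros t Ht; apply Rabs_le; split; [|apply P; auto].
    destruct (Rle_dec t 3); [|pose proof (SIN_bound t); lra].
    assert (3 < PI) by (pose proof PI2_3_2; lra).
    pose proof (sin_ge_0 t Ht ltac:(lra)); lra. }
  unfold Rabs at 2; destruct (Rcase_abs x).
  - replace (sin x) with (- sin (- x)) by (rewrite sin_neg; ring).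
    rewrite Rabs_Ropp; apply Q; lra.
  - apply Q; lra.
Qed.

Lemma Cmod_Csin_sq z : Cmod (Csin z) ^ 2 = sin (Re z) ^ 2 + sinh (Im z) ^ 2.
Proof.
  rewrite Cmod2_alt; unfold Csin; simpl Re at 1; simpl Im at 2; cbn [fst snd Re Im].
  pose proof (cosh_sinh_sq (snd z)) as H; pose proof (sin2_cos2 (fst z)) as K; unfold Rsqr in K.
  assert (E : sin (fst z) ^ 2 = 1 - cos (fst z) ^ 2) by (simpl; lra).
  assert (E' : cosh (snd z) ^ 2 = 1 + sinh (snd z) ^ 2) by lra.
  unfold Re, Im; rewrite !Rpow_mult_distr, E, E'; ring.
Qed.

Lemma Cmod_Csin_le z : Cmod z <= 1 / 2 -> Cmod (Csin z) <= 2 * Cmod z.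
Proof.
  intros Hz.
  assert (Hi : Rabs (Im z) <= Cmod z)
    by (eapply Rle_trans; [apply Rmax_r|apply Rmax_Cmod]).
  pose proof (sinh_abs_le (Im z) ltac:(lra)); pose proof (sin_abs_le (Re z)).
  pose proof (Cmod_ge_0 z).
  apply Rsqr_incr_0; unfold Rsqr; [|apply Cmod_ge_0|lra].
  pose proof (Cmod_Csin_sq z); pose proof (Cmod2_alt z).
  assert (sin (Re z) ^ 2 <= Re z ^ 2).
  { rewrite <- (pow2_abs (sin _)), <- (pow2_abs (Re z)); apply pow_incr; split; auto; apply Rabs_pos. }
  assert (sinh (Im z) ^ 2 <= (3 / 2) ^ 2 * Im z ^ 2).
  { rewrite <- (pow2_abs (sinh _)), <- (pow2_abs (Im z)), <- Rpow_mult_distr; apply pow_incr; split; auto; apply Rabs_pos. }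
  pose proof (pow2_ge_0 (Im z)); pose proof (pow2_ge_0 (Re z)); nra.
Qed.

(** From sin x >= x - x^3 / 6 and x <= 2. A weak form of Jordan's inequality, enough to keep the
    denominators of the finite tangent sum away from 0. *)
Lemma sin_ge_third x : 0 <= x <= PI / 2 -> x / 3 <= sin x.
Proof.
  intros [H0 H1]; pose proof PI_4; pose proof PI_RGT_0.
  destruct (sin_bound x 0 H0 ltac:(lra)) as [L _].
  unfold sin_approx, sin_term in L; simpl in L.
  assert (x * x <= 4) by nra; nra.
Qed.

(** * Componentwise limits, series and finite sums in C *)

Definition Clim (u : nat -> C) (l : C) : Prop :=
  is_lim_seq (fun n => Re (u n)) (Re l) /\ is_lim_seq (fun n => Im (u n)) (Im l).

Lemma Clim_ext (u v : nat -> C) (l : C) : (forall n, u n = v n) -> Clim u l -> Clim v l.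
Proof.
  intros E [A B]; split; eapply is_lim_seq_ext; eauto; intros; simpl; rewrite E; auto.
Qed.

Lemma Clim_minus (u v : nat -> C) (l m : C) : Clim u l -> Clim v m -> Clim (fun n => u n - v n)%C (l - m)%C.
Proof.
  intros [A B] [A' B']; split; simpl.
  - apply is_lim_seq_minus'; [exact A | exact A'].
  - apply is_lim_seq_minus'; [exact B | exact B'].
Qed.

Lemma Clim_mult (u v : nat -> C) (l m : C) : Clim u l -> Clim v m -> Clim (fun n => u n * v n)%C (l * m)%C.
Proof.
  intros [A B] [A' B']; split; simpl.
  - apply is_lim_seq_minus'; apply is_lim_seq_mult'; assumption.
  - apply is_lim_seq_plus'; apply is_lim_seq_mult'; assumption.
Qed.

Lemma Clim_inv (u : nat -> C) (l : C) : l <> 0%C -> Clim u l -> Clim (fun n => / u n)%C (/ l)%C.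
Proof.
  intros Hl [A B].
  assert (D : Re l ^ 2 + Im l ^ 2 <> 0).
  { rewrite <- Cmod2_alt; apply pow_nonzero; intros E; apply Hl, Cmod_eq_0, E. }
  assert (L : is_lim_seq (fun n => Re (u n) ^ 2 + Im (u n) ^ 2) (Re l ^ 2 + Im l ^ 2)).
  { simpl; apply is_lim_seq_plus'; repeat apply is_lim_seq_mult'; auto; apply is_lim_seq_const. }
  split; cbn [Re Im Cinv fst snd].
  - apply is_lim_seq_div'; auto.
  - apply is_lim_seq_div'; auto; apply (is_lim_seq_opp _ (Im l)); exact B.
Qed.

(** Summing by components gives access to the real theorems on comparison, interchange and products;
    [Cser_is_series] returns to the normed module C, where [is_residue] is stated. *)
Definition Cser (f : nat -> C) (l : C) : Prop :=
  is_series (fun n => Re (f n)) (Re l) /\ is_series (fun n => Im (f n)) (Im l).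

Definition Cpsum (f : nat -> C) (n : nat) : C :=
  (psum (fun k => Re (f k)) n, psum (fun k => Im (f k)) n).

Lemma Cpsum_S f n : Cpsum f (S n) = (Cpsum f n + f n)%C.
Proof. apply C_eq; reflexivity. Qed.

Lemma Cpsum_0 f : Cpsum f 0 = 0%C.
Proof. reflexivity. Qed.

Lemma Cpsum_ext f g n : (forall i, (i < n)%nat -> f i = g i) -> Cpsum f n = Cpsum g n.
Proof. intros H; apply C_eq; simpl; apply psum_ext; intros; rewrite H; auto. Qed.

Lemma Cpsum_scal c f n : Cpsum (fun k => c * f k)%C n = (c * Cpsum f n)%C.
Proof.
  induction n as [|n IH]; [rewrite !Cpsum_0; ring | rewrite !Cpsum_S, IH; ring].
Qed.

Lemma Cpsum_head f n : Cpsum f (S n) = (f O + Cpsum (fun k => f (S k)) n)%C.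
Proof. apply C_eq; apply psum_head. Qed.

(** Folding the range about its middle pairs the angle of index k with its supplement. The induction
    peels off the first and the last term together. *)
Lemma Cpsum_reflect f n :
  Cpsum f (n + n) = Cpsum (fun k => f k + f (n + n - S k)%nat)%C n.
Proof.
  assert (G : forall n g, Cpsum g (n + n) = Cpsum (fun k => g k + g (n + n - S k)%nat)%C n).
  { clear; induction n as [|n IH]; intros g; [reflexivity|].
    replace (S n + S n)%nat with (S (S (n + n))) by lia.
    rewrite Cpsum_head, Cpsum_S, IH, (Cpsum_head _ n).
    rewrite (Cpsum_ext (fun k => g (S k) + g (S (S (n + n)) - S (S k))%nat)%C
      (fun k => g (S k) + g (S (n + n - S k)))%C).
    - replace (S (S (n + n)) - 1)%nat with (S (n + n)) by lia; ring.
    - intros i Hi; do 2 f_equal; lia. }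
  apply G.
Qed.

(** * The finite tangent sum and its limit *)

Lemma half_lt_pow n m : (m < 2 ^ n)%nat -> 0 < half (S m) < 2 ^ n.
Proof.
  intros H; apply le_INR in H; rewrite pow_INR in H; simpl (INR 2) in H.
  replace (1 + 1) with 2 in H by lra.
  pose proof (half_S_ge m); unfold half in *; lra.
Qed.

(* The logarithmic derivative of [cos (N v) = 2^(N-1) prod_m (cos v - cos (PI (m+1/2) / N))]
   for [N = 2^n], by induction on [n] through the angle [2 v]. *)
Lemma tan_pow2_sum n v : Ccos (2 ^ n * v) <> 0%C ->
  (forall m, (m < 2 ^ n)%nat -> (Ccos v - RtoC (cos (PI * half (S m) / 2 ^ n)))%C <> 0%C) /\
  (Csin v * Cpsum (fun m => / (Ccos v - RtoC (cos (PI * half (S m) / 2 ^ n)))) (2 ^ n)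
   = 2 ^ n * (Csin (2 ^ n * v) / Ccos (2 ^ n * v)))%C.
Proof.
  revert v; induction n as [|n IH]; intros v Hv.
  - assert (E : (2 ^ 0 * v)%C = v) by (simpl; ring); rewrite E in *.
    assert (E0 : cos (PI * half 1 / 2 ^ 0) = 0).
    { unfold half; simpl; replace (PI * (1 - 1 / 2) / 1) with (PI / 2) by field; apply cos_PI2. }
    split.
    + intros [|m] Hm; [|simpl in Hm; lia].
      rewrite E0; intros F; apply Hv; rewrite <- F; ring.
    + change (2 ^ 0)%nat with 1%nat; rewrite Cpsum_S, Cpsum_0, E0; simpl.
      replace (Ccos v - 0)%C with (Ccos v) by ring.
      field; auto.
  - assert (E : (2 ^ S n * v)%C = (2 ^ n * (2 * v))%C) by (rewrite Cpow_S; ring).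
    rewrite E in *; destruct (IH _ Hv) as [NZ Sm]; clear IH.
    set (p := fun m => cos (PI * half (S m) / 2 ^ S n)).
    assert (P2 : 0 < 2 ^ n) by (apply pow_lt; lra).
    assert (Pd : forall m, cos (PI * half (S m) / 2 ^ n) = 2 * p m * p m - 1).
    { intros m; unfold p; rewrite <- cos_2a_cos; f_equal; simpl; field; lra. }
    assert (Pr : forall m, (m < 2 ^ n)%nat -> p (2 ^ n + 2 ^ n - S m)%nat = - p m).
    { intros m Hm; unfold p; rewrite <- Rtrigo_facts.cos_pi_minus; f_equal.
      assert (Ei : INR (S (2 ^ n + 2 ^ n - S m)) = 2 * 2 ^ n - INR m).
      { replace (S (2 ^ n + 2 ^ n - S m)) with (2 * 2 ^ n - m)%nat by lia.
        rewrite minus_INR, mult_INR, pow_INR by lia; change (INR 2) with 2; reflexivity. }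
      unfold half; rewrite Ei, S_INR; simpl; field; lra. }
    (* cos 2v - cos 2t = 2 (cos v - cos t) (cos v + cos t); by [Pr] the second factor belongs to the
       supplementary angle. *)
    assert (Fac : forall m, (Ccos (2 * v) - RtoC (cos (PI * half (S m) / 2 ^ n)))%C
       = (2 * (Ccos v - RtoC (p m)) * (Ccos v + RtoC (p m)))%C).
    { intros m; rewrite Pd, Ccos_double, RtoC_minus, !RtoC_mult; ring. }
    assert (NZ1 : forall m, (m < 2 ^ n)%nat ->
      (Ccos v - RtoC (p m))%C <> 0%C /\ (Ccos v + RtoC (p m))%C <> 0%C).
    { intros m Hm; specialize (NZ m Hm); rewrite Fac in NZ.
      split; intros F; apply NZ; rewrite F; ring. }
    assert (Dbl : (2 ^ S n = 2 ^ n + 2 ^ n)%nat) by (simpl; lia).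
    split.
    + rewrite Dbl; intros m Hm; fold (p m).
      destruct (Nat.lt_ge_cases m (2 ^ n)) as [L|L]; [apply NZ1; auto|].
      assert (L' : (2 ^ n + 2 ^ n - S m < 2 ^ n)%nat) by lia.
      specialize (Pr _ L').
      replace (2 ^ n + 2 ^ n - S (2 ^ n + 2 ^ n - S m))%nat with m in Pr by lia.
      rewrite Pr, RtoC_opp; destruct (NZ1 _ L') as [_ K].
      intros F; apply K; rewrite <- F; ring.
    + rewrite Dbl, Cpsum_reflect, Cpow_S.
      (* With c = cos v, a pair gives 1 / (c - p) + 1 / (c + p) = 2 c / (c^2 - p^2), and the
         denominator is half of cos 2v - cos 2t. *)
      rewrite (Cpsum_ext _ (fun m => (4 * Ccos v) * / (Ccos (2 * v) - RtoC (cos (PI * half (S m) / 2 ^ n))))%C).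
      * rewrite Cpsum_scal.
        replace (Csin v * (4 * Ccos v * Cpsum (fun m => / (Ccos (2 * v) - RtoC (cos (PI * half (S m) / 2 ^ n)))) (2 ^ n)))%C
          with (2 * (2 * Csin v * Ccos v * Cpsum (fun m => / (Ccos (2 * v) - RtoC (cos (PI * half (S m) / 2 ^ n)))) (2 ^ n)))%C by ring.
        rewrite <- Csin_double, Sm; ring.
      * intros m Hm; fold (p m) (p (2 ^ n + 2 ^ n - S m)%nat).
        rewrite Pr by auto; rewrite Fac, RtoC_opp.
        destruct (NZ1 m Hm) as [A B].
        field; repeat split; auto.
Qed.

(** Each component is a difference quotient at 0 of a real function of eps, so its limit is a
    derivative. *)
Lemma Csin_scaled_lim (eps : nat -> R) (z : C) :
  is_lim_seq eps 0 -> (forall n, eps n <> 0) ->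
  Clim (fun n => Csin (RtoC (eps n) * z) / RtoC (eps n))%C z.
Proof.
  intros He Hn; destruct z as [x y].
  assert (G : forall f l, f 0 = 0 -> derivable_pt_lim f 0 l ->
     is_lim_seq (fun n => f (eps n) / eps n) l).
  { intros f l F0 D; apply is_lim_seq_spec; intros d.
    destruct (D d (cond_pos d)) as [dl Hdl].
    apply is_lim_seq_spec in He; destruct (He dl) as [N HN]; exists N; intros n Ln.
    specialize (HN n Ln); rewrite Rminus_0_r in HN.
    specialize (Hdl (eps n) (Hn n) HN); rewrite F0, Rplus_0_l, Rminus_0_r in Hdl; auto. }
  split.
  - apply is_lim_seq_ext with (fun n => sin (eps n * x) * cosh (eps n * y) / eps n).
    + intros n; unfold Csin, Cdiv; simpl.
      replace (eps n * x - 0 * y) with (eps n * x) by ring.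
      replace (eps n * y + 0 * x) with (eps n * y) by ring.
      field; repeat split; auto; pose proof (Hn n); nra.
    + apply (G (fun t => sin (t * x) * cosh (t * y))); [rewrite !Rmult_0_l, sin_0; ring|].
      apply is_derive_Reals; unfold cosh; auto_derive; auto.
      rewrite !Rmult_0_l, Ropp_0, exp_0, cos_0, sin_0; simpl; field.
  - apply is_lim_seq_ext with (fun n => cos (eps n * x) * sinh (eps n * y) / eps n).
    + intros n; unfold Csin, Cdiv; simpl.
      replace (eps n * x - 0 * y) with (eps n * x) by ring.
      replace (eps n * y + 0 * x) with (eps n * y) by ring.
      field; repeat split; auto; pose proof (Hn n); nra.
    + apply (G (fun t => cos (t * x) * sinh (t * y))).
      { unfold sinh; rewrite !Rmult_0_l, Ropp_0, exp_0; field. }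
      apply is_derive_Reals; unfold sinh; auto_derive; auto.
      rewrite !Rmult_0_l, Ropp_0, exp_0, cos_0, sin_0; simpl; field.
Qed.

Lemma Rabs_Re_le (z : C) : Rabs (Re z) <= Cmod z.
Proof. eapply Rle_trans; [apply Rmax_l|apply Rmax_Cmod]. Qed.

Lemma Rabs_Im_le (z : C) : Rabs (Im z) <= Cmod z.
Proof. eapply Rle_trans; [apply Rmax_r|apply Rmax_Cmod]. Qed.

Lemma Cmod_minus_ge (u v : C) : Cmod u - Cmod v <= Cmod (u - v).
Proof.
  pose proof (Cmod_triangle (u - v) v) as H.
  replace (u - v + v)%C with u in H by ring; lra.
Qed.

Lemma Cmod_Csin_PI_half_lt (z : C) : Cmod z <= 1 / 20 -> Cmod (Csin (PI / 2 * z)) <= 1 / 5.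
Proof.
  intros Hz; pose proof PI_4; pose proof PI_RGT_0; pose proof (Cmod_ge_0 z).
  assert (E : Cmod (PI / 2 * z)%C = PI / 2 * Cmod z).
  { rewrite <- RtoC_div, Cmod_mult, Cmod_R, Rabs_pos_eq by lra; auto. }
  assert (L : PI / 2 * Cmod z <= 1 / 10) by nra.
  pose proof (Cmod_Csin_le (PI / 2 * z)%C ltac:(lra)); lra.
Qed.

(** cos (pi z) = 1 - 2 sin^2 (pi z / 2), and the subtracted term has modulus at most 2/25. *)
Lemma Ccos_PI_nonzero (z : C) : Cmod z <= 1 / 20 -> Ccos (PI * z) <> 0%C.
Proof.
  intros Hz; pose proof (Cmod_Csin_PI_half_lt z Hz) as L.
  replace (PI * z)%C with (2 * (PI / 2 * z))%C by (field; apply Cmod_gt_0; rewrite Cmod_R, Rabs_pos_eq; lra).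
  rewrite Ccos_double_sin; set (s := Csin (PI / 2 * z)) in *.
  intros F; assert (E : (2 * s * s)%C = 1%C)
    by (transitivity (2 * s * s + (1 - 2 * s * s))%C; [rewrite F|]; ring).
  apply (f_equal Cmod) in E; rewrite !Cmod_mult, Cmod_1, Cmod_R, Rabs_pos_eq in E by lra.
  pose proof (Cmod_ge_0 s); nra.
Qed.

(** Take [tan_pow2_sum] at v = pi z / 2^n and put e = pi / 2^(n+1). A difference of cosines there is
    2 e^2 (r^2 - s^2) with r = sin (e a) / e and s = sin (e z) / e, so after multiplication by pi /
    2^n = 2 e the powers of e cancel. The finite sum equals pi tan (pi z) for every n, its terms
    tend to those of the series as e tends to 0, and [tannery_psum] passes to the limit. *)
Lemma Cser_PI_Ctan (z : C) : Cmod z <= 1 / 20 ->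
  Cser (fun m => 2 * z / (RtoC (half (S m)) * RtoC (half (S m)) - z * z))%C
    (PI * Ctan (PI * z))%C.
Proof.
  intros Hz; pose proof PI_4 as P4; pose proof PI_RGT_0 as P0; pose proof (Cmod_ge_0 z) as Z0.
  set (e := fun n => PI / 2 / 2 ^ n).
  assert (e0 : forall n, 0 < e n <= 2).
  { intros n; unfold e; assert (1 <= 2 ^ n) by (apply pow_R1_Rle; lra); split.
    - apply Rdiv_lt_0_compat; lra.
    - apply Rmult_le_reg_r with (2 ^ n); [lra|].
      unfold Rdiv; rewrite !Rmult_assoc, Rinv_l by lra; lra. }
  assert (elim : is_lim_seq e 0).
  { apply is_lim_seq_ext with (fun n => PI / 2 * (/ 2) ^ n).
    - intros n; unfold e; rewrite pow_inv; auto.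
    - replace (Finite 0) with (Rbar_mult (PI / 2) 0) by (simpl; f_equal; ring).
      apply is_lim_seq_scal_l, is_lim_seq_geom; rewrite Rabs_pos_eq; lra. }
  set (s := fun n => (Csin (e n * z) / e n)%C).
  set (s2 := fun n => (Csin (e n * (2 * z)) / e n)%C).
  set (r := fun n m => sin (e n * half (S m)) / e n).
  set (u := fun n m => (s2 n * / (r n m * r n m - s n * s n))%C).
  assert (eC : forall n, RtoC (e n) <> 0%C).
  { intros n F; apply (f_equal Re) in F; simpl in F; specialize (e0 n); lra. }
  assert (Cme : forall n w, Cmod (e n * w)%C = e n * Cmod w).
  { intros n w; rewrite Cmod_mult, Cmod_R, Rabs_pos_eq; auto; specialize (e0 n); lra. }
  assert (Hs : forall n, Cmod (s n) <= 2 * Cmod z).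
  { intros n; unfold s; rewrite Cmod_div, Cmod_R, Rabs_pos_eq by (auto; specialize (e0 n); lra).
    specialize (e0 n); apply Rmult_le_reg_r with (e n); [lra|].
    unfold Rdiv; rewrite Rmult_assoc, Rinv_l, Rmult_1_r by lra.
    eapply Rle_trans; [apply Cmod_Csin_le; rewrite Cme; nra|]; rewrite Cme; lra. }
  assert (Hs2 : forall n, Cmod (s2 n) <= 4 * Cmod z).
  { intros n; unfold s2; rewrite Cmod_div, Cmod_R, Rabs_pos_eq by (auto; specialize (e0 n); lra).
    assert (E2 : Cmod (2 * z)%C = 2 * Cmod z) by (rewrite Cmod_mult, Cmod_R, Rabs_pos_eq; lra).
    specialize (e0 n); apply Rmult_le_reg_r with (e n); [lra|].
    unfold Rdiv; rewrite Rmult_assoc, Rinv_l, Rmult_1_r by lra.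
    eapply Rle_trans; [apply Cmod_Csin_le; rewrite Cme, E2; nra|]; rewrite Cme, E2; lra. }
  assert (Hr : forall n m, (m < 2 ^ n)%nat -> half (S m) / 3 <= r n m).
  { intros n m Hm; pose proof (half_lt_pow n m Hm); specialize (e0 n); unfold r.
    apply Rmult_le_reg_r with (e n); [lra|].
    unfold Rdiv at 2; rewrite Rmult_assoc, Rinv_l, Rmult_1_r by lra.
    assert (J : e n * half (S m) <= PI / 2).
    { unfold e; replace (PI / 2) with (PI / 2 / 2 ^ n * 2 ^ n) at 2 by (field; lra).
      apply Rmult_le_compat_l; unfold e in *; lra. }
    pose proof (sin_ge_third (e n * half (S m))); nra. }
  (* For t >= 1/2, t^2 / 9 - 1/100 >= t^2 / 16. The radius 1/20 is sized for this: it makes |s n| <=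
     2 |z| <= 1/10. *)
  assert (Hden : forall (a : R) (b : C) (t : R), 1 / 2 <= t -> t / 3 <= a -> Cmod b <= 1 / 10 ->
     t ^ 2 / 16 <= Cmod (RtoC a * RtoC a - b * b)%C).
  { intros a b t Ht Ha Hb; eapply Rle_trans; [|apply Cmod_minus_ge].
    rewrite !Cmod_mult, Cmod_R, Rabs_pos_eq by lra; pose proof (Cmod_ge_0 b); nra. }
  assert (Hu : forall n m, (m < 2 ^ n)%nat -> Cmod (u n m) <= 4 * / half (S m) ^ 2).
  { intros n m Hm; unfold u; pose proof (half_S_ge m).
    assert (D := Hden (r n m) (s n) (half (S m)) ltac:(auto) (Hr n m Hm)
      ltac:(specialize (Hs n); lra)).
    assert (0 < half (S m) ^ 2) by (apply pow_lt; lra).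
    rewrite Cmod_mult, Cmod_inv by (apply Cmod_gt_0; lra).
    replace (4 * / half (S m) ^ 2) with (1 / 4 * / (half (S m) ^ 2 / 16)) by (field; lra).
    apply Rmult_le_compat; [apply Cmod_ge_0|left; apply Rinv_0_lt_compat; lra| |].
    - specialize (Hs2 n); lra.
    - apply Rinv_le_contravar; lra. }
  assert (Hul : forall m, Clim (fun n => u n m)
     (2 * z * / (RtoC (half (S m)) * RtoC (half (S m)) - z * z))%C).
  { intros m; pose proof (half_S_ge m); unfold u.
    apply Clim_mult; [apply (Csin_scaled_lim e (2 * z)%C); auto; intros n; specialize (e0 n); lra|].
    apply Clim_inv.
    - apply Cmod_gt_0; apply Rlt_le_trans with (half (S m) ^ 2 / 16).
      + assert (0 < half (S m) ^ 2) by (apply pow_lt; lra); lra.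
      + apply Hden; lra.
    - assert (L : Clim (fun n => RtoC (r n m)) (RtoC (half (S m)))).
      { apply Clim_ext with (fun n => Csin (e n * half (S m)) / e n)%C.
        - intros n; unfold r; rewrite RtoC_div by (specialize (e0 n); lra).
          rewrite <- RtoC_mult; f_equal; unfold Csin; apply C_eq; simpl.
          + unfold cosh; rewrite Ropp_0, exp_0; field.
          + unfold sinh; rewrite Ropp_0, exp_0; field.
        - apply Csin_scaled_lim; auto; intros n; specialize (e0 n); lra. }
      assert (L' : Clim s z) by (apply Csin_scaled_lim; auto; intros n; specialize (e0 n); lra).
      apply Clim_minus; apply Clim_mult; auto. }
  assert (Id : forall n, Cpsum (u n) (2 ^ n) = (PI * Ctan (PI * z))%C).
  { intros n; set (v := (2 * (e n * z))%C).
    assert (Ev : (2 ^ n * v)%C = (PI * z)%C).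
    { unfold v, e; assert (0 < 2 ^ n) by (apply pow_lt; lra).
      rewrite !RtoC_div, RtoC_pow by lra; field.
      apply Cpow_nz; intros F; apply (f_equal Re) in F; simpl in F; lra. }
    destruct (tan_pow2_sum n v) as [NZ Sm]; [rewrite Ev; apply Ccos_PI_nonzero; auto|].
    rewrite Ev in Sm; unfold Ctan.
    replace (PI * (Csin (PI * z) / Ccos (PI * z)))%C
      with (PI / 2 ^ n * (2 ^ n * (Csin (PI * z) / Ccos (PI * z))))%C.
    2: { field; split; [apply Ccos_PI_nonzero; auto|apply Cpow_nz; intros F; apply (f_equal Re) in F; simpl in F; lra]. }
    rewrite <- Sm, Cmult_assoc, <- Cpsum_scal; apply Cpsum_ext; intros m Hm.
    specialize (NZ m Hm); unfold u.
    assert (Ed : (Ccos v - RtoC (cos (PI * half (S m) / 2 ^ n)))%C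
       = (2 * e n * e n * (r n m * r n m - s n * s n))%C).
    { unfold v; rewrite Ccos_double_sin; unfold s, r.
      replace (PI * half (S m) / 2 ^ n) with (2 * (e n * half (S m)))
        by (unfold e; field; apply pow_nonzero; lra).
      rewrite cos_2a_sin, RtoC_div by (specialize (e0 n); lra).
      rewrite RtoC_minus, !RtoC_mult; field; auto. }
    rewrite Ed in *.
    assert (Es : Csin v = (e n * s2 n)%C).
    { unfold s2, v; replace (2 * (e n * z))%C with (e n * (2 * z))%C by ring; field; auto. }
    rewrite Es.
    replace (PI / 2 ^ n)%C with (2 * e n)%C.
    2: { unfold e; assert (0 < 2 ^ n) by (apply pow_lt; lra).
      rewrite !RtoC_div, RtoC_pow by lra; field.
      apply Cpow_nz; intros F; apply (f_equal Re) in F; simpl in F; lra. }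
    field; split; auto; intros F; apply NZ; rewrite F; ring. }
  (* Stated for a real functional bounded by the modulus, then used for [Re] and for [Im]; the
     sequence of finite sums is constant, so the limit is known. *)
  assert (T : forall f : C -> R, (forall w, Rabs (f w) <= Cmod w) ->
     (forall n, psum (fun m => f (u n m)) (2 ^ n) = f (PI * Ctan (PI * z))%C) ->
     (forall m, is_lim_seq (fun n => f (u n m))
        (f (2 * z / (RtoC (half (S m)) * RtoC (half (S m)) - z * z))%C)) ->
     is_series (fun m => f (2 * z / (RtoC (half (S m)) * RtoC (half (S m)) - z * z))%C)
       (f (PI * Ctan (PI * z))%C)).
  { intros f Hf Hsum Hlim.
    destruct (tannery_psum (fun n m => f (u n m)) (fun n => (2 ^ n)%nat)
      (fun m => f (2 * z / (RtoC (half (S m)) * RtoC (half (S m)) - z * z))%C)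
      (fun m => 4 * / half (S m) ^ 2)) as [E L]; [| | | |exact Hlim|].
    - intros n m Hm; eapply Rle_trans; [apply Hf|auto].
    - intros m; pose proof (half_S_ge m).
      apply Rmult_le_pos; [lra|left; apply Rinv_0_lt_compat, pow_lt; lra].
    - apply ex_series_Rscal, ex_series_inv_half_pow; lia.
    - intros m; exists m; intros n Hn; apply Nat.le_lt_trans with n; auto.
      apply Nat.pow_gt_lin_r; lia.
    - apply is_lim_seq_ext with (v := fun _ => f (PI * Ctan (PI * z))%C) in L; auto.
      apply is_lim_seq_unique in L; rewrite Lim_seq_const in L.
      injection L as L; rewrite L; apply Series_correct; auto. }
  split; apply T.
  - apply Rabs_Re_le.
  - intros n; rewrite <- (Id n); reflexivity.
  - intros m; apply Hul.
  - apply Rabs_Im_le.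
  - intros n; rewrite <- (Id n); reflexivity.
  - intros m; apply Hul.
Qed.

(** * Complex power series *)


Lemma psum_rev f n : psum f n = psum (fun k => f (n - S k)%nat) n.
Proof.
  revert f; induction n as [|n IH]; intros f; [reflexivity|].
  rewrite psum_head, IH; cbn [psum]; rewrite Nat.sub_diag, Rplus_comm; f_equal.
  apply psum_ext; intros i Hi; f_equal; lia.
Qed.

Lemma Cpsum_rev f n : Cpsum f n = Cpsum (fun k => f (n - S k)%nat) n.
Proof. apply C_eq; apply psum_rev. Qed.

Lemma Cser_unique f l : Cser f l -> CSeries f = l.
Proof. intros [A B]; apply C_eq; apply is_series_unique; assumption. Qed.

Lemma Cser_ext f g l : (forall n, f n = g n) -> Cser f l -> Cser g l.
Proof.
  intros E [A B]; split; eapply is_series_ext; eauto; intros; simpl; rewrite E; auto.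
Qed.

Lemma Cser_minus f g l m : Cser f l -> Cser g m -> Cser (fun n => f n - g n)%C (l - m)%C.
Proof.
  intros [A B] [A' B']; split.
  - apply (is_series_minus _ _ _ _ A A').
  - apply (is_series_minus _ _ _ _ B B').
Qed.

Lemma is_series_Rscal (c : R) f (l : R) : is_series f l -> is_series (fun n => c * f n) (c * l).
Proof. apply (is_series_scal_l c f l). Qed.

Lemma Cser_scal c f l : Cser f l -> Cser (fun n => c * f n)%C (c * l)%C.
Proof.
  intros [A B]; split.
  - apply (is_series_minus _ _ _ _ (is_series_Rscal (Re c) _ _ A) (is_series_Rscal (Im c) _ _ B)).
  - apply (is_series_plus _ _ _ _ (is_series_Rscal (Re c) _ _ B) (is_series_Rscal (Im c) _ _ A)).
Qed.

Lemma Cser_trunc f K : Cser (fun k => if (k <? K)%nat then f k else 0%C) (Cpsum f K).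
Proof.
  split; [pose proof (is_series_trunc (fun k => Re (f k)) K) as H
         |pose proof (is_series_trunc (fun k => Im (f k)) K) as H];
    revert H; apply is_series_ext; intros n; destruct (n <? K)%nat; reflexivity.
Qed.

Lemma is_series_drop f (l : R) K : is_series f l -> is_series (fun k => f (K + k)%nat) (l - psum f K).
Proof.
  intros H; apply is_series_psum in H; apply is_series_psum.
  apply is_lim_seq_ext with (fun n => psum f (n + K) - psum f K).
  - intros n; rewrite Nat.add_comm, psum_add; ring.
  - apply is_lim_seq_minus'; [apply (is_lim_seq_incr_n (psum f) K); auto|apply is_lim_seq_const].
Qed.

Lemma Cser_drop f l K : Cser f l -> Cser (fun k => f (K + k)%nat) (l - Cpsum f K)%C.
Proof. intros [A B]; split; [apply (is_series_drop _ _ K A)|apply (is_series_drop _ _ K B)]. Qed.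

Lemma is_series_cons (f : nat -> R) (l : R) :
  is_series (fun k => f (S k)) l -> is_series f (f O + l).
Proof.
  intros H; apply is_series_psum in H; apply is_series_psum.
  apply is_lim_seq_incr_1, is_lim_seq_ext with (fun n => f O + psum (fun k => f (S k)) n).
  - intros n; rewrite psum_head; auto.
  - apply is_lim_seq_plus'; auto; apply is_lim_seq_const.
Qed.

Lemma Cser_cons f l : Cser (fun k => f (S k)) l -> Cser f (f O + l)%C.
Proof.
  intros [A B]; split;
    [apply (is_series_cons (fun k => Re (f k))); exact A
    |apply (is_series_cons (fun k => Im (f k))); exact B].
Qed.

(** A ball of C is the product of two real balls, so componentwise convergence is enough. *)
Lemma Cser_is_series f l : Cser f l -> @is_series C_AbsRing C_NormedModule f l.
Proof.
  intros [A B].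
  assert (Sm : forall n, sum_n (G := C_NormedModule) f n
     = (sum_n (fun k => Re (f k)) n, sum_n (fun k => Im (f k)) n)).
  { induction n as [|n IH]; [rewrite !sum_O; destruct (f 0%nat); auto|].
    rewrite !sum_Sn, IH; reflexivity. }
  intros P [eps HP].
  specialize (A (fun x => ball (Re l) eps x) (ex_intro _ eps (fun x H => H))).
  specialize (B (fun x => ball (Im l) eps x) (ex_intro _ eps (fun x H => H))).
  destruct A as [N HN], B as [M HM]; exists (N + M)%nat; intros n Hn.
  apply HP; rewrite Sm; split; [apply HN|apply HM]; lia.
Qed.

Definition Cps (a : nat -> R) (z w : C) : Prop := Cser (fun k => RtoC (a k) * Cpow z k)%C w.

(** The coefficients in play are O(2^k), their poles being at distance at least 1/2 from 0. The
    radius 1/4 lies inside that disc, and absolute convergence there survives Cauchy products. *)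
Definition abs_conv (a : nat -> R) : Prop := ex_series (fun k => Rabs (a k) * (1 / 4) ^ k).

(** The real Cauchy product theorem is applied to the four products of real and imaginary parts; z^n
    = z^k z^(n-k) recombines them. *)
Lemma Cps_mult a b z u v : abs_conv a -> abs_conv b -> Cmod z <= 1 / 4 ->
  Cps a z u -> Cps b z v -> Cps (PS_mult a b) z (u * v)%C.
Proof.
  intros Ha Hb Hz [Ar Ai] [Br Bi].
  assert (Abs : forall c (f : C -> R), abs_conv c -> (forall w, Rabs (f w) <= Cmod w) ->
     ex_series (fun k => Rabs (f (RtoC (c k) * Cpow z k)%C))).
  { intros c f Hc Hf; apply ex_series_dom with (2 := Hc); intros n; rewrite Rabs_Rabsolu.
    eapply Rle_trans; [apply Hf|]; rewrite Cmod_mult, Cmod_R, Cmod_pow.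
    apply Rmult_le_compat_l; [apply Rabs_pos|apply pow_incr; split; auto; apply Cmod_ge_0]. }
  pose proof (fun c Hc => Abs c Re Hc Rabs_Re_le) as AR.
  pose proof (fun c Hc => Abs c Im Hc Rabs_Im_le) as AI.
  pose proof (is_series_mult _ _ _ _ Ar Br (AR a Ha) (AR b Hb)) as RR.
  pose proof (is_series_mult _ _ _ _ Ai Bi (AI a Ha) (AI b Hb)) as II.
  pose proof (is_series_mult _ _ _ _ Ar Bi (AR a Ha) (AI b Hb)) as RI.
  pose proof (is_series_mult _ _ _ _ Ai Br (AI a Ha) (AR b Hb)) as IR.
  assert (Pk : forall n k, (k <= n)%nat -> Cpow z n = (Cpow z k * Cpow z (n - k))%C).
  { intros n k L; rewrite <- Cpow_add_r; f_equal; lia. }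
  assert (Re_scal : forall (r : R) w, Re (RtoC r * w)%C = r * Re w) by (intros; simpl; unfold Re, Im; ring).
  assert (Im_scal : forall (r : R) w, Im (RtoC r * w)%C = r * Im w) by (intros; simpl; unfold Re, Im; ring).
  split.
  - generalize (is_series_minus _ _ _ _ RR II); apply is_series_ext; intros n.
    unfold PS_mult; rewrite Re_scal, !sum_f_R0_psum.
    change (psum (fun k => Re (RtoC (a k) * Cpow z k)%C * Re (RtoC (b (n - k)%nat) * Cpow z (n - k))%C) (S n)
      - psum (fun k => Im (RtoC (a k) * Cpow z k)%C * Im (RtoC (b (n - k)%nat) * Cpow z (n - k))%C) (S n)
      = psum (fun k => a k * b (n - k)%nat) (S n) * Re (Cpow z n)).
    rewrite <- psum_minus, Rmult_comm, <- psum_scal; apply psum_ext; intros k Hk.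
    rewrite (Pk n k) by lia; rewrite !Re_scal, !Im_scal; unfold Re, Im; cbn [Cmult fst snd]; ring.
  - generalize (is_series_plus _ _ _ _ RI IR); apply is_series_ext; intros n.
    unfold PS_mult; rewrite Im_scal, !sum_f_R0_psum.
    change (psum (fun k => Re (RtoC (a k) * Cpow z k)%C * Im (RtoC (b (n - k)%nat) * Cpow z (n - k))%C) (S n)
      + psum (fun k => Im (RtoC (a k) * Cpow z k)%C * Re (RtoC (b (n - k)%nat) * Cpow z (n - k))%C) (S n)
      = psum (fun k => a k * b (n - k)%nat) (S n) * Im (Cpow z n)).
    rewrite <- psum_plus, Rmult_comm, <- psum_scal; apply psum_ext; intros k Hk.
    rewrite (Pk n k) by lia; rewrite !Re_scal, !Im_scal; unfold Re, Im; cbn [Cmult fst snd]; ring.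
Qed.

Lemma abs_conv_mult a b : abs_conv a -> abs_conv b -> abs_conv (PS_mult a b).
Proof.
  intros Ha Hb.
  assert (P : forall c k, 0 <= Rabs (c k) * (1 / 4) ^ k)
    by (intros; apply Rmult_le_pos; [apply Rabs_pos|apply pow_le; lra]).
  assert (E := is_series_mult_pos _ _ _ _ (Series_correct _ Ha) (Series_correct _ Hb) (P a) (P b)).
  apply ex_series_dom with (2 := ex_intro _ _ E); intros n.
  rewrite Rabs_mult, Rabs_Rabsolu, (Rabs_pos_eq ((1 / 4) ^ n)) by (apply pow_le; lra).
  unfold PS_mult; rewrite !sum_f_R0_psum, Rmult_comm.
  eapply Rle_trans; [apply Rmult_le_compat_l; [apply pow_le; lra|apply psum_abs]|].
  rewrite <- psum_scal; right; apply psum_ext; intros k Hk.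
  rewrite Rabs_mult; replace n with (k + (n - k))%nat at 1 by lia; rewrite pow_add; ring.
Qed.

Lemma abs_conv_bound a c : (forall k, Rabs (a k) <= c * 2 ^ k) -> abs_conv a.
Proof.
  intros H; apply ex_series_dom with (fun k => c * (1 / 2) ^ k).
  - intros k; rewrite Rabs_mult, Rabs_Rabsolu, (Rabs_pos_eq ((1 / 4) ^ k)) by (apply pow_le; lra).
    replace (1 / 2) with (2 * (1 / 4)) by lra; rewrite Rpow_mult_distr, <- Rmult_assoc.
    apply Rmult_le_compat_r; [apply pow_le; lra|apply H].
  - apply ex_series_Rscal, ex_series_geom; rewrite Rabs_pos_eq; lra.
Qed.

(* Expanding each summand of [sum_m (1 / (x_m - z) - 1 / x_m)] geometrically. *)
Lemma pole_series (x : nat -> R) (z : C) :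
  (forall m, 1 / 2 <= x m) -> ex_series (fun m => / x m ^ 2) -> Cmod z <= 1 / 4 ->
  exists w, Cser (fun m => / (RtoC (x m) - z) - / RtoC (x m))%C w /\
    Cps (fun j => match j with O => 0 | S _ => Series (fun m => / x m ^ S j) end) z w.
Proof.
  intros Hx Ex Hz.
  assert (Hd : forall m, x m / 2 <= Cmod (RtoC (x m) - z)%C).
  { intros m; specialize (Hx m); eapply Rle_trans; [|apply Cmod_minus_ge].
    rewrite Cmod_R, Rabs_pos_eq by lra; lra. }
  assert (Hn : forall m, (RtoC (x m) - z)%C <> 0%C).
  { intros m; apply Cmod_gt_0; specialize (Hx m); specialize (Hd m); lra. }
  assert (Hn' : forall m, RtoC (x m) <> 0%C).
  { intros m F; apply (f_equal Re) in F; simpl in F; specialize (Hx m); lra. }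
  (* The remainder of the geometric series of 1 / (x m - z) after the powers 0, ..., J - 1. [rem 1]
     is the summand of the statement. *)
  set (rem := fun J m => (Cpow z J / (RtoC (x m ^ J) * (RtoC (x m) - z)))%C).
  assert (Hrem : forall J m, (1 <= J)%nat -> Cmod (rem J m) <= (1 / 2) ^ J * / x m ^ 2).
  { intros J m HJ; unfold rem; specialize (Hx m); specialize (Hd m).
    assert (PJ : 0 < x m ^ J) by (apply pow_lt; lra).
    unfold Cdiv; rewrite Cmod_mult, Cmod_inv, Cmod_mult, Cmod_R, Rabs_pos_eq, Cmod_pow; try lra.
    2: { apply Cmult_neq_0; auto; intros F; apply (f_equal Re) in F; simpl in F; lra. }
    destruct J as [|J]; [lia|].
    assert (PJ' : (1 / 2) ^ J <= x m ^ J) by (apply pow_incr; lra).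
    assert (Q : 0 < (1 / 2) ^ J) by (apply pow_lt; lra).
    replace ((1 / 2) ^ S J * / x m ^ 2) with ((1 / 4) ^ S J * / ((1 / 2) ^ J * x m * (x m / 2) )).
    - apply Rmult_le_compat.
      + apply pow_le, Cmod_ge_0.
      + left; apply Rinv_0_lt_compat, Rmult_lt_0_compat; lra.
      + apply pow_incr; split; auto; apply Cmod_ge_0.
      + apply Rinv_le_contravar; [repeat apply Rmult_lt_0_compat; lra|].
        simpl; rewrite (Rmult_comm (x m)).
        apply Rmult_le_compat; auto; try lra; [apply Rmult_le_pos; lra|].
        apply Rmult_le_compat_r; lra.
    - simpl; replace ((1 / 4) ^ J) with ((1 / 2) ^ J * (1 / 2) ^ J)
        by (rewrite <- Rpow_mult_distr; f_equal; lra).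
      field; split; [lra|apply Rgt_not_eq, Q]. }
  assert (R1 : forall m, rem 1%nat m = (/ (RtoC (x m) - z) - / RtoC (x m))%C).
  { intros m; unfold rem; rewrite pow_1; simpl; field; auto. }
  set (s := fun j => Series (fun m => / x m ^ j)).
  assert (Es : forall j, ex_series (fun m => / x m ^ S (S j))).
  { intros j; apply ex_series_dom with (fun m => 2 ^ j * / x m ^ 2); [|apply ex_series_Rscal; auto].
    intros m; specialize (Hx m); assert (0 < x m ^ S (S j)) by (apply pow_lt; lra).
    rewrite Rabs_pos_eq by (left; apply Rinv_0_lt_compat; auto).
    replace (2 ^ j * / x m ^ 2) with (/ ((1 / 2) ^ j * x m ^ 2)).
    2: { rewrite Rinv_mult; f_equal; rewrite <- pow_inv; f_equal; lra. }
    assert (0 < (1 / 2) ^ j) by (apply pow_lt; lra).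
    assert (0 < x m ^ 2) by (apply pow_lt; lra).
    apply Rinv_le_contravar; [apply Rmult_lt_0_compat; auto|].
    replace (S (S j)) with (j + 2)%nat by lia; rewrite pow_add.
    apply Rmult_le_compat_r; [lra|apply pow_incr; lra]. }
  (* Again for a real functional, to be [Re] and [Im]. By [Id], removing the powers below z^(J+1)
     from the total leaves the sum over m of [rem (S J) m], which is O(2^(-J)); this exchanges the
     two summations. *)
  assert (K : forall f : C -> R, (forall w, Rabs (f w) <= Cmod w) ->
     (forall u v, f (u - v)%C = f u - f v) -> (forall (r : R) v, f (RtoC r * v)%C = r * f v) ->
     exists l : R, is_series (fun m => f (rem 1%nat m)) l /\
       is_series (fun j => f (RtoC (match j with O => 0 | S _ => s (S j) end) * Cpow z j)%C) l).
  { intros f Hf Hm Hs.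
    assert (EJ : forall J, ex_series (fun m => f (rem (S J) m))).
    { intros J; apply ex_series_dom with (fun m => (1 / 2) ^ S J * / x m ^ 2).
      - intros m; eapply Rle_trans; [apply Hf|apply Hrem; lia].
      - apply ex_series_Rscal; auto. }
    exists (Series (fun m => f (rem 1%nat m))); split; [apply Series_correct, EJ|].
    set (c := fun j => f (RtoC (match j with O => 0 | S _ => s (S j) end) * Cpow z j)%C).
    set (l := Series (fun m => f (rem 1%nat m))).
    assert (Id : forall J, l - psum c (S J) = Series (fun m => f (rem (S J) m))).
    { induction J as [|J IH].
      - simpl; unfold c; rewrite Hs; unfold l; ring.
      - cbn [psum]; cbn [psum] in IH.
        replace (l - (psum c J + c J + c (S J))) with (l - (psum c J + c J) - c (S J)) by ring.
        rewrite IH; unfold c at 1; rewrite Hs; unfold s.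
        rewrite <- Series_scal_r, <- Series_minus.
        2: apply EJ.
        2: { eapply ex_series_ext; [|apply (ex_series_Rscal (f (Cpow z (S J)))), (Es J)].
             intros m; apply Rmult_comm. }
        apply Series_ext; intros m; rewrite <- Hs, <- Hm.
        assert (E : (rem (S J) m - RtoC (/ x m ^ S (S J)) * Cpow z (S J))%C = rem (S (S J)) m).
        { unfold rem; rewrite RtoC_inv by (apply pow_nonzero; specialize (Hx m); lra).
          rewrite !RtoC_pow, !Cpow_S; field; repeat split; auto.
          apply Cpow_nz; auto. }
        rewrite <- E; reflexivity. }
    apply is_series_psum, is_lim_seq_incr_1.
    apply is_lim_seq_ext with (fun J => l - Series (fun m => f (rem (S J) m)));
      [intros J; rewrite <- Id; unfold Rminus; lra|].
    replace (Finite l) with (Finite (l - 0)) by (rewrite Rminus_0_r; reflexivity).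
    apply is_lim_seq_minus'; [apply is_lim_seq_const|].
    apply is_lim_seq_abs_0.
    apply is_lim_seq_le_le with (fun _ => 0) (fun J => (1 / 2) ^ S J * s 2%nat).
    - intros J; split; [apply Rabs_pos|].
      unfold s; rewrite <- Series_scal_l.
      eapply Rle_trans; [apply Series_Rabs|apply Series_le].
      + apply ex_series_dom with (fun m => (1 / 2) ^ S J * / x m ^ 2).
        * intros m; rewrite Rabs_Rabsolu; eapply Rle_trans; [apply Hf|apply Hrem; lia].
        * apply ex_series_Rscal; auto.
      + intros m; split; [apply Rabs_pos|eapply Rle_trans; [apply Hf|apply Hrem; lia]].
      + apply ex_series_Rscal; auto.
    - apply is_lim_seq_const.
    - replace (Finite 0) with (Finite (0 * s 2%nat)) by (rewrite Rmult_0_l; reflexivity).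
      apply is_lim_seq_mult'; [|apply is_lim_seq_const].
      apply (is_lim_seq_incr_1 (fun J => (1 / 2) ^ J)), is_lim_seq_geom; rewrite Rabs_pos_eq; lra. }
  destruct (K Re Rabs_Re_le) as [lr [Kr Kr']]; [reflexivity|intros; simpl; unfold Re, Im; ring|].
  destruct (K Im Rabs_Im_le) as [li [Ki Ki']]; [reflexivity|intros; simpl; unfold Re, Im; ring|].
  exists (lr, li); split; split; cbn [Re Im fst snd].
  - revert Kr; apply is_series_ext; intros m; rewrite R1; auto.
  - revert Ki; apply is_series_ext; intros m; rewrite R1; auto.
  - exact Kr'.
  - exact Ki'.
Qed.

(** * The residue at the origin *)


(** The Taylor coefficients of pi tan (pi z) at 0. By [half_odd_sum], index j is also the sum of (a
    - n)^(-(j+1)) over all half-odd-integers a, for every natural n. *)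
Definition tan_coef (j : nat) : R := (1 - (-1) ^ j) * ttilde (S j).

(** The Taylor coefficients of z Psi (1/2 - z) at 0, the factor z removing the pole. *)
Definition psi_coef (j : nat) : R :=
  match j with O => 1 | S O => 2 * ln 2 | _ => - zeta j end.

(** The Taylor coefficients of z^(q+3) times the kernel, the same for every q; index q + 2 is the
    residue. *)
Definition kernel_coef : nat -> R :=
  PS_mult tan_coef (PS_mult psi_coef (PS_mult psi_coef psi_coef)).

Lemma zeta_Series s : zeta s = Series (fun m => / INR (S m) ^ s).
Proof. apply msum_1. Qed.

Lemma ttilde_Series s : ttilde s = Series (fun m => / half (S m) ^ s).
Proof. apply msum_1. Qed.

Lemma INR_S_ge m : 1 / 2 <= INR (S m).
Proof. rewrite S_INR; pose proof (pos_INR m); lra. Qed.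

(** Each surplus factor 1 / x m is at most 2, which gives the growth required by
    [abs_conv_bound]. *)
Lemma Series_inv_pow_bound (x : nat -> R) j :
  (forall m, 1 / 2 <= x m) -> ex_series (fun m => / x m ^ 2) ->
  0 <= Series (fun m => / x m ^ S (S j)) <= Series (fun m => / x m ^ 2) * 2 ^ S j.
Proof.
  intros Hx Ex.
  assert (P : forall m, 0 <= / x m ^ S (S j) <= / x m ^ 2 * 2 ^ S j).
  { intros m; specialize (Hx m).
    assert (0 < x m ^ S (S j)) by (apply pow_lt; lra).
    assert (0 < (1 / 2) ^ j) by (apply pow_lt; lra).
    assert (0 < x m ^ 2) by (apply pow_lt; lra).
    split; [left; apply Rinv_0_lt_compat; auto|].
    apply Rle_trans with (/ x m ^ 2 * 2 ^ j).
    2: { apply Rmult_le_compat_l; [left; apply Rinv_0_lt_compat; auto|].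
         apply Rle_pow; [lra|lia]. }
    replace (2 ^ j) with (/ (1 / 2) ^ j) by (rewrite <- pow_inv; f_equal; lra).
    rewrite <- Rinv_mult; apply Rinv_le_contravar; [apply Rmult_lt_0_compat; auto|].
    replace (S (S j)) with (2 + j)%nat by lia; rewrite pow_add.
    apply Rmult_le_compat_l; [lra|apply pow_incr; lra]. }
  assert (E2 : ex_series (fun m => / x m ^ 2 * 2 ^ S j)).
  { apply ex_series_ext with (fun m => 2 ^ S j * / x m ^ 2);
      [intros; apply Rmult_comm|apply ex_series_Rscal; auto]. }
  split.
  - rewrite <- (Rmult_0_l (Series (fun m => / x m ^ S (S j)))), <- Series_scal_l.
    apply Series_le; [intros m; specialize (P m); lra|].
    apply ex_series_dom with (2 := E2); intros m; rewrite Rabs_pos_eq; apply P.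
  - rewrite <- Series_scal_r; apply Series_le; auto.
Qed.

Lemma abs_conv_tan_coef : abs_conv tan_coef.
Proof.
  apply abs_conv_bound with (2 * Series (fun m => / half (S m) ^ 2)); intros [|j].
  - unfold tan_coef; simpl pow; rewrite Rminus_diag, Rmult_0_l, Rabs_R0.
    destruct (Series_inv_pow_bound (fun m => half (S m)) 0) as [A _];
      [apply half_S_ge|apply ex_series_inv_half_pow; lia|].
    simpl pow in *; lra.
  - unfold tan_coef; rewrite ttilde_Series, Rabs_mult.
    destruct (Series_inv_pow_bound (fun m => half (S m)) j) as [A B];
      [apply half_S_ge|apply ex_series_inv_half_pow; lia|].
    rewrite (Rabs_pos_eq (Series _)), Rmult_assoc by auto.
    apply Rmult_le_compat; auto; [apply Rabs_pos|].
    unfold Rminus; eapply Rle_trans; [apply Rabs_triang|].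
    rewrite Rabs_Ropp, Rabs_R1, pow_1_abs; lra.
Qed.

Lemma abs_conv_psi_coef : abs_conv psi_coef.
Proof.
  set (s := Series (fun m => / INR (S m) ^ 2)).
  assert (Es : ex_series (fun m => / INR (S m) ^ 2)) by (apply ex_series_inv_INR_pow; lia).
  assert (S0 : 0 <= s) by (apply (Series_inv_pow_bound (fun m => INR (S m)) 0 INR_S_ge Es)).
  assert (L0 : 0 < ln 2 <= 1) by (pose proof ln_lt_2; pose proof (ln_le_minus_1 2); lra).
  apply abs_conv_bound with (1 + s); intros [|[|j]]; unfold psi_coef.
  - rewrite Rabs_R1; simpl; lra.
  - rewrite Rabs_pos_eq by lra; simpl; lra.
  - rewrite Rabs_Ropp, zeta_Series.
    destruct (Series_inv_pow_bound (fun m => INR (S m)) j INR_S_ge Es) as [A B]; fold s in B.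
    rewrite Rabs_pos_eq by auto; eapply Rle_trans; [apply B|].
    assert (0 < 2 ^ S j) by (apply pow_lt; lra).
    replace (2 ^ S (S j)) with (2 * 2 ^ S j) by reflexivity; nra.
Qed.

(** 2 z / (a^2 - z^2) is the difference of 1 / (a - z) - 1 / a and the same expression at -z, so the
    coefficients of even index cancel. *)
Lemma Cps_tan (z : C) : Cmod z <= 1 / 20 -> Cps tan_coef z (PI * Ctan (PI * z))%C.
Proof.
  intros Hz.
  assert (Eh := ex_series_inv_half_pow 2 ltac:(lia)).
  destruct (pole_series (fun m => half (S m)) z half_S_ge Eh ltac:(lra)) as [w1 [A1 B1]].
  destruct (pole_series (fun m => half (S m)) (- z)%C half_S_ge Eh ltac:(rewrite Cmod_opp; lra)) as [w2 [A2 B2]].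
  assert (E : (PI * Ctan (PI * z))%C = (w1 - w2)%C).
  { rewrite <- (Cser_unique _ _ (Cser_PI_Ctan z Hz)).
    apply Cser_unique, Cser_ext with (2 := Cser_minus _ _ _ _ A1 A2); intros m.
    assert (Q : forall w, Cmod w <= 1 / 20 -> (RtoC (half (S m)) - w)%C <> 0%C).
    { intros w Hw; apply Cmod_gt_0; eapply Rlt_le_trans; [|apply Cmod_minus_ge].
      pose proof (half_S_ge m); rewrite Cmod_R, Rabs_pos_eq; lra. }
    pose proof (Q z Hz) as Q1; pose proof (Q (- z)%C ltac:(rewrite Cmod_opp; lra)) as Q2.
    replace (RtoC (half (S m)) * RtoC (half (S m)) - z * z)%C
      with ((RtoC (half (S m)) - z) * (RtoC (half (S m)) - - z))%C by ring.
    assert (RtoC (half (S m)) <> 0%C).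
    { intros F; apply (f_equal Re) in F; simpl in F; pose proof (half_S_ge m); lra. }
    field; repeat split; auto. }
  rewrite E; apply Cser_ext with (2 := Cser_minus _ _ _ _ B1 B2); intros [|j]; unfold tan_coef.
  - simpl pow; rewrite Rminus_diag, Rmult_0_l; simpl; ring.
  - rewrite ttilde_Series, RtoC_mult, RtoC_minus, RtoC_pow.
    assert (O : Cpow (- z) (S j) = (RtoC (-1) ^ S j * Cpow z (S j))%C).
    { rewrite <- Cpow_mult_l; f_equal; ring. }
    rewrite O; ring.
Qed.

(** Split 1 / (n - 1/2) - 1 / (n - z) as (1 / (n - 1/2) - 1 / n) - (1 / (n - z) - 1 / n). The first
    part has partial sums h_N - H_N and total 2 log 2; the second is expanded by [pole_series]. *)
Lemma Psi_shift (z : C) : Cmod z <= 1 / 20 -> z <> 0%C ->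
  Cps psi_coef z (z * Psi (RtoC (1 / 2) - z))%C.
Proof.
  intros Hz z0.
  assert (Ei := ex_series_inv_INR_pow 2 ltac:(lia)).
  destruct (pole_series (fun m => INR (S m)) z INR_S_ge Ei ltac:(lra)) as [w [A B]].
  assert (L : Cser (fun m => RtoC (/ half (S m) - / INR (S m))) (RtoC (2 * ln 2))).
  { split; simpl.
    - apply is_series_psum, is_lim_seq_ext with (2 := h_sub_harm_lim); intros n.
      rewrite h_psum; unfold harm; rewrite <- psum_minus; reflexivity.
    - apply is_series_psum, is_lim_seq_ext with (fun _ => 0); [|apply is_lim_seq_const].
      intros n; symmetry; apply psum_zero; auto. }
  assert (E : Psi (RtoC (1 / 2) - z) = (/ z + (RtoC (2 * ln 2) - w))%C).
  { unfold Psi; f_equal; [f_equal; ring|].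
    apply Cser_unique, Cser_ext with (2 := Cser_minus _ _ _ _ L A); intros m.
    assert (half (S m) <> 0) by (pose proof (half_S_ge m); lra).
    assert (INR (S m) <> 0) by (pose proof (INR_S_ge m); lra).
    rewrite RtoC_minus, !RtoC_inv by auto.
    replace (RtoC (half (S m)) - - (RtoC (1 / 2) - z))%C with (RtoC (INR (S m)) - z)%C; [ring|].
    unfold half; rewrite RtoC_minus; ring. }
  rewrite E.
  replace (z * (/ z + (RtoC (2 * ln 2) - w)))%C
    with (RtoC (psi_coef 0) * Cpow z 0 + (RtoC (psi_coef 1) * Cpow z 1 + - z * w))%C
    by (simpl; rewrite RtoC_mult; field; auto).
  apply Cser_cons, (Cser_cons (fun k => RtoC (psi_coef (S k)) * Cpow z (S k))%C).
  (* The series of [pole_series] has constant term 0; without it, the factor -z moves its k-th term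
     to degree k + 2, where [psi_coef] is -zeta. *)
  apply (Cser_drop _ _ 1) in B; rewrite Cpsum_S, Cpsum_0 in B.
  replace (w - (0 + 0 * Cpow z 0))%C with w in B by ring.
  apply Cser_ext with (2 := Cser_scal (- z)%C _ _ B); intros k; cbn [Nat.add psi_coef].
  rewrite zeta_Series, RtoC_opp, (Cpow_S z (S k)); ring.
Qed.

(** Of the factor z^(q+3), z^q cancels the denominator and each of the three copies of Psi takes one
    z. *)
Lemma Cps_kernel_coef (q : nat) (z : C) : Cmod z <= 1 / 20 -> z <> 0%C ->
  Cps kernel_coef z (kernel q z * Cpow z (q + 3))%C.
Proof.
  intros Hz z0.
  pose proof (Cps_tan z Hz) as T; pose proof (Psi_shift z Hz z0) as P.
  assert (Hz' : Cmod z <= 1 / 4) by lra.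
  pose proof abs_conv_psi_coef as HB; pose proof (abs_conv_mult _ _ HB HB) as HBB.
  pose proof (Cps_mult _ _ z _ _ abs_conv_tan_coef (abs_conv_mult _ _ HB HBB) Hz' T
    (Cps_mult _ _ z _ _ HB HBB Hz' P (Cps_mult _ _ z _ _ HB HB Hz' P P))) as K.
  unfold kernel_coef; match goal with |- Cps _ _ ?w => match type of K with Cps _ _ ?w' =>
    replace w with w'; [exact K|] end end.
  unfold kernel; rewrite Cpow_add_r; simpl (Cpow _ 3).
  field; apply Cpow_nz; auto.
Qed.

Lemma kernel_is_residue q : is_residue (kernel q) 0%C (RtoC (kernel_coef (q + 2))).
Proof.
  set (P := (q + 3)%nat).
  (* [b k] is the coefficient of z^(-k), namely [kernel_coef (P - k)] for 1 <= k <= P, as the pole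
     has order at most P. *)
  set (b := fun k => match k with O => RtoC 0
    | S i => if (i <? P)%nat then RtoC (kernel_coef (P - S i)) else RtoC 0 end).
  exists (1 / 20), (fun k => RtoC (kernel_coef (P + k))), b; repeat split.
  - lra.
  - unfold b; destruct (Nat.ltb_spec 0 P); [|unfold P in *; lia].
    do 2 f_equal; unfold P; lia.
  - intros z Hz; replace (z - 0)%C with z in * by ring.
    assert (z0 : z <> 0%C) by (apply Cmod_gt_0; lra).
    assert (Zn : forall n, Cpow z n <> 0%C) by (intros; apply Cpow_nz; auto).
    assert (tm : forall (x c : C) k,
      @scal C_AbsRing C_NormedModule (@pow_n C_AbsRing x k) c = (Cpow x k * c)%C).
    { reflexivity. }
    pose proof (Cps_kernel_coef q z ltac:(lra) z0) as K; fold P in K; unfold Cps in K.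
    set (f := fun k => (RtoC (kernel_coef k) * Cpow z k)%C) in *.
    exists (/ Cpow z P * (kernel q z * Cpow z P - Cpsum f P))%C, (/ Cpow z P * Cpsum f P)%C.
    split; [|split].
    + apply Cser_is_series, Cser_ext with (2 := Cser_scal (/ Cpow z P)%C _ _ (Cser_drop _ _ P K)).
      intros k; rewrite tm; unfold f; rewrite Cpow_add_r; field; auto.
    + apply Cser_is_series, Cser_ext with (fun k => Cpow (/ z) k * b k)%C; [intros; symmetry; apply tm|].
      replace (/ Cpow z P * Cpsum f P)%C with
        (Cpow (/ z) 0 * b O + Cpsum (fun i => Cpow (/ z) (S i) * b (S i)) P)%C.
      * apply (Cser_cons (fun i => Cpow (/ z) i * b i)%C).
        apply Cser_ext with (2 := Cser_trunc _ P); intros i; unfold b.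
        destruct (i <? P)%nat; auto; ring.
      (* [b] lists the principal part from z^(-1) downwards, opposite to the order of [f]. *)
      * rewrite (Cpsum_rev f), <- Cpsum_scal.
        replace (Cpow (/ z) 0 * b O)%C with (RtoC 0) by (simpl; ring).
        rewrite Cplus_0_l.
        apply Cpsum_ext; intros i Hi; rewrite Cpow_inv by auto.
        unfold b; destruct (Nat.ltb_spec i P); [|lia]; unfold f.
        assert (EP : Cpow z P = (Cpow z (P - S i) * Cpow z (S i))%C)
          by (rewrite <- Cpow_add_r; f_equal; lia).
        rewrite EP; field; auto.
    + field; auto.
Qed.

(** Divide the tangent expansion by 2 z and let a real z tend to 0: one side tends to the sum of
    a^(-2), the other is pi^2 / 2 times (sin w / w) / cos w with w = pi z. *)
Lemma ttilde_2 : ttilde 2 = PI ^ 2 / 2.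
Proof.
  set (x := fun n => 1 / 20 * / INR (S n)).
  assert (Hx : forall n, 0 < x n <= 1 / 20).
  { intros n; unfold x; pose proof (inv_INR_S_pos n).
    assert (/ INR (S n) <= / 1) by (apply Rinv_le_contravar; [lra|];
      rewrite S_INR; pose proof (pos_INR n); lra).
    lra. }
  assert (Lx : is_lim_seq x 0).
  { replace (Finite 0) with (Finite (1 / 20 * 0)) by (rewrite Rmult_0_r; auto).
    apply is_lim_seq_mult'; [apply is_lim_seq_const|apply is_lim_seq_inv_INR_S]. }
  assert (Hd : forall n m, half (S m) ^ 2 / 2 <= half (S m) * half (S m) - x n * x n).
  { intros n m; pose proof (half_S_ge m); specialize (Hx n); simpl; nra. }
  assert (Hp : forall m, 0 < half (S m) ^ 2) by (intros m; pose proof (half_S_ge m); apply pow_lt; lra).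
  assert (E : forall n, Series (fun m => / (half (S m) * half (S m) - x n * x n))
     = PI ^ 2 / 2 * (sin (PI * x n) / (PI * x n) / cos (PI * x n))).
  { intros n; specialize (Hx n).
    assert (Hz : Cmod (RtoC (x n)) <= 1 / 20) by (rewrite Cmod_R, Rabs_pos_eq; lra).
    pose proof (Ccos_PI_nonzero _ Hz) as Cnz.
    destruct (Cser_PI_Ctan _ Hz) as [A _].
    assert (Es : Csin (PI * x n)%C = RtoC (sin (PI * x n))).
    { rewrite <- RtoC_mult; unfold Csin; apply C_eq; simpl; unfold cosh, sinh;
        rewrite Ropp_0, exp_0; field. }
    assert (Ec : Ccos (PI * x n)%C = RtoC (cos (PI * x n))).
    { rewrite <- RtoC_mult; unfold Ccos; apply C_eq; simpl; unfold cosh, sinh;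
        rewrite Ropp_0, exp_0; field. }
    assert (cos (PI * x n) <> 0) by (intros F; apply Cnz; rewrite Ec, F; auto).
    unfold Ctan in A; rewrite Es, Ec, <- RtoC_div in A by auto.
    assert (Er : forall u v, Re (RtoC u * RtoC v)%C = u * v) by (intros; simpl; ring).
    rewrite Er in A.
    apply (is_series_Rscal (/ (2 * x n))) in A.
    apply is_series_unique.
    replace (PI ^ 2 / 2 * (sin (PI * x n) / (PI * x n) / cos (PI * x n)))
      with (/ (2 * x n) * (PI * (sin (PI * x n) / cos (PI * x n))))
      by (field; pose proof PI_RGT_0; repeat split; lra).
    revert A; apply is_series_ext; intros m.
    specialize (Hd n m); specialize (Hp m).
    rewrite <- !RtoC_mult, <- RtoC_minus, <- RtoC_div by lra; simpl Re.
    match goal with |- ?a = ?b => change (@eq R a b) end; field; repeat split; lra. }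
  destruct (tannery (fun n m => / (half (S m) * half (S m) - x n * x n))
    (fun m => / (half (S m) * half (S m) - 0 * 0)) (fun m => 2 * / half (S m) ^ 2)) as [_ L].
  - intros n m; specialize (Hd n m); specialize (Hp m).
    rewrite Rabs_pos_eq by (left; apply Rinv_0_lt_compat; lra).
    replace (2 * / half (S m) ^ 2) with (/ (half (S m) ^ 2 / 2)) by (field; pose proof (half_S_ge m); lra).
    apply Rinv_le_contravar; lra.
  - apply ex_series_Rscal, ex_series_inv_half_pow; lia.
  - intros m; specialize (Hp m).
    apply (is_lim_seq_inv _ (half (S m) * half (S m) - 0 * 0));
      [|intros F; injection F; simpl in Hp; lra].
    apply is_lim_seq_minus'; [apply is_lim_seq_const|apply is_lim_seq_mult'; auto].
  - apply is_lim_seq_ext with (1 := E) in L.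
    assert (L' : is_lim_seq (fun n => PI ^ 2 / 2 * (sin (PI * x n) / (PI * x n) / cos (PI * x n)))
       (PI ^ 2 / 2 * (1 / 1))).
    { assert (LP : is_lim_seq (fun n => PI * x n) 0).
      { replace (Finite 0) with (Finite (PI * 0)) by (rewrite Rmult_0_r; auto).
        apply is_lim_seq_mult'; auto; apply is_lim_seq_const. }
      apply is_lim_seq_mult'; [apply is_lim_seq_const|apply is_lim_seq_div'; [| |lra]].
      - destruct (Csin_scaled_lim (fun n => PI * x n) 1%C LP) as [A _].
        { intros n; specialize (Hx n); pose proof PI_RGT_0; apply Rgt_not_eq, Rmult_lt_0_compat; lra. }
        revert A; apply is_lim_seq_ext; intros n.
        rewrite <- RtoC_mult, Rmult_1_r; specialize (Hx n); pose proof PI_RGT_0.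
        assert (PI * x n <> 0) by (apply Rgt_not_eq, Rmult_lt_0_compat; lra).
        unfold Csin, Cdiv; simpl; unfold cosh, sinh; rewrite Ropp_0, exp_0; field; split; lra.
      - replace (Finite 1) with (Finite (cos 0)) by (rewrite cos_0; auto).
        apply is_lim_seq_continuous; auto; apply continuity_cos. }
    apply is_lim_seq_unique in L; apply is_lim_seq_unique in L'.
    rewrite L in L'; injection L' as L'.
    rewrite ttilde_Series.
    rewrite (Series_ext (fun m => / half (S m) ^ 2) (fun m => / (half (S m) * half (S m) - 0 * 0)));
      [rewrite L'; field|intros; f_equal; simpl; ring].
Qed.

(** * Asymptotic expansions and partial fractions *)


(* [f u = e 0 + e 1 u + ... + e (J - 1) u^(J - 1) + O(u^J)] as [u -> 0]. *)
Fixpoint expands (f : R -> R) (J : nat) (e : nat -> R) : Prop :=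
  match J with
  | O => exists d M, 0 < d /\ forall u, 0 < Rabs u < d -> Rabs (f u) <= M
  | S J' => expands (fun u => (f u - e O) / u) J' (fun j => e (S j))
  end.

Lemma Rabs_pos_neq u : 0 < Rabs u -> u <> 0.
Proof. intros H ->; rewrite Rabs_R0 in H; lra. Qed.

Lemma expands_ext_near (f g : R -> R) J e d : 0 < d ->
  (forall u, 0 < Rabs u < d -> f u = g u) -> expands f J e -> expands g J e.
Proof.
  intros Hd; revert f g e; induction J as [|J IH]; intros f g e H; simpl.
  - intros [d' [M [Hd' HM]]]; exists (Rmin d d'), M; split; [apply Rmin_pos; auto|].
    intros u Hu; assert (Rabs u < d /\ Rabs u < d') by (apply Rmin_Rgt_l; lra).
    rewrite <- H by lra; apply HM; lra.
  - apply IH; intros u Hu; rewrite H; auto.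
Qed.

Lemma expands_ext (f g : R -> R) J e :
  (forall u, u <> 0 -> f u = g u) -> expands f J e -> expands g J e.
Proof.
  intros H; apply expands_ext_near with 1; [lra|].
  intros u Hu; apply H, Rabs_pos_neq; lra.
Qed.

Lemma expands_ext_coef f J e e' : (forall j, (j < J)%nat -> e j = e' j) ->
  expands f J e -> expands f J e'.
Proof.
  revert f e e'; induction J as [|J IH]; intros f e e' H; simpl; auto.
  rewrite <- (H O) by lia; apply IH; intros; apply H; lia.
Qed.

Lemma expands_weaken_S f J e : expands f (S J) e -> expands f J e.
Proof.
  revert f e; induction J as [|J IH]; intros f e.
  - simpl; intros [d [M [Hd HM]]].
    exists (Rmin d 1), (M + Rabs (e O)); split; [apply Rmin_pos; lra|].
    intros u Hu; assert (Rabs u < d /\ Rabs u < 1) by (apply Rmin_Rgt_l; lra).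
    specialize (HM u ltac:(lra)).
    replace (f u) with ((f u - e O) / u * u + e O) by (field; apply Rabs_pos_neq; lra).
    eapply Rle_trans; [apply Rabs_triang|]; apply Rplus_le_compat_r.
    rewrite Rabs_mult; pose proof (Rabs_pos ((f u - e O) / u)); nra.
  - intros H; simpl; apply IH; exact H.
Qed.

Lemma expands_weaken f J J' e : (J <= J')%nat -> expands f J' e -> expands f J e.
Proof. intros L; induction L; auto; intros; apply IHL, expands_weaken_S; auto. Qed.

Lemma expands_plus f g J e e' : expands f J e -> expands g J e' ->
  expands (fun u => f u + g u) J (fun j => e j + e' j).
Proof.
  revert f g e e'; induction J as [|J IH]; intros f g e e'; simpl.
  - intros [d [M [Hd HM]]] [d' [M' [Hd' HM']]].
    exists (Rmin d d'), (M + M'); split; [apply Rmin_pos; auto|].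
    intros u Hu; assert (Rabs u < d /\ Rabs u < d') by (apply Rmin_Rgt_l; lra).
    specialize (HM u ltac:(lra)); specialize (HM' u ltac:(lra)).
    eapply Rle_trans; [apply Rabs_triang|]; lra.
  - intros Hf Hg; eapply expands_ext; [|apply (IH _ _ _ _ Hf Hg)].
    intros u Hu; simpl; field; auto.
Qed.

Lemma expands_scal c f J e : expands f J e -> expands (fun u => c * f u) J (fun j => c * e j).
Proof.
  revert f e; induction J as [|J IH]; intros f e; simpl.
  - intros [d [M [Hd HM]]]; exists d, (Rabs c * M); split; auto.
    intros u Hu; rewrite Rabs_mult; apply Rmult_le_compat_l; auto using Rabs_pos.
  - intros Hf; eapply expands_ext; [|apply (IH _ _ Hf)].
    intros u Hu; simpl; field; auto.
Qed.

Lemma expands_zero J : expands (fun _ => 0) J (fun _ => 0).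
Proof.
  induction J as [|J IH]; simpl.
  - exists 1, 0; split; [lra|]; intros; rewrite Rabs_R0; lra.
  - eapply expands_ext; [|apply IH]; intros u Hu; simpl; field; auto.
Qed.

Lemma expands_psum (F : nat -> R -> R) (E : nat -> nat -> R) J n :
  (forall i, (i < n)%nat -> expands (F i) J (E i)) ->
  expands (fun u => psum (fun i => F i u) n) J (fun j => psum (fun i => E i j) n).
Proof.
  intros H; induction n as [|n IH]; simpl; [apply expands_zero|].
  apply expands_plus; auto.
Qed.

Lemma PS_mult_S a b n :
  PS_mult a b (S n) = a O * b (S n) + PS_mult (fun j => a (S j)) b n.
Proof. unfold PS_mult; rewrite !sum_f_R0_psum, psum_head; reflexivity. Qed.

(** With constant terms e_0 and e'_0, (f g - e_0 e'_0) / u = e_0 (g - e'_0) / u + g (f - e_0) / u,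
    which matches the recursion [PS_mult_S]. *)
Lemma expands_mult f g J e e' : expands f J e -> expands g J e' ->
  expands (fun u => f u * g u) J (PS_mult e e').
Proof.
  revert f g e e'; induction J as [|J IH]; intros f g e e' Hf Hg.
  - destruct Hf as [d [M [Hd HM]]], Hg as [d' [M' [Hd' HM']]].
    exists (Rmin d d'), (M * M'); split; [apply Rmin_pos; auto|].
    intros u Hu; assert (Rabs u < d /\ Rabs u < d') by (apply Rmin_Rgt_l; lra).
    rewrite Rabs_mult; apply Rmult_le_compat; try apply Rabs_pos; [apply HM|apply HM']; lra.
  - pose proof (IH _ _ _ _ Hf (expands_weaken_S _ _ _ Hg)) as H1.
    pose proof (expands_scal (e O) _ J _ Hg) as H2.
    cbn [expands]; apply expands_ext_coef with
      (fun j => e O * e' (S j) + PS_mult (fun j => e (S j)) e' j);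
      [intros j _; symmetry; apply PS_mult_S|].
    eapply expands_ext; [|apply (expands_plus _ _ _ _ _ H2 H1)].
    intros u Hu; unfold PS_mult; simpl; field; auto.
Qed.

(** Two constant terms differ by at most (M + M') |u| for all small u, hence agree; divide by u and
    repeat. *)
Lemma expands_unique f J e e' : expands f J e -> expands f J e' ->
  forall j, (j < J)%nat -> e j = e' j.
Proof.
  revert f e e'; induction J as [|J IH]; intros f e e' H H'; [lia|].
  assert (E0 : e O = e' O).
  { apply (expands_weaken _ 1) in H; [|lia]; apply (expands_weaken _ 1) in H'; [|lia].
    destruct H as [d [M [Hd HM]]], H' as [d' [M' [Hd' HM']]].
    destruct (Req_dec (e O) (e' O)) as [|N]; auto; exfalso.
    set (D := Rabs (e O - e' O)).
    assert (D0 : 0 < D) by (apply Rabs_pos_lt; lra).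
    set (m := Rmax 1 (M + M')).
    assert (m1 : 1 <= m) by apply Rmax_l.
    assert (mM : M + M' <= m) by apply Rmax_r.
    set (t := Rmin (Rmin d d') (D / m) / 2).
    assert (P : 0 < Rmin (Rmin d d') (D / m)).
    { apply Rmin_pos; [apply Rmin_pos; auto|apply Rdiv_lt_0_compat; lra]. }
    pose proof (Rmin_l (Rmin d d') (D / m)); pose proof (Rmin_r (Rmin d d') (D / m)).
    pose proof (Rmin_l d d'); pose proof (Rmin_r d d').
    assert (Ht : Rabs t = t) by (apply Rabs_pos_eq; unfold t; lra).
    specialize (HM t); specialize (HM' t); rewrite Ht in *.
    specialize (HM ltac:(unfold t; lra)); specialize (HM' ltac:(unfold t; lra)).
    assert (L : D <= (M + M') * t).
    { unfold D; replace (e O - e' O) with (((f t - e' O) / t - (f t - e O) / t) * t)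
        by (field; unfold t; lra).
      rewrite Rabs_mult, Ht; apply Rmult_le_compat_r; [unfold t; lra|].
      unfold Rminus at 1; eapply Rle_trans; [apply Rabs_triang|]; rewrite Rabs_Ropp; lra. }
    assert (t < D / m) by (unfold t; lra).
    assert (m * t < D).
    { apply Rmult_lt_reg_r with (/ m); [apply Rinv_0_lt_compat; lra|].
      replace (m * t * / m) with t by (field; lra); exact H3. }
    assert (0 < t) by (unfold t; lra); nra. }
  intros [|j] Hj; auto.
  cbn [expands] in H, H'; rewrite <- E0 in H'.
  apply (IH _ _ _ H H' j); lia.
Qed.

Lemma expands_shift f J e P : expands f J e ->
  expands (fun u => u ^ P * f u) (P + J) (fun j => if (j <? P)%nat then 0 else e (j - P)%nat).
Proof.
  intros H; induction P as [|P IH].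
  - apply expands_ext_coef with e; [intros; rewrite Nat.sub_0_r; reflexivity|].
    eapply expands_ext; [|apply H]; intros; simpl; ring.
  - simpl; eapply expands_ext; [|apply IH]; intros u Hu; simpl; field; auto.
Qed.

Lemma expands_poly e K : expands (fun u => psum (fun j => e j * u ^ j) K) K e.
Proof.
  revert e; induction K as [|K IH]; intros e.
  - exists 1, 0; split; [lra|]; intros; simpl; rewrite Rabs_R0; lra.
  - cbn [expands]; eapply expands_ext; [|apply (IH (fun j => e (S j)))].
    intros u Hu; rewrite psum_head; cbn [pow].
    rewrite (psum_ext (fun i => e (S i) * (u * u ^ i)) (fun i => u * (e (S i) * u ^ i)))
      by (intros; ring).
    rewrite psum_scal; field; auto.
Qed.

(** The function reproduces itself: (1 / (d + u) - 1 / d) / u = - (1 / d) (1 / (d + u)). *)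
Lemma expands_inv d J : d <> 0 ->
  expands (fun u => / (d + u)) J (fun j => (-1) ^ j / d ^ S j).
Proof.
  intros Hd; assert (D : 0 < Rabs d) by (apply Rabs_pos_lt; auto).
  assert (Hnz : forall u, 0 < Rabs u < Rabs d / 2 -> Rabs d / 2 <= Rabs (d + u)).
  { intros u Hu; pose proof (Rabs_triang (d + u) (- u)) as T.
    replace (d + u + - u) with d in T by ring; rewrite Rabs_Ropp in T; lra. }
  induction J as [|J IH].
  - exists (Rabs d / 2), (/ (Rabs d / 2)); split; [lra|]; intros u Hu.
    specialize (Hnz u Hu); rewrite Rabs_inv; apply Rinv_le_contravar; lra.
  - cbn [expands]; apply expands_ext_coef with (fun j => - / d * ((-1) ^ j / d ^ S j)).
    { intros j _; simpl; field; split; [apply pow_nonzero|]; auto. }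
    apply (expands_ext_near (fun u => - / d * / (d + u))) with (Rabs d / 2); [lra| |].
    + intros u Hu; specialize (Hnz u Hu); simpl; field; repeat split; auto.
      * apply Rabs_pos_neq; lra.
      * apply Rabs_pos_neq; lra.
    + apply expands_scal, IH.
Qed.

Lemma expands_inv_pow d q : d <> 0 ->
  expands (fun u => / (d + u) ^ q) 2
    (fun j => match j with O => / d ^ q | _ => - INR q / d ^ S q end).
Proof.
  intros Hd; induction q as [|q IH].
  - eapply expands_ext_coef; [|eapply expands_ext; [|apply (expands_poly (fun j => match j with O => 1 | _ => 0 end))]].
    + intros [|j] _; simpl; field; auto.
    + intros u Hu; simpl; field.
  - pose proof (expands_mult _ _ _ _ _ (expands_inv d 2 Hd) IH) as H.
    eapply expands_ext_coef; [|eapply expands_ext; [|exact H]].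
    + intros [|[|j]] Hj; [| |lia]; unfold PS_mult; cbn [sum_f_R0 Nat.sub]; rewrite ?S_INR;
        cbn [pow]; field; repeat split; auto; apply pow_nonzero; auto.
    + intros u _; simpl; rewrite Rinv_mult; reflexivity.
Qed.

(** * Partial fractions with poles at 0, ..., N *)

Definition off_poles (N : nat) (s : R) : Prop := forall n, (n <= N)%nat -> s <> INR n.

Definition pole_sum (N K : nat) (c : nat -> nat -> R) (s : R) : R :=
  psum (fun n => psum (fun k => c n k * / (s - INR n) ^ S k) K) (S N).

(** Only existence is recorded; [pole_sum_coef] recovers the coefficients afterwards from the
    expansion at each pole. *)
Definition has_pole_sum (N : nat) (f : R -> R) : Prop :=
  exists K c, forall s, off_poles N s -> f s = pole_sum N K c s.

Lemma pole_sum_extend N K K' c s : (K <= K')%nat ->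
  pole_sum N K c s = pole_sum N K' (fun n k => if (k <? K)%nat then c n k else 0) s.
Proof.
  intros L; unfold pole_sum; apply psum_ext; intros n _.
  rewrite (psum_extend _ K K' L).
  - apply psum_ext; intros k Hk; destruct (Nat.ltb_spec k K); auto; lia.
  - intros k Hk; destruct (Nat.ltb_spec k K); [lia|ring].
Qed.

Lemma has_pole_sum_ext N f g :
  (forall s, off_poles N s -> f s = g s) -> has_pole_sum N f -> has_pole_sum N g.
Proof. intros E [K [c H]]; exists K, c; intros s Hs; rewrite <- E; auto. Qed.

Lemma has_pole_sum_plus N f g : has_pole_sum N f -> has_pole_sum N g ->
  has_pole_sum N (fun s => f s + g s).
Proof.
  intros [K [c H]] [K' [c' H']].
  exists (K + K')%nat, (fun n k => (if (k <? K)%nat then c n k else 0) + (if (k <? K')%nat then c' n k else 0)).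
  intros s Hs; rewrite H, H' by auto.
  rewrite (pole_sum_extend N K (K + K')), (pole_sum_extend N K' (K + K')) by lia.
  unfold pole_sum; rewrite <- psum_plus; apply psum_ext; intros n _.
  rewrite <- psum_plus; apply psum_ext; intros; ring.
Qed.

Lemma has_pole_sum_scal N a f : has_pole_sum N f -> has_pole_sum N (fun s => a * f s).
Proof.
  intros [K [c H]]; exists K, (fun n k => a * c n k); intros s Hs; rewrite H by auto.
  unfold pole_sum; rewrite <- psum_scal; apply psum_ext; intros n _.
  rewrite <- psum_scal; apply psum_ext; intros; ring.
Qed.

Lemma has_pole_sum_psum N F n : (forall i, (i < n)%nat -> has_pole_sum N (F i)) ->
  has_pole_sum N (fun s => psum (fun i => F i s) n).
Proof.
  intros H; induction n as [|n IH].
  - exists O, (fun _ _ => 0); intros s _; unfold pole_sum; simpl.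
    rewrite psum_zero; auto; ring.
  - simpl; apply has_pole_sum_plus; auto.
Qed.

Lemma has_pole_sum_term N n k : (n <= N)%nat -> has_pole_sum N (fun s => / (s - INR n) ^ S k).
Proof.
  intros Hn; exists (S k), (fun m j => if (m =? n)%nat then if (j =? k)%nat then 1 else 0 else 0).
  intros s Hs; unfold pole_sum.
  rewrite (psum_ext _ (fun m => if (m =? n)%nat then / (s - INR m) ^ S k else 0)).
  - rewrite psum_pick; destruct (Nat.ltb_spec n (S N)); auto; lia.
  - intros m Hm; destruct (Nat.eqb_spec m n) as [->|]; [|apply psum_zero; intros; ring].
    rewrite (psum_ext _ (fun j => if (j =? k)%nat then / (s - INR n) ^ S j else 0)).
    + rewrite psum_pick; destruct (Nat.ltb_spec k (S k)); auto; lia.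
    + intros j _; destruct (j =? k)%nat; ring.
Qed.

(** For n <> m, 1 / ((s - n) (s - m)) = (1 / (s - n) - 1 / (s - m)) / (n - m); multiplying by
    further powers of 1 / (s - n) gives the induction on k. *)
Lemma has_pole_sum_term_mul N n k m : (n <= N)%nat -> (m <= N)%nat ->
  has_pole_sum N (fun s => / (s - INR n) ^ S k * / (s - INR m)).
Proof.
  intros Hn Hm; destruct (Nat.eq_dec n m) as [->|Ne].
  - apply has_pole_sum_ext with (fun s => / (s - INR m) ^ S (S k)); [|apply has_pole_sum_term; auto].
    intros s _; rewrite (Rmult_comm (/ _)), <- Rinv_mult; reflexivity.
  - assert (D : INR n - INR m <> 0) by (intros F; apply Ne, INR_eq; lra).
    induction k as [|k IH].
    + apply has_pole_sum_ext with
        (fun s => / (INR n - INR m) * (/ (s - INR n) ^ 1 + -1 * / (s - INR m) ^ 1)).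
      * intros s Hs; specialize (Hs n Hn) as H1; specialize (Hs m Hm) as H2; field.
        repeat split; auto; lra.
      * apply has_pole_sum_scal, has_pole_sum_plus, has_pole_sum_scal; apply has_pole_sum_term; auto.
    + apply has_pole_sum_ext with
        (fun s => / (INR n - INR m) * (/ (s - INR n) ^ S (S k) + -1 * (/ (s - INR n) ^ S k * / (s - INR m)))).
      * intros s Hs; specialize (Hs n Hn) as H1; specialize (Hs m Hm) as H2; simpl; field.
        repeat split; auto; try lra; apply pow_nonzero; lra.
      * apply has_pole_sum_scal, has_pole_sum_plus, has_pole_sum_scal; auto.
        apply has_pole_sum_term; auto.
Qed.

Lemma has_pole_sum_mul_pole N f m : (m <= N)%nat -> has_pole_sum N f ->
  has_pole_sum N (fun s => f s * / (s - INR m)).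
Proof.
  intros Hm [K [c H]].
  apply has_pole_sum_ext with (fun s => psum (fun n => psum (fun k =>
    c n k * (/ (s - INR n) ^ S k * / (s - INR m))) K) (S N)).
  - intros s Hs; rewrite H by auto; unfold pole_sum.
    rewrite Rmult_comm, <- psum_scal; apply psum_ext; intros n _.
    rewrite <- psum_scal; apply psum_ext; intros; ring.
  - apply has_pole_sum_psum; intros n Hn; apply has_pole_sum_psum; intros k _.
    apply has_pole_sum_scal, has_pole_sum_term_mul; auto; lia.
Qed.

Definition psi_trunc (N : nat) (s : R) : R := h N + psum (fun n => / (s - INR n)) (S N).

Lemma has_pole_sum_mul_psi N f : has_pole_sum N f -> has_pole_sum N (fun s => f s * psi_trunc N s).
Proof.
  intros H; apply has_pole_sum_ext with
    (fun s => h N * f s + psum (fun n => f s * / (s - INR n)) (S N)).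
  - intros s _; rewrite psum_scal; unfold psi_trunc; ring.
  - apply has_pole_sum_plus; [apply has_pole_sum_scal; auto|].
    apply has_pole_sum_psum; intros n Hn; apply has_pole_sum_mul_pole; auto; lia.
Qed.

Definition kernel_trunc (N q : nat) (s : R) : R := psi_trunc N s ^ 3 / s ^ q.

(** Starts from s^(-q), itself a pole sum because q > 0, and multiplies by Psi_N three times. *)
Lemma has_pole_sum_kernel N q : (0 < q)%nat -> has_pole_sum N (kernel_trunc N q).
Proof.
  intros Hq; destruct q as [|q]; [lia|].
  pose proof (has_pole_sum_mul_psi N _ (has_pole_sum_mul_psi N _ (has_pole_sum_mul_psi N _
    (has_pole_sum_term N 0 q (Nat.le_0_l N))))) as H.
  revert H; apply has_pole_sum_ext; intros s _; unfold kernel_trunc.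
  simpl (INR 0); rewrite Rminus_0_r; unfold Rdiv; ring.
Qed.

(** The factor u^K turns the polar part at n0 into a polynomial that lists its coefficients from the
    highest pole order down; the other poles contribute O(u^K). *)
Lemma expands_pole_sum N K c n0 : (n0 <= N)%nat ->
  expands (fun u => u ^ K * pole_sum N K c (INR n0 + u)) K (fun j => c n0 (K - S j)%nat).
Proof.
  intros Hn.
  set (reg := fun u => psum (fun n => if (n =? n0)%nat then 0 else
     psum (fun k => c n k * / ((INR n0 - INR n) + u) ^ S k) K) (S N)).
  (* Order 0 of [expands] is boundedness near 0. *)
  assert (Hreg : expands reg 0 (fun _ => 0)).
  { apply (expands_ext_coef _ 0 (fun _ => psum (fun _ => 0) (S N))); [lia|].
    apply (expands_psum (fun n u => if (n =? n0)%nat then 0 else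
       psum (fun k => c n k * / ((INR n0 - INR n) + u) ^ S k) K) (fun _ _ => 0) 0).
    intros n _; destruct (Nat.eqb_spec n n0) as [|Ne]; [apply (expands_zero 0)|].
    apply (expands_ext_coef _ 0 (fun _ => psum (fun _ => 0) K)); [lia|].
    apply (expands_psum (fun k u => c n k * / ((INR n0 - INR n) + u) ^ S k) (fun _ _ => 0) 0).
    intros k _; apply (expands_scal (c n k) (fun u => / (INR n0 - INR n + u) ^ S k) 0 (fun _ => 0)).
    refine (expands_weaken _ 0 2 _ _ (expands_inv_pow (INR n0 - INR n) (S k) _)); [lia|].
    intros F; apply Ne, INR_eq; lra. }
  pose proof (expands_plus _ _ _ _ _ (expands_poly (fun j => c n0 (K - S j)%nat) K)
    (eq_rect _ (fun J => expands _ J _) (expands_shift _ _ _ K Hreg) _ (Nat.add_0_r K))) as H.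
  eapply expands_ext_coef; [|eapply expands_ext; [|exact H]].
  - intros j Hj; simpl; destruct (Nat.ltb_spec j K); [ring|lia].
  - intros u Hu; cbv beta.
    assert (E : pole_sum N K c (INR n0 + u) = psum (fun k => c n0 k * / u ^ S k) K + reg u).
    { unfold pole_sum, reg.
      rewrite (psum_ext _ (fun n => (if (n =? n0)%nat then psum (fun k => c n k * / u ^ S k) K else 0)
         + (if (n =? n0)%nat then 0 else psum (fun k => c n k * / ((INR n0 - INR n) + u) ^ S k) K))).
      - rewrite psum_plus, psum_pick; destruct (Nat.ltb_spec n0 (S N)); auto; lia.
      - intros n _; destruct (Nat.eqb_spec n n0) as [->|].
        + rewrite Rplus_0_r; apply psum_ext; intros; do 3 f_equal; ring.
        + rewrite Rplus_0_l; apply psum_ext; intros; do 3 f_equal; ring. }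
    rewrite E, Rmult_plus_distr_l; f_equal.
    rewrite (psum_rev (fun k => c n0 k * / u ^ S k)), <- psum_scal; apply psum_ext; intros j Hj.
    replace (u ^ K) with (u ^ S (K - S j) * u ^ j) by (rewrite <- pow_add; f_equal; lia).
    field; apply pow_nonzero; auto.
Qed.

(** Uniqueness of expansions, for u^K f written in two ways. If u^P f is bounded, no coefficient
    beyond pole order P survives, and J known terms determine the J highest orders. *)
Lemma pole_sum_coef N K c f n0 P J e :
  (n0 <= N)%nat -> (P <= K)%nat -> (J <= P)%nat ->
  (forall s, off_poles N s -> f s = pole_sum N K c s) ->
  expands (fun u => u ^ P * f (INR n0 + u)) J e ->
  (forall k, (P <= k < K)%nat -> c n0 k = 0) /\
  (forall k, (P - J <= k < P)%nat -> c n0 k = e (P - S k)%nat).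
Proof.
  intros Hn HP HJ Hf He.
  pose proof (expands_shift _ _ _ (K - P) He) as H1.
  pose proof (expands_pole_sum N K c n0 Hn) as H2.
  apply (expands_weaken _ (K - P + J)) in H2; [|lia].
  assert (H3 : expands (fun u => u ^ K * pole_sum N K c (INR n0 + u)) (K - P + J)
     (fun j => if (j <? K - P)%nat then 0 else e (j - (K - P))%nat)).
  { revert H1; apply expands_ext_near with 1; [lra|]; intros u Hu.
    rewrite <- Rmult_assoc, <- pow_add; replace (K - P + P)%nat with K by lia.
    f_equal; apply Hf; intros n _ E.
    (* Were n0 + u a pole, u would be an integer with 0 < |u| < 1. *)
    assert (Eu : u = IZR (Z.of_nat n - Z.of_nat n0)) by (rewrite minus_IZR, <- !INR_IZR_INZ; lra).
    rewrite Eu, <- abs_IZR in Hu; destruct Hu as [A B]; apply lt_IZR in A; apply lt_IZR in B; lia. }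
  pose proof (expands_unique _ _ _ _ H2 H3) as U; split; intros k Hk.
  - specialize (U (K - S k)%nat ltac:(lia)); cbv beta in U.
    replace (K - S (K - S k))%nat with k in U by lia.
    destruct (Nat.ltb_spec (K - S k) (K - P)); auto; lia.
  - specialize (U (K - S k)%nat ltac:(lia)); cbv beta in U.
    replace (K - S (K - S k))%nat with k in U by lia.
    destruct (Nat.ltb_spec (K - S k) (K - P)); [lia|].
    rewrite U; f_equal; lia.
Qed.

(** * The truncated kernel summed over the half-odd integers *)


(** The Taylor coefficients of u Psi_N (n + u) at u = 0. *)
Definition psi_trunc_coef (N n j : nat) : R :=
  match j with
  | O => 1
  | S i => (if (i =? 0)%nat then h N else 0)
      + psum (fun m => if (m =? n)%nat then 0 else (-1) ^ i / (INR n - INR m) ^ S i) (S N)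
  end.

Lemma expands_const c J : expands (fun _ => c) J (fun i => if (i =? 0)%nat then c else 0).
Proof.
  apply (expands_weaken _ J (S J)); [lia|]; cbn [expands Nat.eqb].
  eapply expands_ext; [|apply expands_zero]; intros u Hu; simpl; field; auto.
Qed.

Lemma expands_psi_trunc N n J : (n <= N)%nat ->
  expands (fun u => u * psi_trunc N (INR n + u)) J (psi_trunc_coef N n).
Proof.
  intros Hn; apply (expands_weaken _ J (S J)); [lia|]; cbn [expands].
  apply (expands_ext (fun u => h N + psum (fun m => if (m =? n)%nat then 0 else / (INR n - INR m + u)) (S N))).
  - intros u Hu; unfold psi_trunc.
    rewrite (psum_ext (fun m => / (INR n + u - INR m)) (fun m => (if (m =? n)%nat then / u else 0)
       + (if (m =? n)%nat then 0 else / (INR n - INR m + u)))).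
    + rewrite psum_plus, (psum_pick (fun _ => / u)).
      destruct (Nat.ltb_spec n (S N)); [|lia]; simpl psi_trunc_coef; field; auto.
    + intros m _; destruct (Nat.eqb_spec m n) as [->|].
      * rewrite Rplus_0_r; f_equal; ring.
      * rewrite Rplus_0_l; f_equal; ring.
  - apply (expands_plus (fun _ => h N) _ J (fun i => if (i =? 0)%nat then h N else 0)); [apply expands_const|].
    apply (expands_psum (fun m u => if (m =? n)%nat then 0 else / (INR n - INR m + u))
      (fun m i => if (m =? n)%nat then 0 else (-1) ^ i / (INR n - INR m) ^ S i)).
    intros m _; destruct (Nat.eqb_spec m n) as [|Ne]; [apply expands_zero|].
    apply expands_inv; intros F; apply Ne, INR_eq; lra.
Qed.

(** The constant term alpha_n of Psi_N at its pole n: poles below n contribute H_n, poles above it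
    -H_(N-n). It tends to 2 log 2 + H_n. *)
Definition psi_const (N n : nat) : R := h N + (harm n - harm (N - n)).

Lemma psi_trunc_coef_1 N n : (n <= N)%nat -> psi_trunc_coef N n 1 = psi_const N n.
Proof.
  intros Hn; cbn [psi_trunc_coef Nat.eqb]; unfold psi_const; f_equal.
  replace (S N) with (n + S (N - n))%nat by lia; rewrite psum_add, psum_head.
  rewrite Nat.add_0_r, Nat.eqb_refl, (psum_rev _ n).
  unfold harm, Rminus; rewrite <- psum_opp, Rplus_0_l; f_equal; apply psum_ext; intros i Hi.
  - destruct (Nat.eqb_spec (n - S i) n); [lia|].
    rewrite minus_INR by lia; rewrite S_INR; simpl; field.
    pose proof (pos_INR i); repeat split; lra.
  - destruct (Nat.eqb_spec (n + S i) n); [lia|].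
    rewrite plus_INR, S_INR; simpl; field; pose proof (pos_INR i); repeat split; lra.
Qed.

Lemma psi_trunc_coef_0_1 N : psi_trunc_coef N 0 1 = h N - harm N.
Proof.
  rewrite psi_trunc_coef_1 by lia; unfold psi_const.
  rewrite Nat.sub_0_r; change (harm 0) with 0; ring.
Qed.

Lemma psi_trunc_coef_0_SS N j :
  psi_trunc_coef N 0 (S (S j)) = - psum (fun m => / INR (S m) ^ S (S j)) N.
Proof.
  cbn [psi_trunc_coef Nat.eqb]; rewrite psum_head; cbn [Nat.eqb].
  rewrite !Rplus_0_l, <- psum_opp; apply psum_ext; intros m _.
  simpl (INR 0); rewrite Rminus_0_l.
  replace (- INR (S m)) with (-1 * INR (S m)) by ring.
  assert (INR (S m) <> 0) by (pose proof (INR_S_ge m); lra).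
  assert (E : (-1) ^ S j * (-1) ^ S j = 1) by (rewrite <- Rpow_mult_distr; replace (-1 * -1) with 1 by ring; apply pow1).
  rewrite Rpow_mult_distr; change ((-1) ^ S (S j)) with (-1 * (-1) ^ S j).
  assert ((-1) ^ S j <> 0) by (apply pow_nonzero; lra).
  field; split; auto; apply pow_nonzero; auto.
Qed.

(** To first order, (1 + alpha_n u)^3 (n^(-q) - q n^(-q-1) u). The coefficient of u belongs to (s -
    n)^(-2); order 2 suffices because the simple pole, which it does not reach, gets weight
    [tan_coef 0] = 0. *)
Lemma expands_kernel_trunc_S N q n : (0 < n <= N)%nat ->
  exists e, expands (fun u => u ^ 3 * kernel_trunc N q (INR n + u)) 2 e /\
    e 1%nat = 3 * psi_const N n / INR n ^ q - INR q / INR n ^ S q.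
Proof.
  intros Hn; assert (Hn0 : INR n <> 0) by (apply not_0_INR; lia).
  pose proof (expands_psi_trunc N n 2 ltac:(lia)) as L.
  pose proof (expands_mult _ _ _ _ _ L (expands_mult _ _ _ _ _ L
    (expands_mult _ _ _ _ _ L (expands_inv_pow (INR n) q Hn0)))) as H.
  eexists; split; [eapply expands_ext; [|exact H]|].
  - intros u _; unfold kernel_trunc, Rdiv; ring.
  - unfold PS_mult; cbn [sum_f_R0 Nat.sub]; rewrite psi_trunc_coef_1 by lia.
    cbn [psi_trunc_coef]; field; split; auto; apply pow_nonzero; auto.
Qed.

Lemma expands_kernel_trunc_0 N q :
  expands (fun u => u ^ (q + 3) * kernel_trunc N q (INR 0 + u)) (q + 3)
    (PS_mult (psi_trunc_coef N 0) (PS_mult (psi_trunc_coef N 0) (psi_trunc_coef N 0))).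
Proof.
  pose proof (expands_psi_trunc N 0 (q + 3) (Nat.le_0_l N)) as L.
  pose proof (expands_mult _ _ _ _ _ L (expands_mult _ _ _ _ _ L L)) as H.
  eapply expands_ext; [|exact H].
  intros u Hu; unfold kernel_trunc; simpl (INR 0); rewrite !Rplus_0_l, pow_add.
  field; apply pow_nonzero; auto.
Qed.

Lemma half_integer_not_INR m n : half (S m) <> INR n.
Proof.
  rewrite half_S, !INR_IZR_INZ; intros E.
  assert (F : IZR (2 * Z.of_nat m + 1) = IZR (2 * Z.of_nat n)) by (rewrite plus_IZR, !mult_IZR; lra).
  apply eq_IZR in F; lia.
Qed.

Lemma is_lim_seq_inv_pow_infty (u : nat -> R) (j : nat) :
  is_lim_seq u p_infty -> is_lim_seq (fun n => / u n ^ S j) 0.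
Proof.
  intros H; apply is_lim_seq_inv in H; [|discriminate]; simpl Rbar_inv in H.
  apply is_lim_seq_ext with (fun n => (/ u n) ^ S j); [intros; apply pow_inv|].
  induction j as [|j IH].
  - revert H; apply is_lim_seq_ext; intros; simpl; ring.
  - replace (Finite 0) with (Finite (0 * 0)) by (rewrite Rmult_0_l; auto).
    apply (is_lim_seq_mult' _ _ _ _ H IH).
Qed.

Lemma is_lim_seq_half_plus x : is_lim_seq (fun M => half M + x) p_infty.
Proof.
  apply is_lim_seq_ext with (fun M => INR M + (x - 1 / 2)); [intros; unfold half; ring|].
  eapply is_lim_seq_plus; [apply is_lim_seq_INR|apply is_lim_seq_const|reflexivity].
Qed.

(* Replacing [n] by [n + 1] only changes two terms, at the ends of the range. *)
Lemma half_odd_sum n j :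
  is_lim_seq (fun M => psum (fun m => / (half (S m) - INR n) ^ S j + / (- half (S m) - INR n) ^ S j) M)
    (tan_coef j).
Proof.
  induction n as [|n IH].
  - unfold tan_coef; rewrite ttilde_Series.
    assert (E : forall m, / (half (S m) - INR 0) ^ S j + / (- half (S m) - INR 0) ^ S j
       = (1 - (-1) ^ j) * / half (S m) ^ S j).
    { intros m; simpl (INR 0); rewrite !Rminus_0_r.
      replace (- half (S m)) with (-1 * half (S m)) by ring.
      assert (half (S m) <> 0) by (pose proof (half_S_ge m); lra).
      assert (E1 : (-1) ^ j * (-1) ^ j = 1)
        by (rewrite <- Rpow_mult_distr; replace (-1 * -1) with 1 by ring; apply pow1).
      assert ((-1) ^ j <> 0) by (apply pow_nonzero; lra).
      rewrite Rpow_mult_distr; change ((-1) ^ S j) with (-1 * (-1) ^ j).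
      replace (/ (-1 * (-1) ^ j * half (S m) ^ S j)) with (- (-1) ^ j * / half (S m) ^ S j); [ring|].
      assert (half (S m) ^ S j <> 0) by (apply pow_nonzero; auto).
      assert (-1 * (-1) ^ j * half (S m) ^ S j <> 0).
      { apply Rmult_integral_contrapositive_currified; auto.
        apply Rmult_integral_contrapositive_currified; auto; lra. }
      apply Rmult_eq_reg_r with (-1 * (-1) ^ j * half (S m) ^ S j); auto.
      rewrite Rinv_l by auto.
      replace (- (-1) ^ j * / half (S m) ^ S j * (-1 * (-1) ^ j * half (S m) ^ S j))
        with ((-1) ^ j * (-1) ^ j * (/ half (S m) ^ S j * half (S m) ^ S j)) by ring.
      rewrite E1, Rinv_l by auto; ring. }
    apply is_lim_seq_ext with (fun M => (1 - (-1) ^ j) * psum (fun m => / half (S m) ^ S j) M).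
    { intros M; rewrite <- psum_scal; apply psum_ext; intros; rewrite E; auto. }
    (* For j = 0 the sum of 1 / half diverges, but the factor 1 - (-1)^0 annihilates every partial
       sum. *)
    destruct j as [|j].
    + simpl ((-1) ^ 0); rewrite Rminus_diag, Rmult_0_l.
      apply is_lim_seq_ext with (fun _ => 0); [intros; ring|apply is_lim_seq_const].
    + apply is_lim_seq_mult'; [apply is_lim_seq_const|].
      apply is_series_psum, Series_correct, ex_series_inv_half_pow; lia.
  - apply is_lim_seq_ext with (fun M =>
      psum (fun m => / (half (S m) - INR n) ^ S j + / (- half (S m) - INR n) ^ S j) M
      + (/ (- half (S M) - INR n) ^ S j - / (half M - INR n) ^ S j)).
    + intros M; rewrite S_INR; induction M as [|M IHM]; cbn [psum].
      * unfold half; simpl (INR 1); simpl (INR 0).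
        replace (- (1 - 1 / 2) - INR n) with (0 - 1 / 2 - INR n) by field; ring.
      * rewrite <- IHM.
        replace (half (S M) - (INR n + 1)) with (half M - INR n)
          by (unfold half; rewrite S_INR; ring).
        replace (- half (S M) - (INR n + 1)) with (- half (S (S M)) - INR n)
          by (unfold half; rewrite (S_INR (S M)); ring).
        ring.
    + replace (Finite (tan_coef j)) with (Finite (tan_coef j + (0 - 0))) by (f_equal; ring).
      apply is_lim_seq_plus'; auto; apply is_lim_seq_minus'.
      * apply is_lim_seq_ext with (fun M => (-1) ^ S j * / (half (S M) + INR n) ^ S j).
        { intros M; replace (- half (S M) - INR n) with (-1 * (half (S M) + INR n)) by ring.
          rewrite Rpow_mult_distr, Rinv_mult; f_equal.
          rewrite <- pow_inv; f_equal; lra. }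
        replace (Finite 0) with (Finite ((-1) ^ S j * 0)) by (rewrite Rmult_0_r; auto).
        apply is_lim_seq_mult'; [apply is_lim_seq_const|].
        apply is_lim_seq_inv_pow_infty, (is_lim_seq_incr_1 (fun M => half M + INR n)), is_lim_seq_half_plus.
      * apply is_lim_seq_inv_pow_infty, (is_lim_seq_half_plus (- INR n)).
Qed.

(** Finite sums over poles and orders commute with the limit, [half_odd_sum] giving each term. The
    points a and -a stay paired because the simple poles would diverge on one side alone. *)
Lemma pole_sum_half_odd_sum N K c f :
  (forall s, off_poles N s -> f s = pole_sum N K c s) ->
  is_lim_seq (psum (fun m => f (half (S m)) + f (- half (S m))))
    (psum (fun n => psum (fun k => c n k * tan_coef k) K) (S N)).
Proof.
  intros Hf.
  apply is_lim_seq_ext with (fun M => psum (fun n => psum (fun k => c n k *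
    psum (fun m => / (half (S m) - INR n) ^ S k + / (- half (S m) - INR n) ^ S k) M) K) (S N)).
  - intros M; symmetry.
    rewrite (psum_ext _ (fun m => psum (fun n => psum (fun k => c n k *
      (/ (half (S m) - INR n) ^ S k + / (- half (S m) - INR n) ^ S k)) K) (S N))).
    + rewrite psum_swap; apply psum_ext; intros n _.
      rewrite psum_swap; apply psum_ext; intros k _; apply psum_scal.
    + intros m _; rewrite !Hf.
      * unfold pole_sum; rewrite <- psum_plus; apply psum_ext; intros n _.
        rewrite <- psum_plus; apply psum_ext; intros k _; ring.
      * intros n _; pose proof (half_S_ge m); pose proof (pos_INR n); lra.
      * intros n _; apply half_integer_not_INR.
  - apply (is_lim_seq_psum (fun M n => psum (fun k => c n k *
      psum (fun m => / (half (S m) - INR n) ^ S k + / (- half (S m) - INR n) ^ S k) M) K)).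
    intros n _; apply (is_lim_seq_psum (fun M k => c n k *
      psum (fun m => / (half (S m) - INR n) ^ S k + / (- half (S m) - INR n) ^ S k) M)).
    intros k _; apply is_lim_seq_mult'; [apply is_lim_seq_const|apply half_odd_sum].
Qed.

Lemma kernel_trunc_sum N q : (0 < q)%nat ->
  is_series (fun m => kernel_trunc N q (half (S m)) + kernel_trunc N q (- half (S m)))
    (PI ^ 2 * psum (fun i => 3 * psi_const N (S i) / INR (S i) ^ q - INR q / INR (S i) ^ S q) N
     + PS_mult tan_coef
        (PS_mult (psi_trunc_coef N 0) (PS_mult (psi_trunc_coef N 0) (psi_trunc_coef N 0))) (q + 2)).
Proof.
  intros Hq.
  destruct (has_pole_sum_kernel N q Hq) as [K0 [c0 H0]].
  (* Padding with zero coefficients makes K exceed the actual pole orders, 3 at n >= 1 and q + 3 at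
     0. *)
  set (K := (K0 + (q + 3))%nat).
  set (c := fun n k => if (k <? K0)%nat then c0 n k else 0).
  assert (H : forall s, off_poles N s -> kernel_trunc N q s = pole_sum N K c s).
  { intros s Hs; rewrite H0 by auto; apply pole_sum_extend; unfold K; lia. }
  apply is_series_psum.
  match goal with |- is_lim_seq _ (Finite ?l) =>
    replace l with (psum (fun n => psum (fun k => c n k * tan_coef k) K) (S N)) end.
  { apply pole_sum_half_odd_sum, H. }
  rewrite psum_head, Rplus_comm; f_equal.
  - rewrite <- psum_scal; apply psum_ext; intros i Hi.
    destruct (expands_kernel_trunc_S N q (S i) ltac:(lia)) as [e [He E1]].
    destruct (pole_sum_coef N K c _ (S i) 3 2 e ltac:(lia) ltac:(unfold K; lia) ltac:(lia) H He) as [Z V].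
    rewrite (psum_extend _ 3 K); [|unfold K; lia|].
    (* The weights [tan_coef 0] and [tan_coef 2] vanish, so simple and triple poles drop out, and
       [tan_coef 1] = 2 ttilde 2 = pi^2. *)
    + cbn [psum]; unfold tan_coef at 1 2 3; rewrite (V 1%nat) by lia; cbn [Nat.sub].
      rewrite E1, ttilde_2; simpl ((-1) ^ _); field.
      assert (INR (S i) <> 0) by (pose proof (INR_S_ge i); lra).
      split; auto; apply pow_nonzero; auto.
    + intros k Hk; destruct (Nat.lt_ge_cases k K); [rewrite Z by lia; ring|].
      unfold c; destruct (Nat.ltb_spec k K0); [unfold K in *; lia|ring].
  (* At 0 the expansion is known up to the full order q + 3, so every coefficient is identified. *)
  - destruct (pole_sum_coef N K c _ 0 (q + 3) (q + 3) _ ltac:(lia) ltac:(unfold K; lia) ltac:(lia) H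
      (expands_kernel_trunc_0 N q)) as [Z V].
    rewrite (psum_extend _ (q + 3) K); [|unfold K; lia|].
    + unfold PS_mult at 1; rewrite sum_f_R0_psum.
      replace (S (q + 2)) with (q + 3)%nat by lia; apply psum_ext; intros k Hk.
      rewrite V by lia; rewrite Rmult_comm; do 2 f_equal; lia.
    + intros k Hk; destruct (Nat.lt_ge_cases k K); [rewrite Z by lia; ring|].
      unfold c; destruct (Nat.ltb_spec k K0); [unfold K in *; lia|ring].
Qed.

(** * The coefficients of the Laurent expansion *)


Definition shift1 (F : nat -> R) (n : nat) : R := match n with O => 0 | S m => F m end.

Definition delta0 (n : nat) : R := if (n =? 0)%nat then 1 else 0.

(** Coefficients of the series Z for which [psi_coef] represents 1 + 2 log 2 z - Z, with z acting as
    [shift1]; degrees 0 and 1 are empty. *)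
Definition zeta_coef (n : nat) : R := if (n <? 2)%nat then 0 else zeta n.

Lemma PS_mult_ext_r a b b' n : (forall j, b j = b' j) -> PS_mult a b n = PS_mult a b' n.
Proof.
  intros H; unfold PS_mult; rewrite !sum_f_R0_psum; apply psum_ext; intros; rewrite H; auto.
Qed.

Lemma PS_mult_lin_r a F H c n :
  PS_mult a (fun j => F j + c * shift1 F j - H j) n
  = PS_mult a F n + c * shift1 (PS_mult a F) n - PS_mult a H n.
Proof.
  assert (Sh : PS_mult a (shift1 F) n = shift1 (PS_mult a F) n).
  { unfold PS_mult; rewrite sum_f_R0_psum; destruct n as [|n]; cbn [psum shift1].
    - simpl; ring.
    - rewrite sum_f_R0_psum; cbn [psum]; rewrite Nat.sub_diag; cbn [shift1].
      rewrite Rmult_0_r, Rplus_0_r; apply (f_equal2 Rplus).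
      + apply psum_ext; intros k Hk; replace (S n - k)%nat with (S (n - k)) by lia; reflexivity.
      + replace (S n - n)%nat with 1%nat by lia; rewrite Nat.sub_diag; reflexivity. }
  rewrite <- Sh; unfold PS_mult; rewrite !sum_f_R0_psum, <- psum_scal, <- psum_plus, <- psum_minus.
  apply psum_ext; intros; ring.
Qed.

Lemma PS_mult_psi_coef F n :
  PS_mult psi_coef F n = F n + 2 * ln 2 * shift1 F n - PS_mult zeta_coef F n.
Proof.
  unfold PS_mult; rewrite !sum_f_R0_psum, psum_head, (psum_head (fun k => zeta_coef k * _)).
  change (zeta_coef 0) with 0; rewrite Nat.sub_0_r; destruct n as [|n].
  - simpl; ring.
  - rewrite psum_head, (psum_head (fun i => zeta_coef (S i) * _)).
    change (zeta_coef 1) with 0; cbn [psi_coef shift1].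
    replace (S n - 1)%nat with n by lia.
    rewrite (psum_ext (fun i => - zeta (S (S i)) * F (S n - S (S i))%nat)
      (fun i => - (zeta_coef (S (S i)) * F (S n - S (S i))%nat))).
    + rewrite psum_opp; ring.
    + intros i _; change (zeta_coef (S (S i))) with (zeta (S (S i))); ring.
Qed.

Lemma PS_mult_delta0 a n : PS_mult a delta0 n = a n.
Proof.
  unfold PS_mult; rewrite sum_f_R0_psum; cbn [psum].
  rewrite psum_zero, Nat.sub_diag; [unfold delta0; simpl; ring|].
  intros i Hi; unfold delta0; destruct (Nat.eqb_spec (n - i) 0); [lia|ring].
Qed.

Lemma PS_mult_mult_psi a F n :
  PS_mult a (PS_mult psi_coef F) n
  = PS_mult a F n + 2 * ln 2 * shift1 (PS_mult a F) n - PS_mult a (PS_mult zeta_coef F) n.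
Proof.
  rewrite (PS_mult_ext_r a _ _ n (PS_mult_psi_coef F)); apply PS_mult_lin_r.
Qed.

Lemma PS_mult_mult_zeta_psi a F n :
  PS_mult a (PS_mult zeta_coef (PS_mult psi_coef F)) n
  = PS_mult a (PS_mult zeta_coef F) n + 2 * ln 2 * shift1 (PS_mult a (PS_mult zeta_coef F)) n
    - PS_mult a (PS_mult zeta_coef (PS_mult zeta_coef F)) n.
Proof.
  rewrite (PS_mult_ext_r a _ _ n (PS_mult_mult_psi zeta_coef F)); apply PS_mult_lin_r.
Qed.

Lemma PS_mult_mult_zeta_zeta_psi a F n :
  PS_mult a (PS_mult zeta_coef (PS_mult zeta_coef (PS_mult psi_coef F))) n
  = PS_mult a (PS_mult zeta_coef (PS_mult zeta_coef F)) n
    + 2 * ln 2 * shift1 (PS_mult a (PS_mult zeta_coef (PS_mult zeta_coef F))) n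
    - PS_mult a (PS_mult zeta_coef (PS_mult zeta_coef (PS_mult zeta_coef F))) n.
Proof.
  rewrite (PS_mult_ext_r a _ _ n (PS_mult_mult_zeta_psi zeta_coef F)); apply PS_mult_lin_r.
Qed.

(** The expansion of T (1 + 2 log 2 z - Z)^3 with T the tangent series: Xi holds T Z^i, and a factor
    z^d lowers the index by d. An index of at least 3 leaves room for z^3. *)
Lemma kernel_coef_expand n :
  let X0 := tan_coef in
  let X1 := PS_mult tan_coef zeta_coef in
  let X2 := PS_mult tan_coef (PS_mult zeta_coef zeta_coef) in
  let X3 := PS_mult tan_coef (PS_mult zeta_coef (PS_mult zeta_coef zeta_coef)) in
  kernel_coef (S (S (S n))) =
    X0 (S (S (S n))) + 6 * ln 2 * X0 (S (S n)) + 12 * ln 2 ^ 2 * X0 (S n) + 8 * ln 2 ^ 3 * X0 n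
    - 3 * X1 (S (S (S n))) - 12 * ln 2 * X1 (S (S n)) - 12 * ln 2 ^ 2 * X1 (S n)
    + 3 * X2 (S (S (S n))) + 6 * ln 2 * X2 (S (S n)) - X3 (S (S (S n))).
Proof.
  intros X0 X1 X2 X3.
  set (P0 := fun n => PS_mult_delta0 tan_coef n).
  assert (P1 : forall m, PS_mult tan_coef (PS_mult zeta_coef delta0) m = X1 m)
    by (intros; apply PS_mult_ext_r; intros; apply PS_mult_delta0).
  assert (P2 : forall m, PS_mult tan_coef (PS_mult zeta_coef (PS_mult zeta_coef delta0)) m = X2 m)
    by (intros; do 2 (apply PS_mult_ext_r; intros); apply PS_mult_delta0).
  assert (P3 : forall m, PS_mult tan_coef (PS_mult zeta_coef (PS_mult zeta_coef (PS_mult zeta_coef delta0))) m = X3 m)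
    by (intros; do 3 (apply PS_mult_ext_r; intros); apply PS_mult_delta0).
  (* Appending the unit series gives all three factors the shape psi times F to which the rewriting
     rules apply. *)
  assert (D : forall m, kernel_coef m =
    PS_mult tan_coef (PS_mult psi_coef (PS_mult psi_coef (PS_mult psi_coef delta0))) m).
  { intros; unfold kernel_coef; symmetry; do 3 (apply PS_mult_ext_r; intros); apply PS_mult_delta0. }
  rewrite D.
  repeat first [rewrite PS_mult_mult_zeta_zeta_psi | rewrite PS_mult_mult_zeta_psi
    | rewrite PS_mult_mult_psi | progress cbn [shift1]].
  rewrite !P3, !P2, !P1, !P0; unfold X0; ring.
Qed.

Lemma psum_pairs f M : psum f (2 * M) = psum (fun a => f (2 * a)%nat + f (S (2 * a))) M.
Proof.
  induction M as [|M IH]; [reflexivity|].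
  replace (2 * S M)%nat with (S (S (2 * M))) by lia; cbn [psum]; rewrite IH; ring.
Qed.

(** Only odd indices 2a + 1 survive, with [tan_coef] equal to 2 ttilde (2 (a + 1)). The length M is
    left free so as to match the ranges of [sum2], [sum3] and [sum4]. *)
Lemma PS_mult_tan_coef F n M : (0 < M)%nat -> (n <= 2 * M)%nat ->
  PS_mult tan_coef F n = 2 * psum (fun a => if (2 * a <? n)%nat
     then ttilde (2 * S a) * F (n - S (2 * a))%nat else 0) M.
Proof.
  intros HM Hn; unfold PS_mult; rewrite sum_f_R0_psum.
  assert (Ev : forall a, tan_coef (2 * a) = 0)
    by (intros; unfold tan_coef; rewrite pow_1_even; ring).
  assert (Od : forall a, tan_coef (S (2 * a)) = 2 * ttilde (2 * S a))
    by (intros; unfold tan_coef; rewrite pow_1_odd; replace (2 * S a)%nat with (S (S (2 * a))) by lia; ring).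
  transitivity (psum (fun k => if (k <=? n)%nat then tan_coef k * F (n - k)%nat else 0) (2 * M)).
  - destruct (Nat.eq_dec n (2 * M)) as [->|Ne].
    + cbn [psum]; rewrite Ev, Rmult_0_l, Rplus_0_r; apply psum_ext; intros i Hi.
      destruct (Nat.leb_spec i (2 * M)); auto; lia.
    + rewrite (psum_extend _ (S n) (2 * M)); [|lia|].
      * apply psum_ext; intros i Hi; destruct (Nat.leb_spec i n); auto; lia.
      * intros i Hi; destruct (Nat.leb_spec i n); auto; lia.
  - rewrite psum_pairs, <- psum_scal; apply psum_ext; intros a _.
    rewrite Ev, Od.
    destruct (Nat.leb_spec (2 * a) n), (Nat.leb_spec (S (2 * a)) n), (Nat.ltb_spec (2 * a) n);
      try lia; ring.
Qed.

Lemma PS_mult_zeta_coef F n M : (n <= S M)%nat ->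
  PS_mult zeta_coef F n = psum (fun b => if (S b <? n)%nat
     then zeta (S b + 1) * F (n - S (S b))%nat else 0) M.
Proof.
  intros Hn; unfold PS_mult; rewrite sum_f_R0_psum.
  transitivity (psum (fun k => if (k <=? n)%nat then zeta_coef k * F (n - k)%nat else 0) (S (S M))).
  - rewrite (psum_extend _ (S n) (S (S M))); [|lia|].
    + apply psum_ext; intros i Hi; destruct (Nat.leb_spec i n); auto; lia.
    + intros i Hi; destruct (Nat.leb_spec i n); auto; lia.
  - rewrite !psum_head; change (zeta_coef 0) with 0; change (zeta_coef 1) with 0.
    replace (if (0 <=? n)%nat then 0 * F (n - 0)%nat else 0) with 0 by (destruct (0 <=? n)%nat; ring).
    replace (if (1 <=? n)%nat then 0 * F (n - 1)%nat else 0) with 0 by (destruct (1 <=? n)%nat; ring).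
    rewrite !Rplus_0_l; apply psum_ext; intros b _.
    destruct (Nat.leb_spec (S (S b)) n), (Nat.ltb_spec (S b) n); try lia; auto.
    replace (S b + 1)%nat with (S (S b)) by lia; reflexivity.
Qed.

Lemma psum_solve (G : nat -> R) e N :
  psum (fun c => if (e + S c =? N)%nat then G (S c) else 0) N = if (e <? N)%nat then G (N - e)%nat else 0.
Proof.
  destruct (Nat.ltb_spec e N) as [L|L].
  - rewrite (psum_ext _ (fun c => if (c =? N - S e)%nat then G (S c) else 0)).
    + rewrite (psum_pick (fun c => G (S c))).
      destruct (Nat.ltb_spec (N - S e) N); [f_equal; lia|lia].
    + intros c _; destruct (Nat.eqb_spec (e + S c) N), (Nat.eqb_spec c (N - S e)); auto; lia.
  - apply psum_zero; intros c _; destruct (Nat.eqb_spec (e + S c) N); auto; lia.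
Qed.

(** A count of degrees: ttilde (2 k1) sits in degree 2 k1 - 1 and zeta (k + 1) in degree k + 1, so 2
    k1 + k2 = N is total degree N. Each further zeta factor raises the degree by one, whence S N and
    S (S N) for [sum3] and [sum4]. *)
Lemma sum2_tan N : (0 < N)%nat ->
  PS_mult tan_coef zeta_coef N = 2 * sum2 N (fun k1 k2 => ttilde (2 * k1) * zeta (k2 + 1)).
Proof.
  intros HN; rewrite (PS_mult_tan_coef _ N N) by lia; f_equal.
  unfold sum2; rewrite sum_n_m_psum; apply psum_ext; intros a _.
  rewrite sum_n_m_psum, (psum_solve (fun k => ttilde (2 * S a) * zeta (k + 1))).
  unfold zeta_coef.
  destruct (Nat.ltb_spec (2 * a) N), (Nat.ltb_spec (2 * S a) N),
    (Nat.ltb_spec (N - S (2 * a)) 2); try lia; try ring.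
  do 2 f_equal; lia.
Qed.

Lemma sum3_tan N : (0 < N)%nat ->
  PS_mult tan_coef (PS_mult zeta_coef zeta_coef) (S N)
  = 2 * sum3 N (fun k1 k2 k3 => ttilde (2 * k1) * zeta (k2 + 1) * zeta (k3 + 1)).
Proof.
  intros HN; rewrite (PS_mult_tan_coef _ (S N) N) by lia; f_equal.
  unfold sum3; rewrite sum_n_m_psum; apply psum_ext; intros a _.
  rewrite sum_n_m_psum.
  rewrite (PS_mult_zeta_coef _ _ N) by lia.
  transitivity (psum (fun b => ttilde (2 * S a) * (if (2 * a <? S N)%nat then
     if (S b <? S N - S (2 * a))%nat then zeta (S b + 1) * zeta_coef (S N - S (2 * a) - S (S b)) else 0 else 0)) N).
  - rewrite psum_scal; destruct (2 * a <? S N)%nat; auto.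
    rewrite (psum_zero (fun _ => 0)) by auto; ring.
  - apply psum_ext; intros b _.
    rewrite sum_n_m_psum, (psum_solve (fun k => ttilde (2 * S a) * zeta (S b + 1) * zeta (k + 1))).
    unfold zeta_coef.
    destruct (Nat.ltb_spec (2 * a) (S N)), (Nat.ltb_spec (S b) (S N - S (2 * a))),
      (Nat.ltb_spec (2 * S a + S b) N), (Nat.ltb_spec (S N - S (2 * a) - S (S b)) 2); try lia; try ring.
    rewrite <- Rmult_assoc; do 2 f_equal; lia.
Qed.

Lemma sum4_tan N : (1 < N)%nat ->
  PS_mult tan_coef (PS_mult zeta_coef (PS_mult zeta_coef zeta_coef)) (S (S N))
  = 2 * sum4 N (fun k1 k2 k3 k4 =>
      ttilde (2 * k1) * zeta (k2 + 1) * zeta (k3 + 1) * zeta (k4 + 1)).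
Proof.
  intros HN; rewrite (PS_mult_tan_coef _ (S (S N)) N) by lia; f_equal.
  unfold sum4; rewrite sum_n_m_psum; apply psum_ext; intros a _.
  rewrite sum_n_m_psum.
  rewrite (PS_mult_zeta_coef _ _ N) by lia.
  transitivity (psum (fun b => ttilde (2 * S a) * (if (2 * a <? S (S N))%nat then
     if (S b <? S (S N) - S (2 * a))%nat then
       zeta (S b + 1) * PS_mult zeta_coef zeta_coef (S (S N) - S (2 * a) - S (S b)) else 0 else 0)) N).
  - rewrite psum_scal; destruct (2 * a <? S (S N))%nat; auto.
    rewrite (psum_zero (fun _ => 0)) by auto; ring.
  - apply psum_ext; intros b _.
    rewrite sum_n_m_psum, (PS_mult_zeta_coef _ _ N) by lia.
    transitivity (psum (fun c => ttilde (2 * S a) * zeta (S b + 1) *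
      (if (2 * a <? S (S N))%nat then if (S b <? S (S N) - S (2 * a))%nat then
        if (S c <? S (S N) - S (2 * a) - S (S b))%nat then
          zeta (S c + 1) * zeta_coef (S (S N) - S (2 * a) - S (S b) - S (S c)) else 0 else 0 else 0)) N).
    + rewrite psum_scal; destruct (2 * a <? S (S N))%nat;
        [destruct (S b <? S (S N) - S (2 * a))%nat; [ring|]|];
        rewrite (psum_zero (fun _ => 0)) by auto; ring.
    + apply psum_ext; intros c _.
      rewrite sum_n_m_psum,
        (psum_solve (fun k => ttilde (2 * S a) * zeta (S b + 1) * zeta (S c + 1) * zeta (k + 1))).
      unfold zeta_coef.
      destruct (Nat.ltb_spec (2 * a) (S (S N))), (Nat.ltb_spec (S b) (S (S N) - S (2 * a))),
        (Nat.ltb_spec (S c) (S (S N) - S (2 * a) - S (S b))),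
        (Nat.ltb_spec (2 * S a + S b + S c) N),
        (Nat.ltb_spec (S (S N) - S (2 * a) - S (S b) - S (S c)) 2); try lia; try ring.
      rewrite <- Rmult_assoc; do 2 f_equal; lia.
Qed.

(** The factor 2 from the tangent coefficients doubles the multinomial constants 3, 12, 12, 3, 6, 1
    into 6, 24, 24, 6, 12, 2. *)
Lemma kernel_coef_Rq q : (1 < q)%nat -> kernel_coef (q + 2) = Rq q.
Proof.
  intros Hq; replace (q + 2)%nat with (S (S (S (q - 1)))) by lia.
  rewrite kernel_coef_expand; cbv zeta.
  replace (S (S (S (q - 1)))) with (S (S q)) by lia.
  replace (S (S (q - 1))) with (S q) by lia.
  replace (S (q - 1)) with q by lia.
  rewrite sum4_tan, !sum3_tan, !sum2_tan by lia.
  unfold Rq, tan_coef.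
  replace (q + 3)%nat with (S (S (S q))) by lia.
  replace (q + 2)%nat with (S (S q)) by lia.
  replace (q + 1)%nat with (S q) by lia.
  replace (S (q - 1)) with q by lia.
  assert (E : (-1) ^ (q - 1) = - (-1) ^ q).
  { replace q with (S (q - 1)) at 2 by lia; simpl; ring. }
  rewrite E; simpl ((-1) ^ S _); ring.
Qed.

(** * Passage to the limit *)


(** In truncated subtraction (N - m) + (m - N) is |N - m|. The points m + 1/2 - n descend by unit
    steps: if N >= m the positive ones give h (S m) and the negative ones -h (N - m); otherwise the
    last m - N terms of h (S m) are missing. *)
Lemma psi_trunc_half N m :
  psi_trunc N (half (S m)) = h (S m) + (h N - h ((N - m) + (m - N))).
Proof.
  unfold psi_trunc.
  assert (E : psum (fun n => / (half (S m) - INR n)) (S N) = h (S m) - h ((N - m) + (m - N))).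
  { induction N as [|N IH].
    - rewrite h_S; simpl; rewrite Nat.sub_0_r, Rminus_0_r; ring.
    - change (psum (fun n => / (half (S m) - INR n)) (S (S N)))
        with (psum (fun n => / (half (S m) - INR n)) (S N) + / (half (S m) - INR (S N))).
      rewrite IH; destruct (Nat.le_gt_cases (S N) m) as [L|L].
      + replace (N - m + (m - N))%nat with (S (m - S N)) by lia.
        replace (S N - m + (m - S N))%nat with (m - S N)%nat by lia.
        rewrite (h_S (m - S N)), (half_S (m - S N)), minus_INR, half_S by lia.
        replace (INR m - INR (S N) + 1 / 2) with (INR m + 1 / 2 - INR (S N)) by ring; ring.
      + replace (N - m + (m - N))%nat with (N - m)%nat by lia.
        replace (S N - m + (m - S N))%nat with (S (N - m)) by lia.
        rewrite (h_S (N - m)), (half_S (N - m)), minus_INR, half_S, S_INR by lia.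
        replace (INR m + 1 / 2 - (INR N + 1)) with (- (INR N - INR m + 1 / 2)) by field.
        rewrite Rinv_opp; ring. }
  rewrite E; ring.
Qed.

Lemma psi_trunc_minus_half N m :
  psi_trunc N (- half (S m)) = h m - (h (N + S m) - h N).
Proof.
  unfold psi_trunc.
  assert (E : psum (fun n => / (- half (S m) - INR n)) (S N) = h m - h (N + S m)).
  { rewrite (psum_ext _ (fun n => - / half (S (m + n)))).
    - rewrite psum_opp, !h_psum; replace (N + S m)%nat with (m + S N)%nat by lia.
      rewrite (psum_add _ m (S N)); ring.
    - intros n _; rewrite <- Rinv_opp, !half_S, plus_INR; f_equal; ring. }
  rewrite E; ring.
Qed.

Lemma lim_increment (f : nat -> R) : is_lim_seq (fun N => f (S N) - f N) 0 ->
  forall m, is_lim_seq (fun N => f (N + m)%nat - f N) 0.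
Proof.
  intros H m; induction m as [|m IH].
  - apply is_lim_seq_ext with (fun _ => 0); [intros; rewrite Nat.add_0_r; ring|apply is_lim_seq_const].
  - apply is_lim_seq_ext with (fun N => (f (N + m)%nat - f N) + (f (S (N + m)) - f (N + m)%nat)).
    + intros N; rewrite Nat.add_succ_r; ring.
    + replace (Finite 0) with (Finite (0 + 0)) by (rewrite Rplus_0_l; auto).
      apply is_lim_seq_plus'; auto.
      apply (is_lim_seq_incr_n (fun N => f (S N) - f N) m), H.
Qed.

Lemma lim_decrement (f : nat -> R) : is_lim_seq (fun N => f (S N) - f N) 0 ->
  forall m, is_lim_seq (fun N => f N - f (N - m)%nat) 0.
Proof.
  intros H m; apply (is_lim_seq_incr_n (fun N => f N - f (N - m)%nat) m).
  apply is_lim_seq_ext with (2 := lim_increment f H m); intros N.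
  do 2 f_equal; lia.
Qed.

Lemma h_increment_lim : is_lim_seq (fun N => h (S N) - h N) 0.
Proof.
  apply is_lim_seq_ext with (fun N => / (half N + 1) ^ 1).
  - intros N; rewrite h_S; unfold half; rewrite S_INR, pow_1.
    replace (INR N + 1 - 1 / 2) with (INR N - 1 / 2 + 1) by ring; ring.
  - apply is_lim_seq_inv_pow_infty, is_lim_seq_half_plus.
Qed.

Lemma harm_increment_lim : is_lim_seq (fun N => harm (S N) - harm N) 0.
Proof.
  apply is_lim_seq_ext with (2 := is_lim_seq_inv_INR_S); intros N.
  unfold harm; cbn [psum]; ring.
Qed.

Lemma is_lim_seq_cube (u : nat -> R) (l : R) : is_lim_seq u l -> is_lim_seq (fun n => u n ^ 3) (l ^ 3).
Proof.
  intros H; apply (is_lim_seq_continuous (fun x => x ^ 3)); auto.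
  apply derivable_continuous_pt, derivable_pt_pow.
Qed.

Lemma cube_abs_le x b : Rabs x <= b -> Rabs (x ^ 3) <= b ^ 3.
Proof. intros H; rewrite <- RPow_abs; apply pow_incr; split; auto using Rabs_pos. Qed.

Lemma kernel_trunc_sum_lim q : (1 < q)%nat ->
  is_lim_seq (fun N => Series (fun m => kernel_trunc N q (half (S m)) + kernel_trunc N q (- half (S m))))
    (Series (fun m => h (S m) ^ 3 / half (S m) ^ q + (-1) ^ q * (h m ^ 3 / half (S m) ^ q))).
Proof.
  intros Hq.
  assert (K : forall N m, kernel_trunc N q (half (S m)) + kernel_trunc N q (- half (S m))
    = psi_trunc N (half (S m)) ^ 3 / half (S m) ^ q
      + (-1) ^ q * (psi_trunc N (- half (S m)) ^ 3 / half (S m) ^ q)).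
  { intros N m; unfold kernel_trunc; f_equal.
    replace (- half (S m)) with (-1 * half (S m)) at 2 by ring.
    unfold Rdiv; rewrite Rpow_mult_distr, Rinv_mult, <- pow_inv.
    replace (/ -1) with (-1) by lra; ring. }
  (* Subadditivity with N <= |N - m| + m and |N - m| <= N + m bounds |h N - h |N - m|| by h m,
     uniformly in N. *)
  assert (L : forall N m, Rabs (psi_trunc N (half (S m))) <= 2 * h (S m) /\
                         Rabs (psi_trunc N (- half (S m))) <= 2 * h (S m)).
  { intros N m; rewrite psi_trunc_half, psi_trunc_minus_half.
    pose proof (h_nonneg m); pose proof (h_mono m (S m) ltac:(lia)).
    split; apply Rabs_le.
    - set (d := (N - m + (m - N))%nat).
      pose proof (h_mono N (d + m) ltac:(unfold d; lia)); pose proof (h_subadd d m).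
      pose proof (h_mono d (N + m) ltac:(unfold d; lia)); pose proof (h_subadd N m).
      split; lra.
    - pose proof (h_mono N (N + S m) ltac:(lia)); pose proof (h_subadd N (S m)); split; lra. }
  destruct (tannery (fun N m => kernel_trunc N q (half (S m)) + kernel_trunc N q (- half (S m)))
    (fun m => h (S m) ^ 3 / half (S m) ^ q + (-1) ^ q * (h m ^ 3 / half (S m) ^ q))
    (fun m => 16 * (h (S m) ^ 3 / half (S m) ^ q))) as [_ T]; auto.
  - intros N m; rewrite K; destruct (L N m) as [A B].
    apply cube_abs_le in A; apply cube_abs_le in B.
    pose proof (half_S_ge m); assert (P : 0 < / half (S m) ^ q) by (apply Rinv_0_lt_compat, pow_lt; lra).
    (* 16 = 2 * 2^3: two cubes, each bounded through [L]. *)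
    replace (16 * (h (S m) ^ 3 / half (S m) ^ q))
      with ((2 * h (S m)) ^ 3 * / half (S m) ^ q + (2 * h (S m)) ^ 3 * / half (S m) ^ q)
      by (unfold Rdiv; ring).
    eapply Rle_trans; [apply Rabs_triang|]; unfold Rdiv.
    rewrite !Rabs_mult, pow_1_abs, Rmult_1_l, (Rabs_pos_eq (/ half (S m) ^ q)) by lra.
    apply Rplus_le_compat; apply Rmult_le_compat_r; lra.
  - apply ex_series_Rscal, ex_series_h_cube; auto.
  - intros m; apply is_lim_seq_ext with (fun N => psi_trunc N (half (S m)) ^ 3 / half (S m) ^ q
      + (-1) ^ q * (psi_trunc N (- half (S m)) ^ 3 / half (S m) ^ q)); [intros; rewrite K; auto|].
    pose proof (half_S_ge m).
    assert (L1 : is_lim_seq (fun N => psi_trunc N (half (S m))) (h (S m))).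
    { apply is_lim_seq_ext_loc with (fun N => h (S m) + (h N - h (N - m)%nat)).
      - exists m; intros N HN; rewrite psi_trunc_half.
        replace (N - m + (m - N))%nat with (N - m)%nat by lia; reflexivity.
      - replace (Finite (h (S m))) with (Finite (h (S m) + 0)) by (rewrite Rplus_0_r; auto).
        apply is_lim_seq_plus'; [apply is_lim_seq_const|apply lim_decrement, h_increment_lim]. }
    assert (L2 : is_lim_seq (fun N => psi_trunc N (- half (S m))) (h m)).
    { apply is_lim_seq_ext with (fun N => h m - (h (N + S m)%nat - h N));
        [intros; rewrite psi_trunc_minus_half; auto|].
      replace (Finite (h m)) with (Finite (h m - 0)) by (rewrite Rminus_0_r; auto).
      apply is_lim_seq_minus'; [apply is_lim_seq_const|apply (lim_increment h), h_increment_lim]. }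
    apply is_lim_seq_plus'; [|apply is_lim_seq_mult'; [apply is_lim_seq_const|]];
      apply is_lim_seq_mult'; try apply is_lim_seq_const; apply is_lim_seq_cube; auto.
Qed.

Lemma psi_const_sum_lim q : (1 < q)%nat ->
  ex_series (fun i => 3 * (2 * ln 2 + harm (S i)) / INR (S i) ^ q - INR q / INR (S i) ^ S q) /\
  is_lim_seq (fun N => psum (fun i => 3 * psi_const N (S i) / INR (S i) ^ q - INR q / INR (S i) ^ S q) N)
    (Series (fun i => 3 * (2 * ln 2 + harm (S i)) / INR (S i) ^ q - INR q / INR (S i) ^ S q)).
Proof.
  intros Hq.
  assert (P : forall i p, 0 < / INR (S i) ^ p) by (intros; apply Rinv_0_lt_compat, pow_lt, lt_0_INR; lia).
  apply (tannery_psum (fun N i => 3 * psi_const N (S i) / INR (S i) ^ q - INR q / INR (S i) ^ S q)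
    (fun N => N) _ (fun i => 6 * / INR (S i) ^ q + 6 * (harm (S i) / INR (S i) ^ q) + INR q * / INR (S i) ^ S q)).
  - intros N i Hi; unfold psi_const.
    (* Here psi_const = (h_N - H_N) + H_(i+1) + (H_N - H_(N-i-1)) lies between 0 and 2 + 2 H_(i+1):
       the first bracket is at most 2, the last at most H_(i+1) by subadditivity. *)
    pose proof (h_sub_harm_bounds N); pose proof (harm_nonneg (S i)).
    pose proof (harm_mono (N - S i) N ltac:(lia)).
    pose proof (harm_subadd (N - S i) (S i)) as S1; replace (N - S i + S i)%nat with N in S1 by lia.
    pose proof (P i q); pose proof (P i (S q)); pose proof (pos_INR q).
    unfold Rdiv, Rminus at 1; eapply Rle_trans; [apply Rabs_triang|]; rewrite Rabs_Ropp.
    rewrite (Rabs_pos_eq (INR q * / INR (S i) ^ S q)) by (apply Rmult_le_pos; lra).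
    apply Rplus_le_compat_r; rewrite Rabs_mult, (Rabs_pos_eq (/ _)) by lra.
    replace (6 * / INR (S i) ^ q + 6 * (harm (S i) * / INR (S i) ^ q))
      with ((6 + 6 * harm (S i)) * / INR (S i) ^ q) by ring.
    apply Rmult_le_compat_r; [lra|]; apply Rabs_le; split; lra.
  - intros i; pose proof (P i q); pose proof (P i (S q)); pose proof (pos_INR q); pose proof (harm_nonneg (S i)).
    assert (0 <= harm (S i) * / INR (S i) ^ q) by (apply Rmult_le_pos; lra).
    assert (0 <= INR q * / INR (S i) ^ S q) by (apply Rmult_le_pos; lra).
    unfold Rdiv; lra.
  - apply (ex_series_plus (V := R_NormedModule) (fun i => 6 * / INR (S i) ^ q + 6 * (harm (S i) / INR (S i) ^ q))).
    + apply (ex_series_plus (V := R_NormedModule) (fun i => 6 * / INR (S i) ^ q)); apply ex_series_Rscal.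
      * apply ex_series_inv_INR_pow; auto.
      * apply ex_series_harm; auto.
    + apply ex_series_Rscal, ex_series_inv_INR_pow; lia.
  - intros m; exists (S m); intros N HN; lia.
  - intros i; apply is_lim_seq_minus'; [|apply is_lim_seq_const].
    apply is_lim_seq_mult'; [|apply is_lim_seq_const].
    apply is_lim_seq_mult'; [apply is_lim_seq_const|].
    apply is_lim_seq_ext with (fun N => (h N - harm N) + (harm (S i) + (harm N - harm (N - S i)))).
    + intros N; unfold psi_const; ring.
    + replace (Finite (2 * ln 2 + harm (S i))) with (Finite (2 * ln 2 + (harm (S i) + 0))) by (rewrite Rplus_0_r; auto).
      apply is_lim_seq_plus'; [apply h_sub_harm_lim|].
      apply is_lim_seq_plus'; [apply is_lim_seq_const|apply lim_decrement, harm_increment_lim].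
Qed.

Lemma psi_trunc_coef_lim j : is_lim_seq (fun N => psi_trunc_coef N 0 j) (psi_coef j).
Proof.
  destruct j as [|[|j]].
  - apply is_lim_seq_const.
  - apply is_lim_seq_ext with (2 := h_sub_harm_lim); intros; rewrite psi_trunc_coef_0_1; auto.
  - apply is_lim_seq_ext with (fun N => - psum (fun m => / INR (S m) ^ S (S j)) N);
      [intros; rewrite psi_trunc_coef_0_SS; auto|].
    cbn [psi_coef]; rewrite zeta_Series.
    apply (is_lim_seq_opp _ (Series (fun m => / INR (S m) ^ S (S j)))).
    apply is_series_psum, Series_correct, ex_series_inv_INR_pow; lia.
Qed.

Lemma PS_mult_lim (a b : nat -> nat -> R) (a' b' : nat -> R) n :
  (forall j, is_lim_seq (fun N => a N j) (a' j)) -> (forall j, is_lim_seq (fun N => b N j) (b' j)) ->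
  is_lim_seq (fun N => PS_mult (a N) (b N) n) (PS_mult a' b' n).
Proof.
  intros Ha Hb; unfold PS_mult; rewrite sum_f_R0_psum.
  apply is_lim_seq_ext with (fun N => psum (fun k => a N k * b N (n - k)%nat) (S n));
    [intros; rewrite sum_f_R0_psum; auto|].
  apply (is_lim_seq_psum (fun N k => a N k * b N (n - k)%nat)).
  intros k _; apply is_lim_seq_mult'; auto.
Qed.

(** The two sides are limits of one sequence in N: the truncated kernel summed over the
    half-odd-integers, and the exact value of that sum. *)
Lemma residue_identity q : (1 < q)%nat ->
  Series (fun m => h (S m) ^ 3 / half (S m) ^ q + (-1) ^ q * (h m ^ 3 / half (S m) ^ q))
  = PI ^ 2 * Series (fun i => 3 * (2 * ln 2 + harm (S i)) / INR (S i) ^ q - INR q / INR (S i) ^ S q) + Rq q.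
Proof.
  intros Hq; rewrite <- kernel_coef_Rq by auto.
  pose proof (kernel_trunc_sum_lim q Hq) as L.
  destruct (psi_const_sum_lim q Hq) as [_ L'].
  apply is_lim_seq_ext with (1 := fun N => is_series_unique _ _ (kernel_trunc_sum N q ltac:(lia))) in L.
  pose proof psi_trunc_coef_lim as P.
  pose proof (PS_mult_lim (fun _ => tan_coef) _ _ _ (q + 2) (fun j => is_lim_seq_const _)
    (fun j => PS_mult_lim _ _ _ _ j P (fun j => PS_mult_lim _ _ _ _ j P P))) as L2.
  pose proof (is_lim_seq_plus' _ _ _ _ (is_lim_seq_mult' _ _ _ _ (is_lim_seq_const (PI ^ 2)) L') L2) as L3.
  apply is_lim_seq_unique in L; apply is_lim_seq_unique in L3.
  pose proof (eq_trans (eq_sym L) L3) as E; injection E; auto.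
Qed.

Lemma T1_Series j q : T1 j q = Series (fun m => h m ^ j / half (S m) ^ q).
Proof.
  unfold T1, Series1; apply Series_ext; intros m; simpl (S m - 1)%nat; rewrite Nat.sub_0_r; auto.
Qed.

Lemma ex_series_h_pow j q : (j <= 3)%nat -> (1 < q)%nat ->
  ex_series (fun m => h m ^ j / half (S m) ^ q).
Proof.
  intros Hj Hq; apply ex_series_half_dom with q; auto; exists 1; intros m.
  pose proof (half_S_ge m); assert (P : 0 < / half (S m) ^ q) by (apply Rinv_0_lt_compat, pow_lt; lra).
  rewrite Rmult_1_l; unfold Rdiv; rewrite Rabs_mult, (Rabs_pos_eq (/ _)) by lra.
  apply Rmult_le_compat_r; [lra|].
  rewrite Rabs_pos_eq by (apply pow_le, h_nonneg).
  apply Rle_trans with (h (S m) ^ j).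
  - apply pow_incr; split; [apply h_nonneg|apply h_mono; lia].
  - apply Rle_pow; auto; apply one_le_h_S.
Qed.

(** Cubing h_m = h_(m-1) + 1 / (m - 1/2) yields the four sums, with binomial coefficients 1, 3, 3,
    1. *)
Lemma Series_h_S_cube q : (1 < q)%nat ->
  Series (fun m => h (S m) ^ 3 / half (S m) ^ q + (-1) ^ q * (h m ^ 3 / half (S m) ^ q))
  = (1 + (-1) ^ q) * T1 3 q + 3 * T1 2 (q + 1) + 3 * mttilde [(q + 2)%nat; 1%nat] + ttilde (q + 3).
Proof.
  intros Hq; unfold mttilde; rewrite msum_2, ttilde_Series, !T1_Series.
  rewrite (Series_ext (fun m => psum (fun k => / half (S k)) m / half (S m) ^ (q + 2))
    (fun m => h m ^ 1 / half (S m) ^ (q + 2))) by (intros; rewrite <- h_psum, pow_1; auto).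
  pose proof (ex_series_h_pow 3 q ltac:(lia) Hq) as E3.
  pose proof (ex_series_h_pow 2 (q + 1) ltac:(lia) ltac:(lia)) as E2.
  pose proof (ex_series_h_pow 1 (q + 2) ltac:(lia) ltac:(lia)) as E1.
  pose proof (ex_series_inv_half_pow (q + 3) ltac:(lia)) as E0.
  apply is_series_unique.
  generalize (is_series_plus _ _ _ _ (is_series_plus _ _ _ _ (is_series_plus _ _ _ _
    (is_series_Rscal (1 + (-1) ^ q) _ _ (Series_correct _ E3))
    (is_series_Rscal 3 _ _ (Series_correct _ E2))) (is_series_Rscal 3 _ _ (Series_correct _ E1)))
    (Series_correct _ E0)).
  apply is_series_ext; intros m; rewrite h_S; unfold plus; simpl AbelianMonoid.plus.
  pose proof (half_S_ge m); assert (half (S m) ^ q <> 0) by (apply pow_nonzero; lra).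
  rewrite !pow_add; match goal with |- ?a = ?b => change (@eq R a b) end.
  simpl; field; split; auto; lra.
Qed.

(** H_n = H_(n-1) + 1 / n: the first part gives zeta (q, 1), and three times the second turns -q
    zeta (q + 1) into -(q - 3) zeta (q + 1). *)
Lemma Series_harm_weighted q : (1 < q)%nat ->
  Series (fun i => 3 * (2 * ln 2 + harm (S i)) / INR (S i) ^ q - INR q / INR (S i) ^ S q)
  = 3 * (mzeta [q; 1%nat] + 2 * ln 2 * zeta q) - (INR q - 3) * zeta (q + 1).
Proof.
  intros Hq; unfold mzeta; rewrite msum_2, !zeta_Series; fold harm.
  change (fun m => psum (fun k => / INR (S k)) m / INR (S m) ^ q) with (fun m => harm m / INR (S m) ^ q).
  assert (EH : ex_series (fun m => harm m / INR (S m) ^ q)).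
  { apply ex_series_dom with (2 := ex_series_harm q Hq); intros m.
    assert (P : 0 < / INR (S m) ^ q) by (apply Rinv_0_lt_compat, pow_lt, lt_0_INR; lia).
    pose proof (harm_nonneg m); pose proof (harm_mono m (S m) ltac:(lia)).
    rewrite Rabs_pos_eq by (apply Rmult_le_pos; lra); apply Rmult_le_compat_r; lra. }
  pose proof (ex_series_inv_INR_pow q Hq) as E0.
  pose proof (ex_series_inv_INR_pow (q + 1) ltac:(lia)) as E1.
  apply is_series_unique.
  replace (3 * (Series (fun m => harm m / INR (S m) ^ q) + 2 * ln 2 * Series (fun m => / INR (S m) ^ q)) -
    (INR q - 3) * Series (fun m => / INR (S m) ^ (q + 1)))
    with (3 * Series (fun m => harm m / INR (S m) ^ q) + 6 * ln 2 * Series (fun m => / INR (S m) ^ q)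
     + (3 - INR q) * Series (fun m => / INR (S m) ^ (q + 1))) by ring.
  generalize (is_series_plus _ _ _ _ (is_series_plus _ _ _ _
    (is_series_Rscal 3 _ _ (Series_correct _ EH)) (is_series_Rscal (6 * ln 2) _ _ (Series_correct _ E0)))
    (is_series_Rscal (3 - INR q) _ _ (Series_correct _ E1))).
  apply is_series_ext; intros m; unfold plus; simpl AbelianMonoid.plus.
  change (harm (S m)) with (harm m + / INR (S m)).
  assert (INR (S m) <> 0) by (pose proof (INR_S_ge m); lra).
  assert (INR (S m) ^ q <> 0) by (apply pow_nonzero; auto).
  replace (q + 1)%nat with (S q) by lia; rewrite <- tech_pow_Rmult.
  match goal with |- ?a = ?b => change (@eq R a b) end.
  set (x := INR (S m)) in *; cbn; field; auto.
Qed.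

Theorem theorem2p9 : forall q : nat, (1 < q)%nat ->
  (1 + (-1) ^ q) * T1 3 q =
    3 * PI ^ 2 * (mzeta [q; 1%nat] + 2 * ln 2 * zeta q)
    - (INR q - 3) * PI ^ 2 * zeta (q + 1)
    - 3 * T1 2 (q + 1) - 3 * mttilde [(q + 2)%nat; 1%nat] - ttilde (q + 3) + Rq q
  /\ is_residue (kernel q) 0%C (RtoC (Rq q)).
Proof.
  intros q Hq; split.
  - pose proof (residue_identity q Hq) as E.
    rewrite Series_h_S_cube, Series_harm_weighted in E by auto; lra.
  - rewrite <- kernel_coef_Rq by auto; apply kernel_is_residue.
Qed.
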